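(* Let $F,G\in\mathcal{F}(\mathbb{R})$ and let $W$ be a weight function system. Let $\mathcal{A}(\mathbb{R})$ be the space of real analytic functions on $\mathbb{R}$ endowed with its natural locally convex topology. The map $\overline\partial:\mathcal{K}_W(T^{F,G};\mathcal{A}(\mathbb{R}))\to\mathcal{K}_W(T^{F,G};\mathcal{A}(\mathbb{R}))$ is not surjective.
   Context: $\overline\partial=\frac12\left(\frac{\partial}{\partial x}+i\frac{\partial}{\partial y}\right)$. $\mathcal{F}(\mathbb{R})$ is the set of all uniformly continuous $F:\mathbb{R}\to[0,\infty)$ with $0<\inf_{t}F(t)\le\sup_{t}F(t)<\infty$. For $F,G\in\mathcal{F}(\mathbb{R})$, $T^{F,G}=\{z\in\mathbb{C}: -G(\mathrm{Re}\,z)<\mathrm{Im}\,z<F(\mathrm{Re}\,z)\}$. A weight function is a non-decreasing unbounded function $w:[0,\infty)\to[0,\infty)$; a weight function system is a sequence $W=(w_N)_{N\in\mathbb{N}}$ of weight functions with $w_N\le w_{N+1}$ pointwise. For a locally convex Hausdorff space $E$, $\mathcal{K}_W(T^{F,G};E)$ is the space of all $\mathbf{f}\in C^\infty(T^{F,G};E)$ such that $\sup_{\xi\in\overline{T^{aF,aG}}}e^{w_N(|\mathrm{Re}\,\xi|)}p(\mathbf{f}^{(\alpha)}(\xi))<\infty$ for all continuous seminorms $p$ on $E$, all $N\in\mathbb{N}$, all multi-indices $\alpha$ (pairs of non-negative integers) and all $a\in(0,1)$. The natural topology of $\mathcal{A}(\mathbb{R})$ is that of the projective limit $\mathcal{A}(\mathbb{R})=\varprojlim_{n}\mathcal{H}([-n,n])$,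 where $\mathcal{H}([-n,n])$ is the space of germs of holomorphic functions on the compact set $[-n,n]\subseteq\mathbb{C}$ with its usual (locally convex inductive limit) topology. *)

(* Defs.v *)
From HB Require Import structures.
From mathcomp Require Import all_boot all_order all_algebra.
From mathcomp Require Import all_classical all_reals all_analysis.
From mathcomp Require Import complex.

Set Implicit Arguments.
Unset Strict Implicit.
Unset Printing Implicit Defensive.

Import Order.TTheory GRing.Theory Num.Theory.
Import numFieldNormedType.Exports.
Import Normc.

Local Open Scope classical_set_scope.
Local Open Scope ring_scope.
Local Open Scope complex_scope.
Local Open Scope quotient_scope.

(** In [tvsType K] local convexity is part of the structure, so
    [tvsType R[i]] is the type of complex locally convex spaces.  The complex
    plane, as a topological space, is the regular module [R[i]^o]. *)

(** * Seminorms and the locally convex topology that they generate *)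

Record seminorm (R : realType) (E : lmodType R[i]) := Seminorm {
  seminorm_fun :> E -> R ;
  seminormD : forall x y,
    seminorm_fun (x + y) <= seminorm_fun x + seminorm_fun y ;
  seminormZ : forall a x, seminorm_fun (a *: x) = normc a * seminorm_fun x }.

HB.instance Definition _ (R : realType) (E : lmodType R[i]) :=
  gen_eqMixin (seminorm E).
HB.instance Definition _ (R : realType) (E : lmodType R[i]) :=
  gen_choiceMixin (seminorm E).

Section SeminormTheory.
Context (R : realType) (E : lmodType R[i]).
Implicit Types (p : seminorm E) (x y : E).

Lemma seminorm0 p : p 0 = 0.
Proof. by rewrite -(scale0r 0) seminormZ normc0 mul0r. Qed.

Lemma seminormN p x : p (- x) = p x.
Proof. by rewrite -scaleN1r seminormZ (normcN (1 : R[i])) normc1 mul1r. Qed.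

Lemma seminorm_ge0 p x : 0 <= p x.
Proof.
have := seminormD p x (- x).
by rewrite subrr seminorm0 seminormN -mulr2n pmulrn_lge0.
Qed.

Lemma seminormBC p x y : p (x - y) = p (y - x).
Proof. by rewrite -seminormN opprB. Qed.

Lemma seminorm_triangle p x y z : p (x - z) <= p (x - y) + p (y - z).
Proof. by rewrite -[x - z](subrKA y); exact: seminormD. Qed.

End SeminormTheory.

(** [lctop P] is [E] with the coarsest locally convex topology for which all
    the seminorms in [P] are continuous. *)
Definition lctop (R : realType) (E : lmodType R[i]) (P : set (seminorm E)) :
  Type := E.

Section LocallyConvexTopology.
Context (R : realType) (E : lmodType R[i]) (P : set (seminorm E)).
Local Notation L := (lctop P).

HB.instance Definition _ := GRing.Lmodule.on L.

Definition seminorm_ball (s : seq (seminorm E)) (e : R) (x : E) : set L :=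
  [set y | forall p, p \in s -> p (y - x) < e].

Definition lctop_nbhs (x : L) : set_system L :=
  [set A | exists s : seq (seminorm E), (forall p, p \in s -> P p) /\
     exists2 e : R, 0 < e & seminorm_ball s e x `<=` A].

HB.instance Definition _ := hasNbhs.Build L lctop_nbhs.

Lemma seminorm_ball_center s e x : 0 < e -> seminorm_ball s e x x.
Proof. by move=> e0 p _; rewrite subrr seminorm0. Qed.

Lemma seminorm_ball_nbhs s e x : (forall p, p \in s -> P p) -> 0 < e ->
  nbhs (x : L) (seminorm_ball s e x).
Proof. by move=> sP e0; exists s; split => //; exists e. Qed.

Let lctop_filter (x : L) : ProperFilter (nbhs x).
Proof.
split.
  by case=> s [_] [e e0] /(_ x); apply; exact: seminorm_ball_center.
split.
- by exists [::]; split => //; exists 1.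
- move=> A B [s [sP [e e0 sA]]] [t [tP [d d0 tB]]].
  exists (s ++ t); split.
    by move=> p; rewrite mem_cat => /orP[/sP|/tP].
  exists (Num.min e d); first by rewrite lt_min e0.
  move=> y yst; split; [apply: sA | apply: tB] => p ps.
    have := yst p; rewrite mem_cat ps => /(_ isT).
    by rewrite lt_min => /andP[].
  have := yst p; rewrite mem_cat ps orbT => /(_ isT).
  by rewrite lt_min => /andP[].
- move=> A B AB [s [sP [e e0 sA]]]; exists s; split => //; exists e => //.
  exact: subset_trans AB.
Qed.

Let lctop_nbhs_singleton (x : L) (A : set L) : nbhs x A -> A x.
Proof. by case=> s [_] [e e0]; apply; exact: seminorm_ball_center. Qed.

(* a finite set of strict inequalities leaves a uniform margin *)
Let margin (s : seq (seminorm E)) (e : R) (x y : E) :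
  0 < e -> seminorm_ball s e x y ->
  exists2 d : R, 0 < d & (forall p, p \in s -> p (y - x) + d <= e).
Proof.
move=> e0; elim: s => [|p s IHs] ys; first by exists 1.
have [|d d0 ds] := IHs; first by move=> q qs; apply: ys; rewrite inE qs orbT.
have yp : 0 < e - p (y - x) by rewrite subr_gt0 ys// mem_head.
exists (Num.min d (e - p (y - x))); first by rewrite lt_min d0.
move=> q; rewrite inE => /predU1P[->|/ds].
  by rewrite -lerBrDl ge_min lexx orbT.
by apply: le_trans; rewrite lerD2l ge_min lexx.
Qed.

Let ball_sub (s : seq (seminorm E)) (d e : R) (x y : E) :
  (forall p, p \in s -> p (y - x) + d <= e) ->
  seminorm_ball s d y `<=` seminorm_ball s e x.
Proof.
move=> yd z zy p ps; apply: le_lt_trans (seminorm_triangle p z y x) _.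
by rewrite addrC (lt_le_trans _ (yd p ps))// ltrD2l zy.
Qed.

Let lctop_nbhs_nbhs (x : L) (A : set L) : nbhs x A -> nbhs x (nbhs^~ A).
Proof.
case=> s [sP [e e0 sA]]; exists s; split => //; exists e => // y ys.
have [d d0 yd] := margin e0 ys.
exists s; split => //; exists d => //.
by apply: subset_trans sA; exact: ball_sub.
Qed.

HB.instance Definition _ := Nbhs_isNbhsTopological.Build L
  lctop_filter lctop_nbhs_singleton lctop_nbhs_nbhs.

Let lctop_add_continuous : continuous (fun z : L * L => z.1 + z.2).
Proof.
move=> [x y] /= A [s [sP [e e0 sA]]].
have e20 : 0 < e / 2 by rewrite divr_gt0.
exists (seminorm_ball s (e / 2) x, seminorm_ball s (e / 2) y).
  by split; exact: seminorm_ball_nbhs.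
move=> [u v] /= [us vs]; apply: sA => p ps.
rewrite opprD addrACA (le_lt_trans (seminormD _ _ _))//.
by rewrite [ltRHS]splitr ltrD// ?us ?vs.
Qed.

Let normc_lt (a : R[i]) (d : R) : (`|a| < d%:C) = (normc a < d).
Proof. by case: a => a b; rewrite normc_def ltcR. Qed.

Let lctop_scale_continuous : continuous (fun z : R[i]^o * L => z.1 *: z.2).
Proof.
move=> [a x] /= A [s [sP [e e0 sA]]].
pose M := 1 + \sum_(p <- s) p x.
have M0 : 0 < M.
  by rewrite ltr_pwDl// sumr_ge0// => p _; exact: seminorm_ge0.
have pM : forall p, p \in s -> p x <= M.
  move=> p ps; rewrite /M (big_rem p)//= addrCA lerDl addr_ge0//.
  by rewrite sumr_ge0// => q _; exact: seminorm_ge0.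
pose d := Num.min 1 (e / 2 / M).
have d0 : 0 < d by rewrite lt_min ltr01/= !divr_gt0.
pose D := normc a + 1.
have a0 : 0 <= normc a by case: (a) => u v; exact: sqrtr_ge0.
have D0 : 0 < D by rewrite ltr_wpDl.
exists (ball (a : R[i]^o) d%:C, seminorm_ball s (e / 2 / D) x).
  split; last by apply: seminorm_ball_nbhs => //; rewrite !divr_gt0.
  by apply: nbhsx_ballx; rewrite ltcR.
move=> [b y] /= [ab yx]; apply: sA => p ps.
have ba : normc (b - a) < d.
  by rewrite -normc_lt distrC; move: ab; rewrite -ball_normE.
have bD : normc b <= D.
  rewrite -[b](subrK a) (le_trans (le_normcD _ _))// addrC lerD2l.
  by rewrite (le_trans (ltW ba))// ge_min lexx.
rewrite -[b *: y - _](subrKA (b *: x)) -scalerBr -scalerBl.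
rewrite (le_lt_trans (seminormD _ _ _))// !seminormZ [ltRHS]splitr.
rewrite ltr_leD//.
  apply: (@le_lt_trans _ _ (D * p (y - x))).
    by rewrite ler_wpM2r// seminorm_ge0.
  by rewrite mulrC -ltr_pdivlMr// yx.
apply: (@le_trans _ _ (e / 2 / M * M)); last by rewrite divfK// gt_eqF.
rewrite ler_pM ?seminorm_ge0 ?pM//.
  by case: (b - a) => u v; exact: sqrtr_ge0.
by rewrite (le_trans (ltW ba))// ge_min lexx orbT.
Qed.

Let lctop_locally_convex : exists2 B : set_system L,
  (forall b, b \in B -> convex_set b) & basis B.
Proof.
exists [set A | exists s e x, [/\ (forall p, p \in s -> P p), 0 < e &
  A = seminorm_ball s e x]].
  move=> A; rewrite inE => -[s [e [x [sP e0 ->]]]].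
  apply/convex_setW => y z; rewrite !inE => yx zx l l0 l1; rewrite inE => p ps.
  rewrite -[conv _ _ _]/(l%:num *: (y : E) + (1 - l%:num) *: (z : E)).
  move: l%:num l0 l1 => k k0 k1.
  have /complex_realP[t kt] : k \is Num.real by rewrite gtr0_real.
  move: k0 k1; rewrite {k}kt !ltcR => t0 t1.
  have -> : t%:C *: (y : E) + (1 - t%:C) *: (z : E) - x =
      t%:C *: ((y : E) - x) + (1 - t)%:C *: ((z : E) - x).
    rewrite !scalerBr addrACA -opprD -scalerDl -rmorphB/= -rmorphD/=.
    by rewrite subrKC rmorph1 scale1r rmorphB rmorph1.
  have normcR (r : R) : 0 <= r -> normc r%:C = r.
    by move=> r0; rewrite /normc/= expr0n/= addr0 sqrtr_sqr ger0_norm.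
  rewrite (le_lt_trans (seminormD _ _ _))// !seminormZ !normcR ?subr_ge0 ?ltW//.
  rewrite -[ltRHS]mul1r -[1 in ltRHS](subrKC t) [ltRHS]mulrDl.
  by rewrite ltrD// ltr_pM2l ?subr_gt0// ?yx ?zx.
split.
  move=> _ [s [e [x [sP e0 ->]]]]; rewrite openE => y ys.
  have [d d0 yd] := margin e0 ys.
  by exists s; split => //; exists d => //; exact: ball_sub.
move=> x A [s [sP [e e0 sA]]]; exists (seminorm_ball s e x) => //.
by split; [exists s, e, x | exact: seminorm_ball_center].
Qed.

HB.instance Definition _ := PreTopologicalLmod_isTvs.Build R[i] L
  lctop_add_continuous lctop_scale_continuous lctop_locally_convex.
(* this factory only provides the uniform structure *)
HB.instance Definition _ :=
  PreTopologicalNmodule_isTopologicalNmodule.Build L lctop_add_continuous.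
HB.instance Definition _ :=
  TopologicalNmodule_isTopologicalLmodule.Build R[i] L lctop_scale_continuous.
HB.instance Definition _ := Uniform_isTvs.Build R[i] L lctop_locally_convex.

Lemma lctop_continuous (p : seminorm E) : P p -> continuous (p : L -> R).
Proof.
move=> Pp x; have xF := lctop_filter x; apply/cvgrPdist_lt => e e0.
have pP q : q \in [:: p] -> P q by rewrite inE => /eqP ->.
apply: filterS (seminorm_ball_nbhs x pP e0) => y /(_ p (mem_head _ _)) yx.
apply: le_lt_trans yx; rewrite ler_distl lerBlDr.
have px (u v : E) : p u <= p (u - v) + p v by rewrite -{1}[u](subrK v) seminormD.
by rewrite addrC px addrC seminormBC px.
Qed.

Lemma lctop_hausdorff :
  (forall x : E, (forall p, P p -> p x = 0) -> x = 0) -> hausdorff_space L.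
Proof.
move=> P0 x y xy; apply/eqP; rewrite -subr_eq0; apply/eqP.
apply: P0 => p Pp; have := seminorm_ge0 p (x - y).
rewrite le_eqVlt => /predU1P[//|pxy]; exfalso.
have [] := xy (seminorm_ball [:: p] (p (x - y) / 2) x)
             (seminorm_ball [:: p] (p (x - y) / 2) y).
- by apply: seminorm_ball_nbhs; rewrite ?divr_gt0// => q; rewrite inE => /eqP ->.
- by apply: seminorm_ball_nbhs; rewrite ?divr_gt0// => q; rewrite inE => /eqP ->.
move=> z [/(_ p (mem_head _ _)) zx /(_ p (mem_head _ _)) zy].
have := seminorm_triangle p x z y; rewrite leNgt [X in _ < X]splitr.
by rewrite ltrD// seminormBC.
Qed.

End LocallyConvexTopology.

(** * Germs of holomorphic functions on a subset of the complex plane *)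

Section Germs.
Context (R : realType) (K : set R[i]^o).
Local Notation C := R[i]^o.

Definition holomorphic_near : {pred C -> C} :=
  fun f => `[< forall z, K z -> \forall w \near z, derivable f w 1 >].

Fact holomorphic_near_submod : submod_closed holomorphic_near.
Proof.
split; first by apply/asboolP => z _; near=> w; exact: derivable_cst.
move=> a f g /asboolP fK /asboolP gK; apply/asboolP => z Kz.
apply: filterS2 (fK z Kz) (gK z Kz) => w fw gw.
exact: (@derivableD _ _ _ (a *: f) g w 1
  (@derivableZ _ _ _ f a w 1 fw) gw).
Unshelve. all: by end_near. Qed.

HB.instance Definition _ := GRing.isSubmodClosed.Build R[i] (C -> C)
  holomorphic_near holomorphic_near_submod.

Record hol := Hol { hol_fun :> C -> C ; _ : hol_fun \in holomorphic_near }.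

HB.instance Definition _ := [isSub for hol_fun].
HB.instance Definition _ := [Choice of hol by <:].
HB.instance Definition _ := [SubChoice_isSubLmodule of hol by <:].

Definition vanishing_near : {pred hol} :=
  fun f => `[< forall z, K z -> \forall w \near z, f w = 0 >].

Fact vanishing_near_submod : submod_closed vanishing_near.
Proof.
split; first by apply/asboolP => z _; near=> w.
move=> a f g /asboolP fK /asboolP gK; apply/asboolP => z Kz.
near=> w; rewrite /= -[LHS]/(a *: f w + g w).
by rewrite (near (fK z Kz) w)// (near (gK z Kz) w)// scaler0 addr0.
Unshelve. all: by end_near. Qed.

HB.instance Definition _ := GRing.isSubmodClosed.Build R[i] hol
  vanishing_near vanishing_near_submod.

Local Notation Q := (Quotient.quot vanishing_near).

Definition germ_scale (a : R[i]) (x : Q) : Q := \pi_Q (a *: repr x).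

Fact pi_scale a (f : hol) : germ_scale a (\pi_Q f) = \pi_Q (a *: f).
Proof.
apply/eqP; rewrite -Quotient.idealrBE -scalerBr rpredZ//.
by rewrite Quotient.idealrBE reprK.
Qed.

Fact germ_scaleA a b x : germ_scale a (germ_scale b x) = germ_scale (a * b) x.
Proof. by rewrite -[x]reprK [germ_scale b _]pi_scale !pi_scale scalerA. Qed.

Fact germ_scale1 : left_id 1 germ_scale.
Proof. by move=> x; rewrite -[x]reprK pi_scale scale1r. Qed.

Fact germ_scaleDr : right_distributive germ_scale +%R.
Proof.
move=> a x y; rewrite -[x]reprK -[y]reprK -raddfD !pi_scale scalerDr.
by rewrite raddfD.
Qed.

Fact germ_scaleDl x : {morph germ_scale^~ x : a b / a + b}.
Proof. by move=> a b; rewrite -[x]reprK !pi_scale scalerDl raddfD. Qed.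

HB.instance Definition _ := GRing.Zmodule_isLmodule.Build R[i] Q
  germ_scaleA germ_scale1 germ_scaleDr germ_scaleDl.

(** The locally convex inductive limit of the Banach spaces of bounded
    holomorphic functions on [U], over the open neighbourhoods [U] of [K], is
    given by all the seminorms whose restriction to each of these spaces is
    continuous. *)
Definition inductive_seminorms : set (seminorm Q) :=
  [set q : seminorm Q | forall U : set C, open U -> K `<=` U -> exists c : R,
     forall (f : hol) (M : R),
       (forall w, U w -> derivable f w 1 /\ normc (f w) <= M) ->
       q (\pi_Q f) <= c * M].

Definition germ : tvsType R[i] := lctop inductive_seminorms.

Definition germ_of (f : hol) : germ := \pi_Q f.

Lemma germ_val (f : hol) z : K z -> repr (\pi_Q f) z = f z.
Proof.
move=> Kz; have : repr (\pi_Q f) - f \in vanishing_near.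
  by rewrite Quotient.idealrBE reprK.
move=> /asboolP/(_ z Kz)/nbhs_singleton.
rewrite -[LHS]/(repr (\pi_Q f) z - f z) => /eqP.
by rewrite subr_eq0 => /eqP.
Qed.

Section Evaluation.
Context (z : C) (Kz : K z).

Definition germ_eval (x : Q) : R := normc (repr x z).

Fact germ_evalD x y : germ_eval (x + y) <= germ_eval x + germ_eval y.
Proof.
rewrite /germ_eval -{1}[x]reprK -{1}[y]reprK -raddfD germ_val//.
exact: le_normcD.
Qed.

Fact germ_evalZ a x : germ_eval (a *: x) = normc a * germ_eval x.
Proof.
by rewrite /germ_eval -{1}[x]reprK [_ *: _]pi_scale germ_val// -normcM.
Qed.

Definition eval_seminorm : seminorm Q := Seminorm germ_evalD germ_evalZ.

Lemma eval_seminormE (f : hol) : eval_seminorm (\pi_Q f) = normc (f z).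
Proof. by rewrite /= /germ_eval germ_val. Qed.

Lemma eval_seminorm_continuous : continuous (eval_seminorm : germ -> R).
Proof.
apply: lctop_continuous => U _ KU; exists 1 => f M fM.
by rewrite mul1r eval_seminormE; case: (fM z (KU z Kz)).
Qed.

End Evaluation.

End Germs.

(** * Real analytic functions *)

Section RealAnalytic.
Context (R : realType).
Local Notation C := R[i]^o.

Definition is_real_analytic : {pred R -> C} :=
  fun f => `[< forall x : R, exists a : nat -> C, \forall y \near x,
    series (fun k => a k * (y - x)%:C ^+ k) @ \oo --> f y >].

Fact is_real_analytic_submod : submod_closed is_real_analytic.
Proof.
split.
  apply/asboolP => x; exists (fun=> 0); near=> y.
  rewrite (_ : series _ = fun=> 0); first exact: cvg_cst.
  by apply/funext => n; rewrite /series/= big1// => k _; rewrite mul0r.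
move=> c f g /asboolP fA /asboolP gA; apply/asboolP => x.
have [a fa] := fA x; have [b gb] := gA x.
exists (fun k => c * a k + b k); apply: filterS2 fa gb => y ya yb.
rewrite (_ : series _ = (fun n => c *: series (fun k => a k * (y - x)%:C ^+ k) n
  + series (fun k => b k * (y - x)%:C ^+ k) n)); last first.
  apply/funext => n; rewrite /series/= scaler_sumr -big_split/=.
  by apply: eq_bigr => k _; rewrite mulrDl -mulrA.
exact: (@cvgD _ C _ _ _ _ _ _ _ (@cvgZl_tmp _ C _ _ _ c _ _ ya) yb).
Unshelve. all: by end_near. Qed.

HB.instance Definition _ := GRing.isSubmodClosed.Build R[i] (R -> C)
  is_real_analytic is_real_analytic_submod.

Record ranalytic :=
  RAnalytic { ranalytic_fun :> R -> C ; _ : ranalytic_fun \in is_real_analytic }.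

HB.instance Definition _ := [isSub for ranalytic_fun].
HB.instance Definition _ := [Choice of ranalytic by <:].
HB.instance Definition _ := [SubChoice_isSubLmodule of ranalytic by <:].

Definition segment (n : nat) : set C := [set x%:C | x in `[- n%:R, n%:R]].

(** [g] is a holomorphic extension of [f] to a neighbourhood of [[-n, n]];
    every [f] has one, and its germ is determined by [f]. *)
Definition extends (n : nat) (f : ranalytic) (g : hol (segment n)) : Prop :=
  forall x : R, x \in `[- n%:R, n%:R] -> \forall y \near x, g y%:C = f y.

(** The seminorms obtained by composing the map that sends a real analytic
    function to its germ on [[-n, n]] with a continuous seminorm on the space
    of germs: they give the projective limit topology. *)
Definition projective_seminorms : set (seminorm ranalytic) :=
  [set p : seminorm ranalytic | exists n (q : seminorm (germ (segment n))),
     continuous (q : germ (segment n) -> R) /\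
     forall f g, extends f g -> p f = q (germ_of g)].

Definition real_analytic : tvsType R[i] := lctop projective_seminorms.

Section Evaluation.
Context (x : R).

Fact ranalytic_evalD (f g : ranalytic) :
  normc ((f + g) x) <= normc (f x) + normc (g x).
Proof. exact: le_normcD. Qed.

Fact ranalytic_evalZ (a : R[i]) (f : ranalytic) :
  normc ((a *: f) x) = normc a * normc (f x).
Proof. exact: normcM. Qed.

Definition ranalytic_eval : seminorm ranalytic :=
  Seminorm ranalytic_evalD ranalytic_evalZ.

Lemma ranalytic_eval_projective : projective_seminorms ranalytic_eval.
Proof.
pose n := Num.bound `|x|.
have xn : x \in `[- n%:R, n%:R].
  by rewrite in_itv/= -ler_norml ltW// archi_boundP.
have Kx : segment n x%:C by exists x.
exists n, (eval_seminorm Kx); split; first exact: eval_seminorm_continuous.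
by move=> f g /(_ x xn)/nbhs_singleton fg; rewrite eval_seminormE fg.
Qed.

End Evaluation.

Lemma real_analytic_hausdorff : hausdorff_space real_analytic.
Proof.
apply: lctop_hausdorff => f f0; apply/val_inj/funext => x.
by apply/eq0_normc/(f0 _ (ranalytic_eval_projective x)).
Qed.

End RealAnalytic.

(** * Smooth functions with values in a locally convex space *)

Section SmoothFunctions.
Context (R : realType) (E : tvsType R[i]).
Local Notation C := R[i]^o.
Implicit Types (f : C -> E) (z v : C) (T : set C).

(** Difference quotient for a real increment [h] in the direction [v]: the
    partial derivatives with respect to [x] and [y] are those in the directions
    [1] and ['i]. *)
Definition diff_quotient v f z (h : R) : E :=
  (h^-1)%:C *: (f (z + h%:C * v) - f z).

Definition is_pderiv v f z (l : E) := diff_quotient v f z h @[h --> 0^'] --> l.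

Definition pderivable v f z := exists l, is_pderiv v f z l.

Definition pderiv v f : C -> E := fun z => xget 0 (is_pderiv v f z).

Definition iter_pderiv (s : seq bool) f : C -> E :=
  foldr (fun b => pderiv (if b then 'i%C else 1)) f s.

(** All the iterated partial derivatives, in any order, exist and are
    continuous on [T], which is meant to be open. *)
Definition smooth_on T f := forall (s : seq bool) z, T z ->
  [/\ {for z, continuous (iter_pderiv s f)},
      pderivable 1 (iter_pderiv s f) z &
      pderivable 'i%C (iter_pderiv s f) z].

Definition mderiv (a : nat * nat) f : C -> E :=
  iter a.1 (pderiv 1) (iter a.2 (pderiv 'i%C) f).

Definition dbar f : C -> E := fun z =>
  2^-1 *: (pderiv 1 f z + 'i%C *: pderiv 'i%C f z).

End SmoothFunctions.

(** * Weighted spaces on strips *)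

Section WeightedSpaces.
Context (R : realType).
Local Notation C := R[i]^o.
Implicit Types (F G : R -> R) (w : R -> R) (W : nat -> R -> R).

Definition strip_profile F :=
  [/\ forall t, 0 <= F t, unif_continuous F,
      0 < inf (range F) & has_ubound (range F)].

Definition strip F G : set C :=
  [set z | - G (complex.Re z) < complex.Im z < F (complex.Re z)].

(** Only the values on [[0, +oo)] matter. *)
Definition weight_function w :=
  [/\ forall x, 0 <= x -> 0 <= w x,
      forall x y, 0 <= x -> x <= y -> w x <= w y &
      forall M, exists2 x, 0 <= x & M < w x].

Definition weight_system W :=
  (forall N, weight_function (W N)) /\
  (forall N x, 0 <= x -> W N x <= W N.+1 x).

(** The elements of the weighted space are represented by functions on the
    whole plane, of which only the restriction to the strip is relevant.  The
    space [E] is meant to be Hausdorff, so that derivatives are unique. *)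
Definition weighted_space W F G (E : tvsType R[i]) : set (C -> E) :=
  [set f | smooth_on (strip F G) f /\
    forall (p : seminorm E), continuous (p : E -> R) ->
    forall (N : nat) (a : nat * nat) (r : R), 0 < r < 1 ->
    has_ubound [set expR (W N `|complex.Re z|) * p (mderiv a f z) |
      z in closure (strip (fun t => r * F t) (fun t => r * G t))]].

End WeightedSpaces.

(* Main.v *)
(** Let [K z = (1 - z ^ 2) (1 + i z)] and let the moments of an analytic [h] be
    [mu_j h = \int_(-1)^1 h(x) K(x)^j dx].  Since [|K| < 1] on [[-1, 1]] except at
    [0], and [|K| < 1] just above [0], moving the path of integration upwards
    near [0] (Goursat's theorem on rectangles) shows that [mu_j h] decays
    exponentially; hence [sup_j b_j |mu_j h|] is a continuous seminorm on the
    space of real analytic functions for every subexponential weight [b].  On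
    the other hand [g = K' / (K - lam)] is real analytic for [2/3 <= lam < 1]
    and satisfies [mu_j g = lam^j mu_0 g], so the rate of decay can be
    arbitrarily slow.

    The right-hand side is [f = sum_n psi_n g_n], where [psi_n] is a bump
    supported in a small disc that approaches the upper boundary of the strip
    as [n] grows, so that [f] lies in the weighted space whatever the weights
    are, and [mu_j g_n = lam_n^j mu_0 g_n] with [lam_n] close to [1].  If
    [dbar u = f], then in the vertical corridor joining the real line to the
    [n]-th disc the scalar function [mu_j u] solves a Cauchy-Riemann equation
    whose right-hand side has size [lam_n^j].  A two-constants argument (the
    maximum principle for a holomorphic function weighted by the exponential
    of a harmonic function) bounds [m_j = sup_(x real) |mu_j (u x)|] from below
    by [c_n exp(- j / (n + 4))] for every [n].  Thus [j / m_j] is subexponential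
    in [j], and the seminorm with weight [b_j = j / m_j] is continuous but
    unbounded on the values of [u] on the real line. *)

Require Import Defs.
From mathcomp Require Import all_boot all_order all_algebra.
From mathcomp Require Import all_classical all_reals all_analysis.
From mathcomp Require Import complex.
From mathcomp Require Import ring lra.

Set Implicit Arguments.
Unset Strict Implicit.
Unset Printing Implicit Defensive.

Import Order.TTheory GRing.Theory Num.Theory.
Import numFieldNormedType.Exports.
Import Normc.

Local Open Scope classical_set_scope.
Local Open Scope ring_scope.
Local Open Scope complex_scope.
Local Open Scope quotient_scope.

(** * Integrals over segments and Goursat's theorem *)

(** Both factors of [K] are forced. Since [1 - z ^ 2] vanishes at the ends of the path, [K' K^j]
    integrates to zero, which makes the eigenvalue relation of [K' / (K - lam)] exact; [1 + i z]
    makes [|K|] drop when the path leaves [0] upwards. The weight [b] has to be beaten by every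
    exponential, so a lower bound of [m_j] at one fixed rate would not do. Hence one disc for each
    rate [1 / (n + 4)], all served by the same solution [u]. A corridor may be very thin, and then a
    harmonic weight that is [L] on its base and non-positive on its other sides is only [sig_n L] at
    the centre of the disc, with [sig_n] tiny. The loss [lam_n^j] must fit into this gain, so
    [lam_n] is chosen after the corridor, as [exp(- sig_n / (n + 4))]; with [L = j / (n + 4) + B]
    the dependence on [j] then cancels at the centre. The profile of the bumps is dictated by the
    removal of the right-hand side: [psi] is the derivative of [bump 0] evaluated at
    [r^2 - |z - c|^2], so [(z - c) psi] is minus the [dbar] of an explicit function [chi]. It
    vanishes on the boundary of the corridor and is positive at the centre, where it is all that
    remains. *)

Section SegmentIntegral.
Context {R : realType}.
Implicit Types (f g F : R -> R) (a b c k M : R).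

Definition Int f a b : R := \int[@lebesgue_measure R]_(x in `[a, b]) f x.

(** Continuity is two-sided even at the end points: all integrands are regular around their
    segments, and this form combines by the pointwise rules. *)
Definition continuous_seg f a b :=
  forall x, x \in `[a, b] -> {for x, continuous f}.

Lemma continuous_seg_sub f a b c d : a <= c -> d <= b ->
  continuous_seg f a b -> continuous_seg f c d.
Proof.
move=> ac db fc x; rewrite in_itv/= => /andP[cx xd]; apply: fc.
by rewrite in_itv/= (le_trans ac)// (le_trans xd).
Qed.

Lemma continuous_seg_within f a b : continuous_seg f a b ->
  {within `[a, b], continuous f}.
Proof. by move=> fc; apply/continuous_in_subspaceT => x; rewrite inE => /fc. Qed.

Lemma continuous_segZ f k a b : continuous_seg f a b ->
  continuous_seg (fun x => k * f x) a b.
Proof. by move=> fc x xab; apply: continuousM (fc x xab); exact: cst_continuous. Qed.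

Lemma continuous_segD f g a b : continuous_seg f a b -> continuous_seg g a b ->
  continuous_seg (fun x => f x + g x) a b.
Proof. by move=> fc gc x xab; exact: continuousD (fc x xab) (gc x xab). Qed.

Lemma continuous_segB f g a b : continuous_seg f a b -> continuous_seg g a b ->
  continuous_seg (fun x => f x - g x) a b.
Proof. by move=> fc gc x xab; exact: continuousB (fc x xab) (gc x xab). Qed.

Lemma continuous_segM f g a b : continuous_seg f a b -> continuous_seg g a b ->
  continuous_seg (fun x => f x * g x) a b.
Proof. by move=> fc gc x xab; exact: continuousM (fc x xab) (gc x xab). Qed.

Lemma continuous_seg_integrable f a b : continuous_seg f a b ->
  (@lebesgue_measure R).-integrable `[a, b] (EFin \o f).
Proof.
move=> fc; apply: continuous_compact_integrable; first exact: segment_compact.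
exact: continuous_seg_within.
Qed.

Lemma eq_Int f g a b : {in `[a, b], f =1 g} -> Int f a b = Int g a b.
Proof. by move=> fg; apply: eq_Rintegral => x; rewrite inE => /fg. Qed.

Lemma IntZ f k a b : continuous_seg f a b ->
  Int (fun x => k * f x) a b = k * Int f a b.
Proof. by move=> fc; rewrite /Int RintegralZl//; exact: continuous_seg_integrable. Qed.

Lemma IntD f g a b : continuous_seg f a b -> continuous_seg g a b ->
  Int (fun x => f x + g x) a b = Int f a b + Int g a b.
Proof. by move=> fc gc; rewrite /Int RintegralD//; exact: continuous_seg_integrable.
    Qed.

Lemma IntB f g a b : continuous_seg f a b -> continuous_seg g a b ->
  Int (fun x => f x - g x) a b = Int f a b - Int g a b.
Proof. by move=> fc gc; rewrite /Int RintegralB//; exact: continuous_seg_integrable.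
    Qed.

Lemma Int_cst k a b : a <= b -> Int (fun=> k) a b = k * (b - a).
Proof.
move=> ab; rewrite /Int Rintegral_cst//= lebesgue_measure_itv/= lte_fin.
by case: ltgtP ab => // -> _; rewrite subrr.
Qed.

Lemma Int_split f a b c : a <= c <= b -> continuous_seg f a b ->
  Int f a b = Int f a c + Int f c b.
Proof.
move=> /andP[ac cb] fc.
have fi := continuous_seg_integrable fc.
have := @Rintegral_itvB R f (BLeft a) (BRight b) c fi.
rewrite !bnd_simp => /(_ ac cb) fE.
rewrite /Int -(@Rintegral_itv_obnd_cbnd _ c (BRight b)); last first.
  apply: integrableS fi => //=.
  by move=> x; rewrite /= !in_itv/= => /andP[/ltW cx ->]; rewrite (le_trans ac).
by rewrite -fE addrC subrK.
Qed.

Lemma le_Int f g a b : continuous_seg f a b -> continuous_seg g a b ->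
  {in `[a, b], forall x, f x <= g x} -> Int f a b <= Int g a b.
Proof.
move=> fc gc fg; apply: le_Rintegral => //; exact: continuous_seg_integrable.
Qed.

Lemma Int_le_cst f M a b : a <= b -> continuous_seg f a b ->
  {in `[a, b], forall x, f x <= M} -> Int f a b <= M * (b - a).
Proof.
move=> ab fc fM; rewrite -Int_cst//; apply: le_Int => //.
by move=> x _; exact: cst_continuous.
Qed.

Lemma Int_ge_cst f M a b : a <= b -> continuous_seg f a b ->
  {in `[a, b], forall x, M <= f x} -> M * (b - a) <= Int f a b.
Proof.
move=> ab fc fM; rewrite -Int_cst//; apply: le_Int => //.
by move=> x _; exact: cst_continuous.
Qed.

Lemma normr_Int_le f M a b : a <= b -> continuous_seg f a b ->
  {in `[a, b], forall x, `|f x| <= M} -> `|Int f a b| <= M * (b - a).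
Proof.
move=> ab fc fM; rewrite ler_norml; apply/andP; split.
  rewrite -mulNr; apply: Int_ge_cst => // x xab.
  by have := fM x xab; rewrite ler_norml => /andP[].
by apply: Int_le_cst => // x xab; rewrite (le_trans (ler_norm _))// fM.
Qed.

Lemma Int_gt0 f a b : a < b -> continuous_seg f a b ->
  {in `[a, b], forall x, 0 < f x} -> 0 < Int f a b.
Proof.
move=> ab fc f0.
have [c cab fmin] := EVT_min (ltW ab) (continuous_seg_within fc).
apply: lt_le_trans (Int_ge_cst (ltW ab) fc fmin).
by rewrite mulr_gt0 ?subr_gt0 ?f0.
Qed.

Lemma Int_FTC f F a b : a < b -> continuous_seg f a b ->
  (forall x, x \in `[a, b] -> is_derive x 1 F (f x)) -> Int f a b = F b - F a.
Proof.
move=> ab fc dF.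
have cF x : x \in `[a, b] -> {for x, continuous F}.
  move=> xab; apply: differentiable_continuous; apply/derivable1_diffP.
  by case: (dF x xab).
rewrite /Int /Rintegral (@continuous_FTC2 _ f F)//.
- exact: continuous_seg_within.
- split.
  + move=> x; rewrite in_itv/= => /andP[/ltW ax /ltW xb].
    by case: (dF x) => //; rewrite in_itv/= ax.
  + by apply: cvg_at_right_filter; apply: cF; rewrite in_itv/= lexx ltW.
  + by apply: cvg_at_left_filter; apply: cF; rewrite in_itv/= lexx ltW.
- move=> x xab; have xab' : x \in `[a, b] by move: xab; rewrite !in_itv/= =>
    /andP[/ltW -> /ltW ->].
  by rewrite derive1E; case: (dF x xab').
Qed.

End SegmentIntegral.

(** * Goursat's theorem for closed forms on rectangles *)

Section Goursat.
Context {R : realType}.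
Variables A B : R -> R -> R.

(** The two components are differentiable at [(x0, y0)] and the form
    [A dx + B dy] is closed there: [b] is both [dA/dy] and [dB/dx]. *)
Definition closed_at x0 y0 := exists a b d : R, forall e, 0 < e ->
  exists2 h, 0 < h & forall x y, `|x - x0| < h -> `|y - y0| < h ->
    `|A x y - A x0 y0 - a * (x - x0) - b * (y - y0)|
      <= e * (`|x - x0| + `|y - y0|) /\
    `|B x y - B x0 y0 - b * (x - x0) - d * (y - y0)|
      <= e * (`|x - x0| + `|y - y0|).

(** The circulation of [A dx + B dy] along the boundary of the rectangle, counterclockwise. *)
Definition rect_int a b c d : R :=
  Int (A ^~ c) a b - Int (A ^~ d) a b + (Int (B b) c d - Int (B a) c d).

Lemma closed_at_continuous x0 y0 : closed_at x0 y0 ->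
  {for x0, continuous (A ^~ y0)} /\ {for y0, continuous (B x0)}.
Proof.
move=> [a [b [d H]]]; split; apply/cvgrPdist_lt => e e0.
  have [h h0 Hh] := H 1 ltr01.
  pose g := Num.min h (e / (2 + `|a|)).
  have a0 : 0 < 2 + `|a| by rewrite ltr_wpDr.
  have g0 : 0 < g by rewrite lt_min h0 divr_gt0.
  near=> x.
  have xg : `|x - x0| < g by near: x; apply: cvgr_distC_lt g0; exact: cvg_id.
  have xh : `|x - x0| < h by rewrite (lt_le_trans xg)// ge_min lexx.
  have [] := Hh x y0 xh; first by rewrite subrr normr0.
  rewrite subrr normr0 addr0 mulr0 subr0 mul1r => AE _.
  rewrite distrC.
  have -> : A x y0 - A x0 y0 = (A x y0 - A x0 y0 - a * (x - x0)) + a * (x - x0)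
    by ring.
  rewrite (le_lt_trans (ler_normD _ _))// normrM.
  have xe : `|x - x0| * (2 + `|a|) < e.
    by rewrite -ltr_pdivlMr// (lt_le_trans xg)// ge_min lexx orbT.
  by have := normr_ge0 (x - x0); lra.
have [h h0 Hh] := H 1 ltr01.
pose g := Num.min h (e / (2 + `|d|)).
have a0 : 0 < 2 + `|d| by rewrite ltr_wpDr.
have g0 : 0 < g by rewrite lt_min h0 divr_gt0.
near=> x.
have xg : `|x - y0| < g by near: x; apply: cvgr_distC_lt g0; exact: cvg_id.
have xh : `|x - y0| < h by rewrite (lt_le_trans xg)// ge_min lexx.
have [|_] := Hh x0 x _ xh; first by rewrite subrr normr0.
rewrite subrr normr0 add0r mulr0 subr0 mul1r => AE.
rewrite distrC.
have -> : B x0 x - B x0 y0 = (B x0 x - B x0 y0 - d * (x - y0)) + d * (x - y0)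
  by ring.
rewrite (le_lt_trans (ler_normD _ _))// normrM.
have xe : `|x - y0| * (2 + `|d|) < e.
  by rewrite -ltr_pdivlMr// (lt_le_trans xg)// ge_min lexx orbT.
by have := normr_ge0 (x - y0); lra.
Unshelve. all: by end_near. Qed.

Variables a0 b0 c0 d0 : R.
Hypotheses (ab0 : a0 <= b0) (cd0 : c0 <= d0).
Hypothesis AB : forall x y, x \in `[a0, b0] -> y \in `[c0, d0] -> closed_at x y.

Let Acont y : y \in `[c0, d0] -> continuous_seg (A ^~ y) a0 b0.
Proof. by move=> yc x xa; case: (closed_at_continuous (AB xa yc)). Qed.

Let Bcont x : x \in `[a0, b0] -> continuous_seg (B x) c0 d0.
Proof. by move=> yc y xa; case: (closed_at_continuous (AB yc xa)). Qed.

Let inside (q : R * R * (R * R)) :=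
  [/\ a0 <= q.1.1, q.1.1 <= q.1.2, q.1.2 <= b0 &
   [/\ c0 <= q.2.1, q.2.1 <= q.2.2 & q.2.2 <= d0]].

Let S (q : R * R * (R * R)) := rect_int q.1.1 q.1.2 q.2.1 q.2.2.

Let quarter q q' := [/\ inside q', q.1.1 <= q'.1.1, q'.1.2 <= q.1.2 &
  [/\ q.2.1 <= q'.2.1, q'.2.2 <= q.2.2,
      q'.1.2 - q'.1.1 = (q.1.2 - q.1.1) / 2,
      q'.2.2 - q'.2.1 = (q.2.2 - q.2.1) / 2 & `|S q| <= 4 * `|S q'|]].

(** Inner edges cancel, so the circulations of the four quarters add up to that of [q]; they cannot
    all be smaller than a quarter of it. *)
Let quarter_ex q : inside q -> exists q', quarter q q'.
Proof.
case: q => [[a b] [c d]] [/= aa ab bb [cc cd dd]].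
pose m := (a + b) / 2; pose n := (c + d) / 2.
have am : a <= m by rewrite /m; lra.
have mb : m <= b by rewrite /m; lra.
have cn : c <= n by rewrite /n; lra.
have nd : n <= d by rewrite /n; lra.
have Ac y : c <= y -> y <= d -> continuous_seg (A ^~ y) a b.
  move=> cy yd; apply: continuous_seg_sub (Acont _) => //.
  by rewrite in_itv/= (le_trans cc) ?(le_trans yd).
have Bc x : a <= x -> x <= b -> continuous_seg (B x) c d.
  move=> ax xb; apply: continuous_seg_sub (Bcont _) => //.
  by rewrite in_itv/= (le_trans aa) ?(le_trans xb).
have SE : S ((a, b), (c, d)) = S ((a, m), (c, n)) + S ((m, b), (c, n)) +
    (S ((a, m), (n, d)) + S ((m, b), (n, d))).
  rewrite /S /rect_int /=.
  have mab : a <= m <= b by rewrite am.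
  have ncd : c <= n <= d by rewrite cn.
  rewrite (Int_split mab (Ac c (lexx _) cd)) (Int_split mab (Ac d cd (lexx _))).
  rewrite (Int_split ncd (Bc a (lexx _) ab)) (Int_split ncd (Bc b ab (lexx _))).
  ring.
have ineq (p q r s : R) : `|p + q + (r + s)| <= `|p| + `|q| + (`|r| + `|s|).
  by rewrite (le_trans (ler_normD _ _))// lerD// ler_normD.
have := ineq (S ((a, m), (c, n))) (S ((m, b), (c, n)))
             (S ((a, m), (n, d))) (S ((m, b), (n, d))).
rewrite -SE => le4.
have width1 : m - a = (b - a) / 2 by rewrite /m; lra.
have width2 : b - m = (b - a) / 2 by rewrite /m; lra.
have width3 : n - c = (d - c) / 2 by rewrite /n; lra.
have width4 : d - n = (d - c) / 2 by rewrite /n; lra.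
have am0 := le_trans aa am; have bm0 := le_trans mb bb.
have cn0 := le_trans cc cn; have dn0 := le_trans nd dd.
have [h1|h1] := leP `|S ((a, b), (c, d))| (4 * `|S ((a, m), (c, n))|).
  by exists ((a, m), (c, n)); split=> //; split.
have [h2|h2] := leP `|S ((a, b), (c, d))| (4 * `|S ((m, b), (c, n))|).
  by exists ((m, b), (c, n)); split=> //; split.
have [h3|h3] := leP `|S ((a, b), (c, d))| (4 * `|S ((a, m), (n, d))|).
  by exists ((a, m), (n, d)); split=> //; split.
have [h4|h4] := leP `|S ((a, b), (c, d))| (4 * `|S ((m, b), (n, d))|).
  by exists ((m, b), (n, d)); split=> //; split.
exfalso; lra.
Qed.

(** The nested rectangles; the default [q] of [xget] is never taken, by [QS]. *)
Let Q k := iter k (fun q => xget q (quarter q)) ((a0, b0), (c0, d0)).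

Let QS k : inside (Q k) /\ quarter (Q k) (Q k.+1).
Proof.
elim: k => [|k [ik qk]].
  have i0 : inside (Q 0) by [].
  split; first exact: i0.
  exact: (@xgetPex _ (Q 0) (quarter (Q 0)) (quarter_ex i0)).
have ik1 : inside (Q k.+1) by case: qk.
split; first exact: ik1.
exact: (@xgetPex _ (Q k.+1) (quarter (Q k.+1)) (quarter_ex ik1)).
Qed.

(* in [rect_int] the terms [a (x - x0)] and [d (y - y0)] cancel, and the terms
   in [b] cancel by closedness *)
Let small_rect x0 y0 : closed_at x0 y0 -> forall e, 0 < e ->
  exists2 h, 0 < h & forall q, inside q ->
    q.1.1 <= x0 <= q.1.2 -> q.2.1 <= y0 <= q.2.2 ->
    q.1.2 - q.1.1 < h -> q.2.2 - q.2.1 < h ->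
    `|S q| <= e * ((q.1.2 - q.1.1) + (q.2.2 - q.2.1)) ^+ 2.
Proof.
move=> [a' [b' [d' H]]] e e0.
have e20 : 0 < e / 2 by rewrite divr_gt0.
have [h h0 Hh] := H _ e20; exists h => // -[[a b] [c d]] /= [aa ab bb [cc cd dd]].
rewrite /= in aa ab bb cc cd dd *.
move=> /andP[ax xb] /andP[cy yd] wh vh.
set w := b - a; set v := d - c.
have Hx x : x \in `[a, b] -> `|x - x0| <= w /\ `|x - x0| < h.
  rewrite in_itv/= => /andP[? ?].
  have : `|x - x0| <= w by rewrite ler_norml /w; apply/andP; split; lra.
  by move=> xw; split=> //; exact: le_lt_trans xw wh.
have Hy y : y \in `[c, d] -> `|y - y0| <= v /\ `|y - y0| < h.
  rewrite in_itv/= => /andP[? ?].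
  have : `|y - y0| <= v by rewrite ler_norml /v; apply/andP; split; lra.
  by move=> xw; split=> //; exact: le_lt_trans xw vh.
have ca : c \in `[c, d] by rewrite in_itv/= lexx.
have da : d \in `[c, d] by rewrite in_itv/= lexx andbT.
have aA : a \in `[a, b] by rewrite in_itv/= lexx.
have bA : b \in `[a, b] by rewrite in_itv/= lexx andbT.
have w0 : 0 <= w by rewrite subr_ge0.
have v0 : 0 <= v by rewrite subr_ge0.
have Ac y : c <= y -> y <= d -> continuous_seg (A ^~ y) a b.
  move=> cy' yd'; apply: continuous_seg_sub (Acont _) => //.
  by rewrite in_itv/= (le_trans cc) ?(le_trans yd').
have Bc x : a <= x -> x <= b -> continuous_seg (B x) c d.
  move=> ax' xb'; apply: continuous_seg_sub (Bcont _) => //.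
  by rewrite in_itv/= (le_trans aa) ?(le_trans xb').
have Ad : `|Int (A ^~ c) a b - Int (A ^~ d) a b + b' * v * w| <= e * (w + v) * w.
  rewrite -IntB; [|exact: Ac|exact: Ac].
  rewrite -(Int_cst (b' * v) ab) -IntD; last 2 first.
  - by apply: continuous_segB; exact: Ac.
  - by move=> ? _; exact: cst_continuous.
  apply: normr_Int_le => //.
    apply: continuous_segD; first by apply: continuous_segB; exact: Ac.
    by move=> ? _; exact: cst_continuous.
  move=> x /Hx[xw xh].
  have [[cv ch] [dv dh]] := (Hy _ ca, Hy _ da).
  have [Ax _] := Hh x c xh ch; have [Ay _] := Hh x d xh dh.
  have -> : A x c - A x d + b' * v =
    (A x c - A x0 y0 - a' * (x - x0) - b' * (c - y0)) -
    (A x d - A x0 y0 - a' * (x - x0) - b' * (d - y0)) by rewrite /v; ring.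
  rewrite (le_trans (ler_normB _ _))//.
  have -> : e * (w + v) = e / 2 * (w + v) + e / 2 * (w + v) by lra.
  by apply: lerD; [apply: le_trans Ax _|apply: le_trans Ay _];
     rewrite ler_pM2l// lerD.
have Bd : `|Int (B b) c d - Int (B a) c d - b' * w * v| <= e * (w + v) * v.
  rewrite -IntB; [|exact: Bc|exact: Bc].
  rewrite -(Int_cst (b' * w) cd) -IntB; last 2 first.
  - by apply: continuous_segB; exact: Bc.
  - by move=> ? _; exact: cst_continuous.
  apply: normr_Int_le => //.
    apply: continuous_segB; first by apply: continuous_segB; exact: Bc.
    by move=> ? _; exact: cst_continuous.
  move=> y /Hy[yw yh].
  have [[av ah] [bv bh]] := (Hx _ aA, Hx _ bA).
  have [_ Ax] := Hh a y ah yh; have [_ Ay] := Hh b y bh yh.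
  have -> : B b y - B a y - b' * w =
    (B b y - B x0 y0 - b' * (b - x0) - d' * (y - y0)) -
    (B a y - B x0 y0 - b' * (a - x0) - d' * (y - y0)) by rewrite /w; ring.
  rewrite (le_trans (ler_normB _ _))//.
  have -> : e * (w + v) = e / 2 * (w + v) + e / 2 * (w + v) by lra.
  by apply: lerD; [apply: le_trans Ay _|apply: le_trans Ax _];
     rewrite ler_pM2l// lerD.
have -> : S ((a, b), (c, d)) =
   (Int (A ^~ c) a b - Int (A ^~ d) a b + b' * v * w) +
   (Int (B b) c d - Int (B a) c d - b' * w * v).
  rewrite /S /rect_int /=; ring.
rewrite (le_trans (ler_normD _ _))// (le_trans (lerD Ad Bd))//.
by rewrite -mulrDr -mulrA.
Qed.

(** The [k]-th rectangle carries at least [4 ^- k] of the circulation, while closedness at the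
    common point of all of them bounds its circulation by an arbitrarily small multiple of its
    squared size, which is [D ^+ 2 / 4 ^+ k]. *)
Lemma goursat : rect_int a0 b0 c0 d0 = 0.
Proof.
have Qin k : inside (Q k) by case: (QS k).
have mono_a : {homo (fun k => (Q k).1.1) : m n / (m <= n)%N >-> m <= n}.
  by apply: homo_leq => [//|y x z|k]; [exact: le_trans|case: (QS k) => _ []].
have mono_b : {homo (fun k => - (Q k).1.2) : m n / (m <= n)%N >-> m <= n}.
  apply: homo_leq => [//|y x z|k]; [exact: le_trans|].
  by rewrite lerN2; case: (QS k) => _ [].
have mono_c : {homo (fun k => (Q k).2.1) : m n / (m <= n)%N >-> m <= n}.
  by apply: homo_leq => [//|y x z|k]; [exact: le_trans|case: (QS k) => _ [_ _ _ []]].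
have mono_d : {homo (fun k => - (Q k).2.2) : m n / (m <= n)%N >-> m <= n}.
  apply: homo_leq => [//|y x z|k]; [exact: le_trans|].
  by rewrite lerN2; case: (QS k) => _ [_ _ _ []].
have ab k l : (Q k).1.1 <= (Q l).1.2.
  apply: (@le_trans _ _ (Q (maxn k l)).1.1); first by apply: mono_a; exact: leq_maxl.
  apply: (@le_trans _ _ (Q (maxn k l)).1.2); first by case: (Qin (maxn k l)).
  by rewrite -lerN2; apply: mono_b; exact: leq_maxr.
have cd k l : (Q k).2.1 <= (Q l).2.2.
  apply: (@le_trans _ _ (Q (maxn k l)).2.1); first by apply: mono_c; exact: leq_maxl.
  apply: (@le_trans _ _ (Q (maxn k l)).2.2); first by case: (Qin (maxn k l)) => _ _ _
      [].
  by rewrite -lerN2; apply: mono_d; exact: leq_maxr.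
pose x0 := sup (range (fun k => (Q k).1.1)).
pose y0 := sup (range (fun k => (Q k).2.1)).
have xab k : (Q k).1.1 <= x0 <= (Q k).1.2.
  apply/andP; split.
    apply: ub_le_sup; last by exists k.
    by exists (Q 0).1.2 => _ [l _ <-].
  apply: ge_sup; first by exists (Q 0).1.1, 0%N.
  by move=> _ [l _ <-].
have ycd k : (Q k).2.1 <= y0 <= (Q k).2.2.
  apply/andP; split.
    apply: ub_le_sup; last by exists k.
    by exists (Q 0).2.2 => _ [l _ <-].
  apply: ge_sup; first by exists (Q 0).2.1, 0%N.
  by move=> _ [l _ <-].
have cl : closed_at x0 y0.
  by apply: AB; rewrite in_itv/=; [exact: (xab 0%N)|exact: (ycd 0%N)].
have wE k : (Q k).1.2 - (Q k).1.1 = (b0 - a0) / 2 ^+ k.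
  elim: k => [|k IH]; first by rewrite expr0 divr1.
  by case: (QS k) => _ [_ _ _ [_ _ -> _ _]]; rewrite IH exprSr invfM mulrA.
have vE k : (Q k).2.2 - (Q k).2.1 = (d0 - c0) / 2 ^+ k.
  elim: k => [|k IH]; first by rewrite expr0 divr1.
  by case: (QS k) => _ [_ _ _ [_ _ _ -> _]]; rewrite IH exprSr invfM mulrA.
have SE k : `|rect_int a0 b0 c0 d0| <= 4 ^+ k * `|S (Q k)|.
  elim: k => [|k IH]; first by rewrite mul1r.
  rewrite (le_trans IH)// exprSr -mulrA ler_pM2l ?exprn_gt0//.
  by case: (QS k) => _ [_ _ _ [_ _ _ _]].
apply/eqP; rewrite -normr_le0; apply/ler_addgt0Pl => e e0.
rewrite addr0.
pose D := (b0 - a0) + (d0 - c0).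
have D0 : 0 <= D by rewrite addr_ge0 ?subr_ge0.
(* The summand 1 covers the degenerate rectangle [D = 0]. *)
pose e' := e / (D ^+ 2 + 1).
have D1 : 0 < D ^+ 2 + 1 by rewrite ltr_wpDl ?sqr_ge0.
have e'0 : 0 < e' by rewrite divr_gt0.
have [h h0 Hh] := small_rect cl e'0.
have [k kh] : exists k : nat, D / 2 ^+ k < h.
  pose k := Num.bound (D / h).
  exists k; rewrite ltr_pdivrMr ?exprn_gt0// -ltr_pdivrMl//.
  have : D / h < k%:R by apply: archi_boundP; rewrite divr_ge0// ltW.
  rewrite mulrC => /lt_le_trans; apply.
  by rewrite -natrX ler_nat ltnW// ltn_expl.
have p2 : (0 : R) < 2 ^+ k by rewrite exprn_gt0.
have wh : (Q k).1.2 - (Q k).1.1 < h.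
  rewrite wE (le_lt_trans _ kh)// ler_pM2r ?invr_gt0// /D lerDl subr_ge0//.
have vh : (Q k).2.2 - (Q k).2.1 < h.
  rewrite vE (le_lt_trans _ kh)// ler_pM2r ?invr_gt0// /D lerDr subr_ge0//.
have := Hh (Q k) (Qin k) (xab k) (ycd k) wh vh.
rewrite wE vE -mulrDl -/D => SQ.
rewrite (le_trans (SE k))//.
have p4 : (0 : R) < 4 ^+ k by rewrite exprn_gt0.
apply: (@le_trans _ _ (4 ^+ k * (e' * (D / 2 ^+ k) ^+ 2))); first by rewrite ler_pM2l.
have -> : 4 ^+ k * (e' * (D / 2 ^+ k) ^+ 2) = e' * D ^+ 2.
  rewrite (_ : 4 = 2 ^+ 2 :> R); last by ring.
  rewrite exprAC; move: (2 ^+ k) p2 => p p2'.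
  by field; rewrite gt_eqF.
by rewrite /e' mulrAC ler_pdivrMr// ler_pM2l// lerDl.
Qed.

End Goursat.

(** * Complex integrals over rectangles *)

Section ComplexBasics.
Context {R : realType}.
Local Notation C := R[i]^o.
Local Notation Re := (@complex.Re R).
Local Notation Im := (@complex.Im R).
Implicit Types (x y z w : R[i]).

Lemma ReD x y : Re (x + y) = Re x + Re y. Proof. by case: x; case: y. Qed.
Lemma ImD x y : Im (x + y) = Im x + Im y. Proof. by case: x; case: y. Qed.
Lemma ReN x : Re (- x) = - Re x. Proof. by case: x. Qed.
Lemma ImN x : Im (- x) = - Im x. Proof. by case: x. Qed.
Lemma ReB x y : Re (x - y) = Re x - Re y. Proof. by rewrite ReD ReN. Qed.
Lemma ImB x y : Im (x - y) = Im x - Im y. Proof. by rewrite ImD ImN. Qed.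
Lemma ReM x y : Re (x * y) = Re x * Re y - Im x * Im y.
Proof. by case: x; case: y. Qed.
Lemma ImM x y : Im (x * y) = Re x * Im y + Im x * Re y.
Proof. by case: x => a b; case: y. Qed.
Lemma Re_i z : Re ('i * z) = - Im z.
Proof. by rewrite ReM /= mul0r mul1r sub0r. Qed.
Lemma Im_i z : Im ('i * z) = Re z.
Proof. by rewrite ImM /= mul0r mul1r add0r. Qed.

Lemma eq_ReIm x y : Re x = Re y -> Im x = Im y -> x = y.
Proof. by case: x => a b; case: y => c d /= -> ->. Qed.

Lemma normc_ge0 z : 0 <= normc z.
Proof. by case: z => a b; exact: sqrtr_ge0. Qed.

Lemma normcE_norm z : `|z| = (normc z)%:C. Proof. by case: z. Qed.

Lemma sqr_normc_ReIm z : normc z ^+ 2 = Re z ^+ 2 + Im z ^+ 2.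
Proof. by case: z => a b /=; rewrite sqr_sqrtr// addr_ge0// sqr_ge0. Qed.

Lemma normr_Re z : `|Re z| <= normc z.
Proof.
rewrite -ler_sqr ?nnegrE ?normc_ge0// real_normK ?num_real//.
by rewrite sqr_normc_ReIm lerDl sqr_ge0.
Qed.

Lemma normr_Im z : `|Im z| <= normc z.
Proof.
rewrite -ler_sqr ?nnegrE ?normc_ge0// real_normK ?num_real//.
by rewrite sqr_normc_ReIm lerDr sqr_ge0.
Qed.

Lemma normc_le_ReIm z : normc z <= `|Re z| + `|Im z|.
Proof.
rewrite -ler_sqr ?nnegrE ?normc_ge0 ?addr_ge0// sqr_normc_ReIm sqrrD.
by rewrite !real_normK ?num_real// -addrA [_ *+ 2 + _]addrC addrA lerDl mulrn_wge0//
    mulr_ge0.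
Qed.

Lemma normcX z n : normc (z ^+ n) = normc z ^+ n.
Proof. by elim: n => [|n IH]; rewrite ?normc1// !exprS normcM IH. Qed.

Lemma normc_real (r : R) : normc r%:C = `|r|.
Proof. by rewrite /normc/= expr0n addr0 sqrtr_sqr. Qed.

Lemma nbhsC (z : C) (A : set C) :
  nbhs z A <-> exists2 e : R, 0 < e & forall w, normc (w - z) < e -> A w.
Proof.
split=> [/nbhs_ballP[e /= e0 eA]|[e e0 eA]].
  have er : e \is Num.real by rewrite gtr0_real.
  move: e0 eA; have /complex_realP[r ->] := er.
  rewrite ltcR => r0 rA; exists r => // w wz; apply: rA.
  by rewrite -ball_normE /ball_/= -normrN opprB normcE_norm ltcR.
apply/nbhs_ballP; exists e%:C => /=; first by rewrite ltcR.
move=> w; rewrite -ball_normE /ball_/= -normrN opprB normcE_norm ltcR.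
exact: eA.
Qed.

Lemma continuousC_Re (T : topologicalType) (f : T -> C) t :
  {for t, continuous f} ->
  {for t, continuous (Re \o f)} /\ {for t, continuous (Im \o f)}.
Proof.
move=> fc; split; apply/cvgrPdist_lt => e e0.
  have /fc : nbhs (f t) [set w : C | normc (w - f t) < e].
    by apply/nbhsC; exists e.
  move=> fA; apply: (@filterS _ (nbhs t) _ _ _ _ fA) => s /=.
  by rewrite distrC -ReB => /(le_lt_trans (normr_Re _)).
have /fc : nbhs (f t) [set w : C | normc (w - f t) < e].
  by apply/nbhsC; exists e.
move=> fA; apply: (@filterS _ (nbhs t) _ _ _ _ fA) => s /=.
by rewrite distrC -ImB => /(le_lt_trans (normr_Im _)).
Qed.

End ComplexBasics.

Section ComplexIntegral.
Context {R : realType}.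
Local Notation C := R[i]^o.
Local Notation Re := (@complex.Re R).
Local Notation Im := (@complex.Im R).
Implicit Types (f g : R -> R[i]) (F : C -> C) (a b c d k M : R).

Definition Cint f a b : R[i] :=
  Int (fun x => Re (f x)) a b +i* Int (fun x => Im (f x)) a b.

Definition ccont f a b := continuous_seg (fun x => Re (f x)) a b /\
  continuous_seg (fun x => Im (f x)) a b.

Lemma ccont_sub f a b c d : a <= c -> d <= b -> ccont f a b -> ccont f c d.
Proof. by move=> ac db [fr fi]; split; exact: continuous_seg_sub fr || exact:
    continuous_seg_sub fi. Qed.

Lemma eq_Cint f g a b : {in `[a, b], f =1 g} -> Cint f a b = Cint g a b.
Proof. by move=> fg; congr (_ +i* _); apply: eq_Int => x xab; rewrite fg. Qed.

Lemma ccontD f g a b : ccont f a b -> ccont g a b ->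
  ccont (fun x => f x + g x) a b.
Proof.
move=> [fr fi] [gr gi]; split.
  by under eq_fun do rewrite ReD; exact: continuous_segD.
by under eq_fun do rewrite ImD; exact: continuous_segD.
Qed.

Lemma ccontM f g a b : ccont f a b -> ccont g a b ->
  ccont (fun x => f x * g x) a b.
Proof.
move=> [fr fi] [gr gi]; split.
  under eq_fun do rewrite ReM.
  by apply: continuous_segB; exact: continuous_segM.
under eq_fun do rewrite ImM.
by apply: continuous_segD; exact: continuous_segM.
Qed.

Lemma ccont_cst (z : R[i]) a b : ccont (fun=> z) a b.
Proof. by split=> x _; exact: cst_continuous. Qed.

Lemma ccont_real a b : ccont (fun x => x%:C) a b.
Proof. by split=> x _ /=; [exact: cvg_id|exact: cst_continuous]. Qed.

Lemma ccontX f n a b : ccont f a b -> ccont (fun x => f x ^+ n) a b.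
Proof.
move=> fc; elim: n => [|n IH].
  by under eq_fun do rewrite expr0; exact: ccont_cst.
by under eq_fun do rewrite exprS; exact: ccontM.
Qed.

Lemma CintD f g a b : ccont f a b -> ccont g a b ->
  Cint (fun x => f x + g x) a b = Cint f a b + Cint g a b.
Proof.
move=> [fr fi] [gr gi]; apply: eq_ReIm => /=; rewrite -IntD//.
  by apply: eq_Int => x _; rewrite ReD.
by apply: eq_Int => x _; rewrite ImD.
Qed.

Lemma CintZ (z : R[i]) f a b : ccont f a b ->
  Cint (fun x => z * f x) a b = z * Cint f a b.
Proof.
move=> [fr fi]; apply: eq_ReIm; rewrite ?ReM ?ImM/= -!IntZ//.
  rewrite -IntB; [|exact: continuous_segZ|exact: continuous_segZ].
  by apply: eq_Int => x _; rewrite ReM.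
rewrite -IntD; [|exact: continuous_segZ|exact: continuous_segZ].
by apply: eq_Int => x _; rewrite ImM.
Qed.

Lemma Cint_split f a b c : a <= c <= b -> ccont f a b ->
  Cint f a b = Cint f a c + Cint f c b.
Proof. by move=> acb [fr fi]; apply: eq_ReIm => /=; rewrite -Int_split. Qed.

Lemma normc_Cint_le f M a b : a <= b -> ccont f a b ->
  {in `[a, b], forall x, normc (f x) <= M} ->
  normc (Cint f a b) <= 2 * M * (b - a).
Proof.
move=> ab [fr fi] fM; rewrite (le_trans (normc_le_ReIm _))//=.
rewrite -mulrA mulr_natl mulr2n; apply: lerD; apply: normr_Int_le => // x xab.
  exact: le_trans (normr_Re _) (fM x xab).
exact: le_trans (normr_Im _) (fM x xab).
Qed.

Lemma is_derive_approx F (z D : C) : is_derive z 1 F D ->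
  forall e : R, 0 < e -> exists2 h, 0 < h &
    forall w, normc (w - z) < h ->
      normc (F w - F z - D * (w - z)) <= e * normc (w - z).
Proof.
move=> [Fz FD] e e0.
have /cvgrPdist_le : h^-1 *: (F (h *: 1 + z) - F z) @[h --> (0 : C)^'] --> (D : C).
  by rewrite -FD; exact: Fz.
move=> /(_ e%:C); rewrite ltcR => /(_ e0) /nbhsC[h h0 hF]; exists h => // w wz.
have [->|wz0] := eqVneq w z.
  by rewrite !subrr mulr0 subrr normc0 mulr0.
have wz1 : w - z != 0 by rewrite subr_eq0.
have := hF (w - z); rewrite subr0 => /(_ wz wz1).
rewrite [(w - z) *: 1]mulr1 subrK normcE_norm lecR => le1.
have -> : F w - F z - D * (w - z) =
    - ((D - (w - z)^-1 * (F w - F z)) * (w - z)).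
  by rewrite mulrBl mulrAC mulVf// mul1r opprB.
by rewrite normcN normcM ler_wpM2r// normc_ge0.
Qed.

Lemma derivable_approx F (z : C) : derivable F z 1 ->
  exists D : R[i], forall e : R, 0 < e -> exists2 h, 0 < h &
    forall w, normc (w - z) < h ->
      normc (F w - F z - D * (w - z)) <= e * normc (w - z).
Proof. by move=> Fz; exists ('D_1 F z); apply: is_derive_approx; exact: DeriveDef. Qed.

(** The two forms are the real and imaginary parts of [F dz]; the Cauchy-Riemann equations are their
    closedness. *)
Lemma derivable_closed_at F x y : derivable F (x +i* y) 1 ->
  closed_at (fun x y => Re (F (x +i* y))) (fun x y => - Im (F (x +i* y))) x y /\
  closed_at (fun x y => Im (F (x +i* y))) (fun x y => Re (F (x +i* y))) x y.
Proof.
move=> /derivable_approx[D FD].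
have H e : 0 < e -> exists2 h, 0 < h & forall x' y',
    `|x' - x| < h -> `|y' - y| < h ->
    normc (F (x' +i* y') - F (x +i* y) - D * ((x' - x) +i* (y' - y))) <=
      e * (`|x' - x| + `|y' - y|).
  move=> e0; have [h h0 Fh] := FD e e0; exists (h / 2); first by rewrite divr_gt0.
  move=> x' y' xh yh.
  have wz : normc ((x' - x) +i* (y' - y)) <= `|x' - x| + `|y' - y|.
    exact: (le_trans (normc_le_ReIm _)).
  have : normc ((x' +i* y') - (x +i* y)) < h.
    by rewrite (le_lt_trans wz)// [h]splitr ltrD.
  by move=> /Fh/le_trans; apply; rewrite ler_pM2l.
split.
  exists (Re D), (- Im D), (- Re D) => e /H[h h0 Hh]; exists h => // x' y' xh yh.
  split.
    apply: le_trans (Hh x' y' xh yh); apply: le_trans (normr_Re _).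
    by rewrite !ReB ReM/= le_eqVlt; apply/orP; left; apply/eqP; congr (`|_|); ring.
  apply: le_trans (Hh x' y' xh yh); apply: le_trans (normr_Im _).
  rewrite !ImB ImM/= -normrN le_eqVlt; apply/orP; left; apply/eqP; congr (`|_|); ring.
exists (Im D), (Re D), (- Im D) => e /H[h h0 Hh]; exists h => // x' y' xh yh.
split.
  apply: le_trans (Hh x' y' xh yh); apply: le_trans (normr_Im _).
  by rewrite !ImB ImM/= le_eqVlt; apply/orP; left; apply/eqP; congr (`|_|); ring.
apply: le_trans (Hh x' y' xh yh); apply: le_trans (normr_Re _).
by rewrite !ReB ReM/= le_eqVlt; apply/orP; left; apply/eqP; congr (`|_|); ring.
Qed.

Lemma derivable_ccont_h F y a b :
  (forall x, x \in `[a, b] -> derivable F (x +i* y) 1) ->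
  ccont (fun x => F (x +i* y)) a b.
Proof.
move=> dF; split=> x /dF/derivable_closed_at[c1 c2].
  by case: (closed_at_continuous c1).
by case: (closed_at_continuous c2).
Qed.

Lemma derivable_ccont_v F x a b :
  (forall y, y \in `[a, b] -> derivable F (x +i* y) 1) ->
  ccont (fun y => F (x +i* y)) a b.
Proof.
move=> dF; split=> y /dF/derivable_closed_at[c1 c2].
  by case: (closed_at_continuous c2).
case: (closed_at_continuous c1) => _ /= Fc.
suff -> : (fun y => Im (F (x +i* y))) = (fun y => - - Im (F (x +i* y))).
  exact: continuousN Fc.
by apply/funext => t; rewrite opprK.
Qed.

Lemma cauchy_rect F a b c d : a <= b -> c <= d ->
  (forall x y, x \in `[a, b] -> y \in `[c, d] -> derivable F (x +i* y) 1) ->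
  Cint (fun x => F (x +i* c)) a b =
  Cint (fun x => F (x +i* d)) a b +
  'i * (Cint (fun y => F (a +i* y)) c d - Cint (fun y => F (b +i* y)) c d).
Proof.
move=> ab cd dF.
have := goursat ab cd (fun x y xab ycd => (derivable_closed_at (dF x y xab ycd)).1).
have := goursat ab cd (fun x y xab ycd => (derivable_closed_at (dF x y xab ycd)).2).
have nI x : x \in `[a, b] -> Int (fun y => - Im (F (x +i* y))) c d =
    - Int (fun y => Im (F (x +i* y))) c d.
  move=> xab; have [_ Fi] := @derivable_ccont_v F x c d (fun y => dF x y xab).
  by rewrite -mulN1r -IntZ//; apply: eq_Int => y _; rewrite mulN1r.
rewrite /rect_int !nI ?in_itv/= ?lexx ?ab//.
move=> E1 E2; apply: eq_ReIm; rewrite ?ReD ?ImD ?ReM ?ImM /=.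
  by lra.
by lra.
Qed.

End ComplexIntegral.

(** * The kernel and its moments *)

Section Kernel.
Context {R : realType}.
Local Notation C := R[i]^o.
Local Notation Re := (@complex.Re R).
Local Notation Im := (@complex.Im R).
Implicit Types (h : R -> R[i]) (F : C -> C) (d e M : R).

Definition kern (z : R[i]) : R[i] := (1 - z ^+ 2) * (1 + 'i * z).

Definition moment j h : R[i] := Cint (fun x => h x * kern x%:C ^+ j) (-1) 1.

Lemma sqr_normc_kern x y : normc (kern (x +i* y)) ^+ 2 =
  ((1 - x ^+ 2 + y ^+ 2) ^+ 2 + 4 * x ^+ 2 * y ^+ 2) * ((1 - y) ^+ 2 + x ^+ 2).
Proof.
rewrite sqr_normc_ReIm /kern expr2 !(ReM, ImM, ReD, ImD, ReN, ImN)/=; ring.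
Qed.

(** With [s = x ^+ 2], the factor [|1 + i z|^2 = (1 - y)^2 + s] loses [2 y - y^2] on the way up, and
    this is multiplied by [(1 - s)^2 >= 9 / 16], so that about [9 y / 8] is gained. The spare
    [y / 8] absorbs the quadratic errors, of size about [10 y^2], because [y <= 1 / 400]. *)
Lemma normc_kern_le x y : x ^+ 2 <= 4^-1 -> 0 <= y -> y <= 400^-1 ->
  normc (kern (x +i* y)) ^+ 2 <= 1 - x ^+ 2 - y.
Proof.
rewrite sqr_normc_kern; have := sqr_ge0 x; move: (x ^+ 2) => s s0 s1 y0 y1.
have H1 : (1 - s + y ^+ 2) ^+ 2 + 4 * s * y ^+ 2 <= (1 - s) ^+ 2 + 5 * y ^+ 2.
  have y2 : 0 <= y ^+ 2 by exact: sqr_ge0.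
  have : y ^+ 2 * y ^+ 2 <= y ^+ 2 * 1 by apply: ler_wpM2l => //; rewrite expr_le1
      //; lra.
  have : y ^+ 2 * s <= y ^+ 2 * 4^-1 by apply: ler_wpM2l.
  rewrite !expr2 in y2 *; lra.
have p0 : 0 <= (1 - y) ^+ 2 + s by rewrite addr_ge0// sqr_ge0.
apply: le_trans (ler_wpM2r p0 H1) _.
have yy : y ^+ 2 <= y * 400^-1 by rewrite expr2 ler_wpM2l.
have p2 : (1 - y) ^+ 2 + s <= 2 by rewrite sqrrB expr1n; lra.
have H2 : 5 * y ^+ 2 * ((1 - y) ^+ 2 + s) <= 5 * y ^+ 2 * 2.
  by rewrite ler_wpM2l// mulr_ge0// sqr_ge0.
have H3 : (1 - s) ^+ 2 * (1 + s) <= 1 - s.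
  have : 0 <= s * s * (1 - s) by rewrite !mulr_ge0//; lra.
  rewrite expr2; lra.
have H4 : (9 / 16) * (2 * y - y ^+ 2) <= (1 - s) ^+ 2 * (2 * y - y ^+ 2).
  rewrite ler_wpM2r//; first lra.
  have -> : 9 / 16 = (3 / 4) ^+ 2 :> R by field.
  by rewrite ler_sqr ?nnegrE; lra.
rewrite mulrDl (_ : (1 - s) ^+ 2 * ((1 - y) ^+ 2 + s) =
  (1 - s) ^+ 2 * (1 + s) - (1 - s) ^+ 2 * (2 * y - y ^+ 2)); last by ring.
lra.
Qed.

Lemma normc_kern_real_le x : -1 <= x <= 1 -> normc (kern x%:C) ^+ 2 <= 1 - x ^+ 2.
Proof.
move=> /andP[x0 x1]; rewrite sqr_normc_kern.
have s0 := sqr_ge0 x; have s1 : x ^+ 2 <= 1.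
  by rewrite -[x ^+ 2]real_normK ?num_real// expr_le1// ler_norml x0.
move: (x ^+ 2) s0 s1 => s s0 s1.
have : 0 <= s * s * (1 - s) by rewrite !mulr_ge0//; lra.
lra.
Qed.

Lemma normc_kernX_le (z : R[i]) e j : normc (kern z) ^+ 2 <= 1 - e ->
  normc (kern z ^+ j) <= expR (- (e / 2)) ^+ j.
Proof.
move=> zE; rewrite normcX lerXn2r ?nnegrE ?normc_ge0 ?expR_ge0//.
have e1 : 0 <= 1 - e by apply: le_trans zE; exact: sqr_ge0.
apply: (@le_trans _ _ (1 - e / 2)); last exact: expR_ge1Dx.
rewrite -ler_sqr ?nnegrE ?normc_ge0//; last lra.
by apply: (le_trans zE); have := sqr_ge0 (e / 2); rewrite sqrrB expr1n; lra.
Qed.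

Lemma ccont_kernX j a b : ccont (fun x : R => kern x%:C ^+ j) a b.
Proof.
apply: ccontX; apply: ccontM.
  apply: ccontD; first exact: ccont_cst.
  under eq_fun do rewrite -mulN1r.
  by apply: ccontM; [exact: ccont_cst|apply: ccontX; exact: ccont_real].
by apply: ccontD; [exact: ccont_cst|apply: ccontM; [exact: ccont_cst|exact:
    ccont_real]].
Qed.

Lemma ccont_moment h j a b : ccont h a b ->
  ccont (fun x : R => h x * kern x%:C ^+ j) a b.
Proof. by move=> hc; apply: ccontM => //; exact: ccont_kernX. Qed.

Lemma momentD j h g : ccont h (-1) 1 -> ccont g (-1) 1 ->
  moment j (fun x => h x + g x) = moment j h + moment j g.
Proof.
move=> hc gc; rewrite /moment -CintD; try exact: ccont_moment.
by apply: eq_Cint => x _; rewrite mulrDl.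
Qed.

Lemma momentZ j (k : R[i]) h : ccont h (-1) 1 ->
  moment j (fun x => k * h x) = k * moment j h.
Proof.
move=> hc; rewrite /moment -CintZ; last exact: ccont_moment.
by apply: eq_Cint => x _; rewrite mulrA.
Qed.

Lemma derivable_kernX j (z : C) : derivable (fun w : C => kern w ^+ j : C) z 1.
Proof.
have dq : derivable (fun w : C => 1 - w ^+ 2 : C) z 1.
  by apply: derivableB; [exact: derivable_cst|exact: exprn_derivable].
have dl : derivable (fun w : C => 1 + 'i * w : C) z 1.
  apply: derivableD; first exact: derivable_cst.
  by apply: derivableM; [exact: derivable_cst|exact: derivable_id].
have dk : derivable (kern : C -> C) z 1 by exact: (derivableM dq dl).
elim: j => [|j IH]; first by under eq_fun do rewrite expr0; exact: derivable_cst.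
under eq_fun do rewrite exprS.
exact: (derivableM dk IH).
Qed.

(** The base of the rectangle is replaced by its other three sides. On each of them
    [x ^+ 2 + y >= e]: on the top [y = e], on the vertical sides [x ^+ 2 = d ^+ 2 >= e]. The factor
    4 comes from [d + e <= 1]. *)
Lemma normc_moment_local_le j F d e M : 0 < d <= 2^-1 -> 0 < e <= 400^-1 ->
  e <= d ^+ 2 -> 0 <= M ->
  (forall x y, x \in `[- d, d] -> y \in `[0, e] ->
     derivable F (x +i* y) 1 /\ normc (F (x +i* y)) <= M) ->
  normc (Cint (fun x => F x%:C * kern x%:C ^+ j) (- d) d) <=
    4 * M * expR (- (e / 2)) ^+ j.
Proof.
move=> /andP[d0 d2] /andP[e0 e4] ed M0 FM.
have dd : - d <= d by lra.
pose G (z : C) : C := F z * kern z ^+ j.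
have dG x y : x \in `[- d, d] -> y \in `[0, e] -> derivable G (x +i* y) 1.
  by move=> xd ye; apply: derivableM; [exact: (FM x y xd ye).1|exact: derivable_kernX].
have d4 : d ^+ 2 <= 4^-1.
  have -> : 4^-1 = 2^-1 ^+ 2 :> R by field.
  by rewrite ler_sqr ?nnegrE//; lra.
set q := expR _ ^+ j.
have q0 : 0 <= q by rewrite exprn_ge0// expR_ge0.
have GM x y : x \in `[- d, d] -> y \in `[0, e] -> e <= x ^+ 2 + y ->
    normc (G (x +i* y)) <= M * q.
  move=> xd ye exy; rewrite /G normcM ler_pM ?normc_ge0//.
    exact: (FM x y xd ye).2.
  apply: normc_kernX_le; move: (ye); rewrite in_itv/= => /andP[y0 y1].
  apply: le_trans (@normc_kern_le x y _ y0 _) _; last by lra.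
    apply: le_trans d4; rewrite -[x ^+ 2]real_normK ?num_real//.
    rewrite ler_sqr ?nnegrE ?normr_ge0 ?(ltW d0)// ler_norml.
    by move: xd; rewrite in_itv.
  lra.
have := @cauchy_rect R G (- d) d 0 e dd (ltW e0) dG.
rewrite -[Cint (fun x => G (x +i* 0)) _ _]/(Cint (fun x => F x%:C * kern x%:C ^+ j)
    (- d) d) => ->.
have d1 : - d \in `[- d, d] by rewrite in_itv/= lexx.
have d1' : d \in `[- d, d] by rewrite in_itv/= lexx andbT.
have e1 : e \in `[0, e] by rewrite in_itv/= lexx ltW.
have b1 : normc (Cint (fun x => G (x +i* e)) (- d) d) <= 2 * (M * q) * (d - - d).
  apply: normc_Cint_le => //; first by apply: derivable_ccont_h => x xd; exact: dG.
  by move=> x xd; apply: GM => //; rewrite lerDr sqr_ge0.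
have b2 x : x \in `[- d, d] -> x ^+ 2 = d ^+ 2 ->
    normc (Cint (fun y => G (x +i* y)) 0 e) <= 2 * (M * q) * (e - 0).
  move=> xd xdE; apply: normc_Cint_le => //; first exact: ltW.
    by apply: derivable_ccont_v => y ye; exact: dG.
  move=> y ye; apply: GM => //; move: ye; rewrite in_itv/= xdE => /andP[y0 y1]; lra.
have b3 := b2 _ d1 (sqrrN d); have b4 := b2 _ d1' erefl.
rewrite (le_trans (le_normcD _ _))// normcM.
have -> : normc ('i : R[i]) = 1 by rewrite /normc/= expr0n expr1n add0r sqrtr1.
rewrite mul1r.
have b5 := le_normcD (Cint (fun y => G (- d +i* y)) 0 e) (- Cint (fun y => G (d +i*
    y)) 0 e).
rewrite normcN in b5.
apply: le_trans (lerD b1 (le_trans b5 (lerD b3 b4))) _.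
have Mq : 0 <= M * q by rewrite mulr_ge0.
rewrite -[4 * M * q]mulrA; move: (M * q) Mq d2 e4 => Y Y0 d2 e4.
have : Y * (d + e) <= Y * 1 by apply: ler_wpM2l => //; clear -d2 e4; lra.
clear; lra.
Qed.

(** For [|x| >= d] the kernel is already small on the real line, since [|K|^2 <= 1 - x^2 <= 1 - e];
    only the middle piece needs a change of path. *)
Lemma normc_moment_le j h d e M : 0 < d <= 2^-1 -> 0 < e -> e <= d ^+ 2 ->
  ccont h (-1) 1 -> {in `[-1, 1], forall x, normc (h x) <= M} ->
  normc (moment j h) <= 4 * M * expR (- (e / 2)) ^+ j +
    normc (Cint (fun x => h x * kern x%:C ^+ j) (- d) d).
Proof.
move=> /andP[d0 d2] e0 ed hc hM.
have c1 := ccont_moment j hc.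
have i1 : -1 <= - d <= 1 by apply/andP; split; lra.
have i2 : - d <= d <= 1 by apply/andP; split; lra.
rewrite /moment (Cint_split i1 c1).
have c2 : ccont (fun x => h x * kern x%:C ^+ j) (- d) 1.
  by apply: ccont_sub c1; lra.
rewrite (Cint_split i2 c2).
set q := expR _ ^+ j.
have q0 : 0 <= q by rewrite exprn_ge0// expR_ge0.
have hMq x : x \in `[-1, 1] -> d ^+ 2 <= x ^+ 2 -> normc (h x * kern x%:C ^+ j) <= M
    * q.
  move=> x1 dx; rewrite normcM ler_pM ?normc_ge0// ?hM//.
  apply: normc_kernX_le; apply: le_trans (normc_kern_real_le _) _.
    by move: x1; rewrite in_itv.
  by lra.
have b1 : normc (Cint (fun x => h x * kern x%:C ^+ j) (-1) (- d)) <= 2 * (M * q) * (-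
    d - - 1).
  apply: normc_Cint_le; [lra|by apply: ccont_sub c1; lra|].
  move=> x; rewrite in_itv/= => /andP[x1 x2]; apply: hMq.
    by rewrite in_itv/=; apply/andP; split; lra.
  by rewrite -[leRHS]sqrrN ler_sqr ?nnegrE; lra.
have b2 : normc (Cint (fun x => h x * kern x%:C ^+ j) d 1) <= 2 * (M * q) * (1 - d).
  apply: normc_Cint_le; [lra|by apply: ccont_sub c1; lra|].
  move=> x; rewrite in_itv/= => /andP[x1 x2]; apply: hMq.
    by rewrite in_itv/=; apply/andP; split; lra.
  by rewrite ler_sqr ?nnegrE; lra.
rewrite (le_trans (le_normcD _ _))//.
have b3 := le_normcD (Cint (fun x => h x * kern x%:C ^+ j) (- d) d)
  (Cint (fun x => h x * kern x%:C ^+ j) d 1).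
have M0 : 0 <= M.
  by apply: (le_trans (normc_ge0 (h 1))); apply: hM; rewrite in_itv/= lexx andbT; lra.
have Mq : 0 <= M * q * d by rewrite !mulr_ge0// ltW.
rewrite -[4 * M * q]mulrA; move: (M * q) Mq b1 b2 b3 => Y Y0 b1 b2 b3.
apply: le_trans (lerD b1 (le_trans b3 (lerD (lexx _) b2))) _.
move: (normc _) => n; clear -Y0; lra.
Qed.

End Kernel.

(** * Exponential decay of the moments *)

Section Decay.
Context {R : realType}.
Local Notation C := R[i]^o.
Local Notation Re := (@complex.Re R).
Local Notation Im := (@complex.Im R).
Implicit Types (h : R -> R[i]) (F : C -> C) (d e r M : R).

Lemma ccont_bounded h a b : a <= b -> ccont h a b ->
  exists M, {in `[a, b], forall x, normc (h x) <= M}.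
Proof.
move=> ab [hr hi].
have nc f : continuous_seg f a b -> exists M, {in `[a, b], forall x, `|f x| <= M}.
  move=> fc.
  have [|c cab cM] := @EVT_max R (fun x => `|f x|) a b ab.
    apply: continuous_seg_within => x xab.
    by apply: continuous_comp; [exact: fc|exact: norm_continuous].
  by exists `|f c|.
have [M1 h1] := nc _ hr; have [M2 h2] := nc _ hi.
exists (M1 + M2) => x xab; apply: le_trans (normc_le_ReIm _) _.
by rewrite lerD ?h1 ?h2.
Qed.

Lemma continuous_ccont h a b :
  (forall x, x \in `[a, b] -> {for x, continuous (h : R -> C)}) -> ccont h a b.
Proof. by move=> hc; split=> x /hc/continuousC_Re[]. Qed.

(** The rate [e] depends on the radius [r] alone. This uniformity in [F] is what later gives
    continuity on the space of germs. *)
Lemma moment_hol_le r : 0 < r -> exists2 e, 0 < e & forall F M,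
  (forall w, normc w < r -> derivable F w 1 /\ normc (F w) <= M) ->
  ccont (fun x => F x%:C) (-1) 1 ->
  {in `[-1, 1], forall x, normc (F x%:C) <= M} ->
  forall j, normc (moment j (fun x => F x%:C)) <= 8 * M * expR (- e) ^+ j.
Proof.
move=> r0.
(* As [e <= d], the rectangle of half-width [d] and height [e] lies within distance [2 r / 3] of the
   origin. *)
pose d : R := Num.min 2^-1 (r / 3).
have d0 : 0 < d by rewrite lt_min invr_gt0 ltr0n divr_gt0.
have d2 : d <= 2^-1 by rewrite ge_min lexx.
have dr : d <= r / 3 by rewrite ge_min lexx orbT.
pose e : R := Num.min 400^-1 (d ^+ 2).
have e0 : 0 < e by rewrite lt_min invr_gt0 ltr0n exprn_gt0.
have e4 : e <= 400^-1 by rewrite ge_min lexx.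
have ed : e <= d ^+ 2 by rewrite ge_min lexx orbT.
have ed' : e <= d.
  apply: le_trans ed _; rewrite expr2 ler_piMr ?ltW//; lra.
exists (e / 2); first by rewrite divr_gt0.
move=> F M FM hc hM j.
have d02 : 0 < d <= 2^-1 by rewrite d0.
have M0 : 0 <= M.
  by apply: (le_trans (normc_ge0 (F 1%:C))); apply: hM; rewrite in_itv/= lexx andbT;
      lra.
apply: le_trans (@normc_moment_le R j _ d e M d02 e0 ed hc hM) _.
have e04 : 0 < e <= 400^-1 by rewrite e0.
apply: le_trans (lerD (lexx _) (@normc_moment_local_le R j F d e M d02 e04 ed M0 _)) _.
  move=> x y; rewrite !in_itv/= => xd /andP[y0 y1]; apply: FM.
  apply: le_lt_trans (normc_le_ReIm _) _ => /=.
  have : `|x| <= d by rewrite ler_norml.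
  rewrite (ger0_norm y0); move: (`|x|) => t td; lra.
move: (expR _ ^+ j) => q; clear; lra.
Qed.

Lemma lim_normc_le (s : nat -> C) (l : C) (z : R[i]) (c : R) N :
  s @ \oo --> l -> (forall n, (N <= n)%N -> normc (s n - z) <= c) ->
  normc (l - z) <= c.
Proof.
move=> sl sc; apply/ler_addgt0Pl => e e0.
have : nbhs l [set w : C | normc (w - l) < e] by apply/nbhsC; exists e.
move=> /sl[n _ nP].
have /= := nP (maxn n N) (leq_maxl _ _).
set w := s (maxn n N) => wl.
have wz : normc (w - z) <= c by apply: sc; exact: leq_maxr.
have -> : l - z = - (w - l) + (w - z) by rewrite opprB addrA subrK.
by rewrite (le_trans (le_normcD _ _))// normcN lerD// ltW.
Qed.

(** Convergence at [x + 2 * r] bounds the terms there by a constant; at radius [r] they are then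
    smaller by the factor [2 ^- k]. *)
Lemma real_analytic_local (f : R -> C) x : f \in @is_real_analytic R ->
  exists (a : nat -> C) (r B : R), [/\ 0 < r, 0 <= B,
    forall k, normc (a k) * r ^+ k <= B / 2 ^+ k &
    forall y, `|y - x| <= r ->
      series (fun k => a k * (y - x)%:C ^+ k) @ \oo --> (f y : C)].
Proof.
move=> /asboolP/(_ x)[a] /nbhs_ballP[d /= d0 da].
pose r := d / 4.
have r0 : 0 < r by rewrite divr_gt0.
have conv y : `|y - x| < d -> series (fun k => a k * (y - x)%:C ^+ k) @ \oo --> (f y
    : C).
  by move=> yx; apply: da; rewrite /ball/= distrC.
have xr : `|(x + 2 * r) - x| < d.
  by rewrite addrAC subrr add0r ger0_norm; rewrite /r; lra.
have := conv _ xr; rewrite addrAC subrr add0r.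
set s := series _; set l := f _ => sl.
have : nbhs l [set w : C | normc (w - l) < 1] by apply/nbhsC; exists 1.
move=> /sl[N _ NP].
have term k : s k.+1 - s k = a k * (2 * r)%:C ^+ k.
  by rewrite /s /series/= big_nat_recr//= addrAC subrr add0r.
have far k : (N <= k)%N -> normc (a k * (2 * r)%:C ^+ k) <= 2.
  move=> Nk; rewrite -term.
  have /= h1 := NP k Nk; have /= h2 := NP k.+1 (leqW Nk).
  have -> : s k.+1 - s k = (s k.+1 - l) + - (s k - l) by rewrite opprB addrA subrK.
  by rewrite (le_trans (le_normcD _ _))// normcN -[2]/(1 + 1) lerD// ltW.
(* From [N] on, consecutive partial sums are within 1 of the limit, so a term is at most 2; the sum
   takes care of the earlier terms. *)
pose B := 2 + \sum_(i < N) normc (a i * (2 * r)%:C ^+ i).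
have B0 : 0 <= \sum_(i < N) normc (a i * (2 * r)%:C ^+ i).
  by apply: sumr_ge0 => i _; exact: normc_ge0.
have all k : normc (a k * (2 * r)%:C ^+ k) <= B.
  have [Nk|kN] := leqP N k.
    by apply: le_trans (far k Nk) _; rewrite /B lerDl.
  rewrite /B (bigD1 (Ordinal kN))//= addrCA lerDl addr_ge0//.
  by apply: sumr_ge0 => i _; exact: normc_ge0.
exists a, r, B; split; first exact: r0.
- by rewrite /B addr_ge0.
- move=> k; have := all k.
  rewrite normcM normcX normc_real ger0_norm; last by rewrite mulr_ge0// ltW.
  by rewrite exprMn mulrCA mulrC -ler_pdivlMr ?exprn_gt0.
- by move=> y yx; apply: conv; apply: le_lt_trans yx _; rewrite /r; lra.
Qed.

Lemma geometric_half_sum (B : R) m n : 0 <= B -> (m <= n)%N ->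
  \sum_(m <= i < n) B / 2 ^+ i <= 2 * B / 2 ^+ m.
Proof.
move=> B0 mn.
suff : \sum_(m <= i < n) B / 2 ^+ i <= 2 * B / 2 ^+ m - 2 * B / 2 ^+ n.
  move/le_trans; apply; rewrite lerBlDr lerDl divr_ge0 ?exprn_ge0 ?mulr_ge0//.
elim: n mn => [|n IH]; first by rewrite leqn0 => /eqP ->; rewrite big_nil subrr.
rewrite leq_eqVlt => /predU1P[->|]; first by rewrite big_geq// subrr.
rewrite ltnS => mn; rewrite big_nat_recr//=; move: (IH mn).
rewrite exprSr invfM.
have -> : 2 * B * (2 ^- n * 2^-1) = B / 2 ^+ n.
  by rewrite [2 * B]mulrC mulrA mulrAC -!mulrA [2 * _]mulrA mulfV// mul1r mulrC.
move: (\sum_(_ <= i < _) _) => S.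
rewrite -[2 * B / 2 ^+ n]mulrA; move: (B / 2 ^+ n) => T; clear; lra.
Qed.

Lemma normc_series_tail (u : nat -> C) (B : R) m n : 0 <= B ->
  (forall k, (m <= k)%N -> normc (u k) <= B / 2 ^+ k) -> (m <= n)%N ->
  normc (series u n - series u m) <= 2 * B / 2 ^+ m.
Proof.
move=> B0 uB mn; rewrite sub_series_geq//.
apply: (le_trans _ (geometric_half_sum B0 mn)).
elim: n mn => [|n IH]; first by rewrite leqn0 => /eqP ->; rewrite !big_nil normc0.
rewrite leq_eqVlt => /predU1P[->|]; first by rewrite !big_geq// normc0.
rewrite ltnS => mn; rewrite !big_nat_recr//=.
by apply: le_trans (le_normcD _ _) _; apply: lerD; [exact: IH|exact: uB].
Qed.

Lemma real_analytic_continuous (f : R -> C) x : f \in @is_real_analytic R ->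
  {for x, continuous f}.
Proof.
move=> /(real_analytic_local x)[a [r [B [r0 B0 aB fa]]]].
(* For [k >= 1] the power [(|y - x| / r)^k] is at most [|y - x| / r], which factors out of the
   geometric tail. *)
have lip y : `|y - x| <= r -> normc (f y - a 0%N) <= `|y - x| * (B / r).
  move=> yx; have := fa y yx.
  set u := fun k => _ => uf.
  have B'0 : 0 <= `|y - x| / r * B by rewrite mulr_ge0// divr_ge0// ltW.
  have uB k : (1 <= k)%N -> normc (u k) <= `|y - x| / r * B / 2 ^+ k.
    case: k => // k _; rewrite /u normcM normcX normc_real -mulrA.
    have yr : (`|y - x| / r) ^+ k.+1 <= `|y - x| / r.
      rewrite exprSr ler_piMl ?divr_ge0 ?(ltW r0)//.
      by rewrite exprn_ile1 ?divr_ge0 ?(ltW r0)// ler_pdivrMr// mul1r.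
    have q0 : 0 <= `|y - x| / r by rewrite divr_ge0// ltW.
    have -> : `|y - x| ^+ k.+1 = (`|y - x| / r) ^+ k.+1 * r ^+ k.+1.
      by rewrite -exprMn divfK// gt_eqF.
    rewrite mulrCA; apply: ler_pM yr (aB k.+1); first exact: exprn_ge0.
    by rewrite mulr_ge0 ?normc_ge0// exprn_ge0// ltW.
  have E : series u 1 = a 0%N.
    by rewrite /series/= big_nat1 /u expr0 mulr1.
  rewrite (_ : _ * (B / r) = `|y - x| / r * B); last by rewrite mulrA mulrAC.
  apply: (lim_normc_le (N := 1) uf) => n n1.
  have := normc_series_tail B'0 uB n1; rewrite E expr1 => /le_trans; apply.
  by rewrite mulrAC mulfV// mul1r.
have fx : f x = a 0%N.
  have := lip x; rewrite subrr normr0 mul0r => /(_ (ltW r0)) h.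
  by apply/eqP; rewrite -subr_eq0; apply/eqP/eq0_normc/le_anti; rewrite h normc_ge0.
move=> A /nbhsC[e e0 eA]; apply/nbhs_ballP.
exists (Num.min r (e / (B / r + 1))) => /=.
  by rewrite lt_min r0 divr_gt0// ltr_wpDl ?divr_ge0// ltW.
move=> y; rewrite /ball/= distrC lt_min => /andP[yr ye]; apply: eA; rewrite fx.
apply: le_lt_trans (lip y (ltW yr)) _.
have Br : 0 < B / r + 1 by rewrite ltr_wpDl ?divr_ge0// ltW.
rewrite ltr_pdivlMr// in ye; apply: le_lt_trans ye.
by rewrite ler_wpM2l// lerDl.
Qed.

(** No holomorphic extension of [f] is built. Near [0] its Taylor polynomials are bounded by [2 * B]
    on the disc of radius [r], whatever their degree, so the change of path applies to them with a
    constant independent of [n]; the remainder on [[- d, d]] costs at most an arbitrary [eta]. *)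
Lemma moment_ranalytic (f : ranalytic R) : exists (c : R) e, 0 < e /\
  forall j, normc (moment j f) <= c * expR (- e) ^+ j.
Proof.
case: f => f fA /=.
have fc : ccont f (-1) 1.
  by apply: continuous_ccont => x _; exact: real_analytic_continuous.
have N11 : (-1 : R) <= 1 by lra.
have [M1 hM1] := ccont_bounded N11 fc.
have [a [r [B [r0 B0 aB fa]]]] := real_analytic_local 0 fA.
pose d : R := Num.min 2^-1 (r / 3).
have d0 : 0 < d by rewrite lt_min invr_gt0 ltr0n divr_gt0.
have d2 : d <= 2^-1 by rewrite ge_min lexx.
have dr : d <= r / 3 by rewrite ge_min lexx orbT.
pose e : R := Num.min 400^-1 (d ^+ 2).
have e0 : 0 < e by rewrite lt_min invr_gt0 ltr0n exprn_gt0.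
have e4 : e <= 400^-1 by rewrite ge_min lexx.
have ed : e <= d ^+ 2 by rewrite ge_min lexx orbT.
have ed' : e <= d by apply: le_trans ed _; rewrite expr2 ler_piMr ?ltW//; lra.
have d02 : 0 < d <= 2^-1 by rewrite d0.
have e04 : 0 < e <= 400^-1 by rewrite e0.
exists (4 * M1 + 4 * (2 * B)), (e / 2); split; first by rewrite divr_gt0.
move=> j; rewrite mulrDl.
apply: le_trans (@normc_moment_le R j f d e M1 d02 e0 ed fc hM1) _.
rewrite lerD2l; apply/ler_addgt0Pl => eta eta0.
pose S n (z : C) : C := series (fun k => a k * z ^+ k) n.
have [n nP] : exists n, 2 * B / 2 ^+ n <= eta / 2.
  exists (Num.bound (2 * B / (eta / 2))).
  rewrite ler_pdivrMr ?exprn_gt0// -ler_pdivrMl ?divr_gt0// mulrC.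
  have : 2 * B / (eta / 2) < (Num.bound (2 * B / (eta / 2)))%:R.
    by apply: archi_boundP; rewrite divr_ge0 ?mulr_ge0// ltW// divr_gt0.
  by move/ltW/le_trans; apply; rewrite -natrX ler_nat ltnW// ltn_expl.
have term k z : normc z <= r -> normc (a k * z ^+ k) <= B / 2 ^+ k.
  move=> zr; apply: le_trans (aB k); rewrite normcM normcX ler_wpM2l ?normc_ge0//.
  by rewrite lerXn2r ?nnegrE ?normc_ge0// ltW.
have SM z : normc z <= r -> normc (S n z) <= 2 * B.
  move=> zr; have := @normc_series_tail (fun k => a k * z ^+ k) B 0 n B0 (fun k _ =>
      term k z zr) (leq0n n).
  rewrite [X in _ - X](_ : _ = 0); last by rewrite /series/= big_geq.
  by rewrite subr0 expr0 divr1.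
have fS x : x \in `[- d, d] -> normc (f x - S n x%:C) <= eta / 2.
  rewrite in_itv/= -ler_norml => xd.
  have xr : `|x - 0| <= r by rewrite subr0 (le_trans xd)// (le_trans dr)//; lra.
  have := fa x xr; rewrite subr0 => fl; apply: (lim_normc_le (N := n) fl) => m nm.
  apply: le_trans nP; apply: normc_series_tail nm => // k _.
  by apply: term; rewrite normc_real -[x]subr0.
have Sd (z : C) : derivable (S n) z 1.
  rewrite /S /series/=; elim: (n) => [|m IH].
    by under eq_fun do rewrite big_geq//; exact: derivable_cst.
  under eq_fun do rewrite big_nat_recr//=.
  apply: derivableD; first exact: IH.
  by apply: derivableM; [exact: derivable_cst|exact: exprn_derivable].
have Sloc := @normc_moment_local_le R j (S n) d e (2 * B) d02 e04 ed.
have Sc : ccont (fun x => S n x%:C) (- d) d.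
  apply: (@derivable_ccont_h R (S n) 0) => x _; exact: Sd.
have N1d : -1 <= - d by lra. have d1 : d <= 1 by lra.
have fc' := ccont_sub N1d d1 fc.
have Dc : ccont (fun x => f x + -1 * S n x%:C) (- d) d.
  by apply: ccontD => //; apply: ccontM => //; exact: ccont_cst.
have -> : Cint (fun x => f x * kern x%:C ^+ j) (- d) d =
    Cint (fun x => S n x%:C * kern x%:C ^+ j) (- d) d +
    Cint (fun x => (f x + -1 * S n x%:C) * kern x%:C ^+ j) (- d) d.
  rewrite -CintD; try exact: ccont_moment.
  by apply: eq_Cint => x _; ring.
apply: le_trans (le_normcD _ _) _.
rewrite [leLHS]addrC; apply: lerD.
  have dd : - d <= d by lra.
  apply: le_trans (normc_Cint_le dd (ccont_moment j Dc) (M := eta / 2) _) _.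
    move=> x xd; rewrite normcM mulN1r -[eta / 2]mulr1.
    apply: ler_pM; rewrite ?normc_ge0//; first exact: fS.
    rewrite normcX exprn_ile1 ?normc_ge0//.
    have x1 : -1 <= x <= 1 by move: xd; rewrite in_itv/=; lra.
    rewrite -(@ler_sqr R) ?nnegrE ?normc_ge0// expr1n.
    by apply: le_trans (normc_kern_real_le x1) _; rewrite gerBl sqr_ge0.
  have : eta * (2 * d) <= eta * 1 by apply: ler_wpM2l; [exact: ltW|clear -d2; lra].
  by clear; lra.
apply: Sloc; first by rewrite mulr_ge0.
move=> x y; rewrite !in_itv/= -ler_norml => xd /andP[y0 y1]; split; first exact: Sd.
apply: SM; apply: le_trans (normc_le_ReIm _) _ => /=.
by rewrite (ger0_norm y0); move: (`|x|) xd => t td; lra.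
Qed.

End Decay.

(** * Continuous seminorms from moments *)

Section SupSeminorm.
Context {R : realType} {E : lmodType R[i]}.
Variable s : nat -> seminorm E.
Hypothesis s_bounded : forall x, exists c, forall j, s j x <= c.

Definition sup_seminorm_fun (x : E) : R := sup (range (fun j => s j x)).

Lemma le_sup_seminorm j x : s j x <= sup_seminorm_fun x.
Proof.
apply: ub_le_sup; last by exists j.
by have [c sc] := s_bounded x; exists c => _ [k _ <-].
Qed.

Lemma sup_seminorm_le x c : (forall j, s j x <= c) -> sup_seminorm_fun x <= c.
Proof. by move=> sc; apply: ge_sup => [|_ [j _ <-]//]; exists (s 0%N x), 0%N. Qed.

Fact sup_seminormD x y :
  sup_seminorm_fun (x + y) <= sup_seminorm_fun x + sup_seminorm_fun y.
Proof.
apply: sup_seminorm_le => j; apply: le_trans (seminormD _ _ _) _.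
by rewrite lerD// le_sup_seminorm.
Qed.

Fact sup_seminormZ a x :
  sup_seminorm_fun (a *: x) = normc a * sup_seminorm_fun x.
Proof.
have le1 b y : sup_seminorm_fun (b *: y) <= normc b * sup_seminorm_fun y.
  apply: sup_seminorm_le => j.
  by rewrite seminormZ ler_wpM2l ?normc_ge0// le_sup_seminorm.
apply/le_anti; rewrite le1/=.
have [->|a0] := eqVneq a 0.
  rewrite normc0 mul0r scale0r; apply: le_trans (le_sup_seminorm 0%N _).
  exact: seminorm_ge0.
have na : 0 < normc a.
  by rewrite lt_neqAle normc_ge0 andbT eq_sym; apply: contra_neq a0 => /eq0_normc.
by rewrite mulrC -ler_pdivlMr// mulrC -normcV -{1}[x]scale1r -(mulVf a0) -scalerA.
Qed.

Definition sup_seminorm : seminorm E := Seminorm sup_seminormD sup_seminormZ.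

End SupSeminorm.

(** * Weighted suprema of moments as continuous seminorms *)

Section MomentSeminorms.
Context {R : realType}.
Local Notation C := R[i]^o.
Local Notation Q := (Quotient.quot (@vanishing_near R (@segment R 1))).
Variable b : nat -> R.
Hypothesis b0 : forall j, 0 <= b j.
Hypothesis b_subexp : forall e, 0 < e ->
  exists c, forall j, b j * expR (- e) ^+ j <= c.

Lemma subexp_ge0 e : 0 < e ->
  exists2 c, 0 <= c & forall j, b j * expR (- e) ^+ j <= c.
Proof.
move=> /b_subexp[c bc]; exists c => //; apply: le_trans (bc 0%N).
by rewrite expr0 mulr1.
Qed.

Lemma segment1 (x : R) : x \in `[-1, 1] -> @segment R 1 x%:C.
Proof. by move=> x1; exists x. Qed.

Lemma hol_ccont (f : hol (@segment R 1)) : ccont (fun x => f x%:C) (-1) 1.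
Proof.
case: f => f /= /asboolP fh; apply: (@derivable_ccont_h R f 0) => x x1.
by have /nbhs_singleton := fh _ (segment1 x1).
Qed.

Lemma repr_pi_hol (f : hol (@segment R 1)) : {in `[-1, 1],
  (fun x : R => repr (\pi_Q f) x%:C) =1 (fun x => f x%:C)}.
Proof. by move=> x /segment1 xK; exact: germ_val. Qed.

Lemma eq_moment j (h g : R -> R[i]) : {in `[-1, 1], h =1 g} ->
  moment j h = moment j g.
Proof. by move=> hg; apply: eq_Cint => x x1; rewrite hg. Qed.

Definition germ_moment_fun j (x : Q) : R :=
  b j * normc (moment j (fun t => repr x t%:C)).

Lemma germ_moment_pi j (f : hol (@segment R 1)) :
  germ_moment_fun j (\pi_Q f) = b j * normc (moment j (fun t => f t%:C)).
Proof. by rewrite /germ_moment_fun (eq_moment j (@repr_pi_hol f)). Qed.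

Fact germ_momentD j x y :
  germ_moment_fun j (x + y) <= germ_moment_fun j x + germ_moment_fun j y.
Proof.
rewrite -[x]reprK -[y]reprK -raddfD !germ_moment_pi -mulrDr ler_wpM2l//.
rewrite (_ : moment j _ = moment j (fun t => repr x t%:C) + moment j (fun t => repr y
    t%:C)).
  exact: le_normcD.
by rewrite -momentD; [|exact: hol_ccont|exact: hol_ccont].
Qed.

Fact germ_momentZ j a x :
  germ_moment_fun j (a *: x) = normc a * germ_moment_fun j x.
Proof.
rewrite -[x]reprK [_ *: _]pi_scale !germ_moment_pi mulrCA -normcM -momentZ//.
exact: hol_ccont.
Qed.

Definition germ_moment j : seminorm Q :=
  Seminorm (germ_momentD j) (germ_momentZ j).

(** The constant does not depend on [j]: [U] contains a disc about [0], whose radius fixes an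
    exponential rate, and this rate beats the subexponential weight [b]. *)
Lemma germ_moment_bound (U : set C) : open U -> @segment R 1 `<=` U ->
  exists2 c, 0 <= c & forall (f : hol (@segment R 1)) M,
    (forall w, U w -> derivable f w 1 /\ normc (f w) <= M) ->
    forall j, germ_moment j (\pi_Q f) <= c * M.
Proof.
move=> oU KU.
have U0 : U 0 by apply: KU; apply: (@segment1 0); rewrite in_itv/=; lra.
have /nbhsC[r r0 rU] : nbhs (0 : C) U by exact: open_nbhs_nbhs.
have [e e0 He] := moment_hol_le r0.
have [c c0 bc] := subexp_ge0 e0.
exists (8 * c); first by rewrite mulr_ge0.
move=> f M fM j; rewrite [germ_moment _ _]germ_moment_pi.
have M0 : 0 <= M by apply: le_trans (normc_ge0 _) (fM _ U0).2.
apply: (@le_trans _ _ (b j * (8 * M * expR (- e) ^+ j))).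
  rewrite ler_wpM2l//; apply: (He f M _ (hol_ccont f)) => [w wr|x x1].
    by apply: fM; apply: rU; rewrite subr0.
  by apply: (fM _ _).2; apply: KU; exact: segment1.
have := ler_wpM2l M0 (bc j); move: (expR _ ^+ j) (b j) => q bj; clear; lra.
Qed.

(** Every germ thus lies in one of the Banach spaces of the inductive limit, so that the supremum of
    its weighted moments is finite. *)
Lemma segment_bounded_nbhs (f : hol (@segment R 1)) : exists (U : set C) M,
  [/\ open U, @segment R 1 `<=` U &
    forall w, U w -> derivable f w 1 /\ normc (f w) <= M].
Proof.
have N11 : (-1 : R) <= 1 by lra.
have [M fM] := ccont_bounded N11 (hol_ccont f).
exists [set z : C | nbhs z [set w : C | derivable f w 1 /\ normc (f w) <= M + 1]].
exists (M + 1); split.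
- rewrite openE => z /=; exact: nbhs_interior.
- move=> _ [x x1 <-] /=.
  have fh : \forall w \near (x%:C : C), derivable f w 1.
    by case: f {fM} => f /= /asboolP fh; apply: fh; exact: segment1.
  have fx : {for (x%:C : C), continuous f}.
    have /derivable1_diffP/differentiable_continuous// : derivable f (x%:C : C) 1.
    exact: nbhs_singleton fh.
  have /fx fx1 : nbhs (f x%:C) [set w : C | normc (w - f x%:C) < 1].
    by apply/nbhsC; exists 1.
  near=> w; split; first by near: w.
  have fw : normc (f w - f x%:C) < 1 by near: w; exact: fx1.
  rewrite -[f w](subrK (f x%:C)) addrC (le_trans (le_normcD _ _))//.
  by rewrite lerD ?fM// ltW.
- by move=> w /= /nbhs_singleton.
Unshelve. all: by end_near. Qed.

Lemma germ_moment_pointwise x : exists c, forall j, germ_moment j x <= c.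
Proof.
rewrite -[x]reprK; have [U [M [oU KU fM]]] := segment_bounded_nbhs (repr x).
have [c _ H] := germ_moment_bound oU KU.
by exists (c * M) => j; exact: H.
Qed.

Definition germ_sup_moment : seminorm Q := sup_seminorm germ_moment_pointwise.

Lemma germ_sup_moment_continuous :
  continuous (germ_sup_moment : germ (@segment R 1) -> R).
Proof.
apply: lctop_continuous => U oU KU; have [c _ H] := germ_moment_bound oU KU.
by exists c => f M fM; apply: sup_seminorm_le => j; exact: H.
Qed.

Lemma ranalytic_ccont (f : ranalytic R) : ccont f (-1) 1.
Proof.
case: f => f fA; apply: continuous_ccont => x _ /=.
exact: real_analytic_continuous.
Qed.

Definition ra_moment_fun j (f : ranalytic R) : R := b j * normc (moment j f).

Fact ra_momentD j f g :
  ra_moment_fun j (f + g) <= ra_moment_fun j f + ra_moment_fun j g.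
Proof.
rewrite /ra_moment_fun -mulrDr ler_wpM2l//.
rewrite (_ : moment j (f + g) = moment j f + moment j g); first exact: le_normcD.
by rewrite -momentD; [|exact: ranalytic_ccont|exact: ranalytic_ccont].
Qed.

Fact ra_momentZ j (a : R[i]) f :
  ra_moment_fun j (a *: f) = normc a * ra_moment_fun j f.
Proof.
rewrite /ra_moment_fun mulrCA -normcM -momentZ//; exact: ranalytic_ccont.
Qed.

Definition ra_moment j : seminorm (ranalytic R) :=
  Seminorm (ra_momentD j) (ra_momentZ j).

(** Finiteness is proved on analytic functions themselves: [extends] is a mere relation, and going
    through germs would require an extension of [f]. *)
Lemma ra_moment_pointwise f : exists c, forall j, ra_moment j f <= c.
Proof.
have [c [e [e0 fe]]] := moment_ranalytic f.
have [d d0 bd] := subexp_ge0 e0.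
exists (`|c| * d) => j; rewrite /= /ra_moment_fun.
apply: le_trans (ler_wpM2l (b0 j) (fe j)) _.
rewrite mulrCA; apply: (@le_trans _ _ (`|c| * (b j * expR (- e) ^+ j))).
  by rewrite ler_wpM2r ?ler_norm// mulr_ge0// exprn_ge0// expR_ge0.
by rewrite ler_wpM2l.
Qed.

Definition ra_sup_moment : seminorm (ranalytic R) :=
  sup_seminorm ra_moment_pointwise.

Lemma ra_sup_moment_projective : projective_seminorms ra_sup_moment.
Proof.
exists 1%N, germ_sup_moment.
split; first exact: germ_sup_moment_continuous.
move=> f g fg.
suff -> : ra_sup_moment f = sup (range (fun j => germ_moment j (germ_of g))) by [].
suff -> : (fun j => germ_moment j (germ_of g)) = (fun j => ra_moment j f) by [].
apply/funext => j; apply: etrans (germ_moment_pi j g) _.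
congr (b j * normc _).
by apply: eq_moment => x x1; exact: (@nbhs_singleton _ x _ (fg x x1)).
Qed.

Lemma ra_sup_moment_continuous : continuous (ra_sup_moment : real_analytic R -> R).
Proof. exact: lctop_continuous ra_sup_moment_projective. Qed.

Lemma ra_moment_le_sup j (f : ranalytic R) :
  b j * normc (moment j f) <= ra_sup_moment f.
Proof. exact: (le_sup_seminorm ra_moment_pointwise j f). Qed.

End MomentSeminorms.

(** * Functions with slowly decaying moments *)

Section LogDerivative.
Context {R : realType}.
Local Notation C := R[i]^o.
Local Notation Re := (@complex.Re R).
Local Notation Im := (@complex.Im R).

Lemma cvgC_normc (s : nat -> C) (l : C) :
  (forall e, 0 < e -> exists N, forall n, (N <= n)%N -> normc (s n - l) < e) ->
  s @ \oo --> l.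
Proof.
move=> sl A /nbhsC[e e0 eA]; have [N NP] := sl e e0.
by exists N => // n /= Nn; apply: eA; exact: NP.
Qed.

Lemma is_derive_approx_real (f : R -> R) x l :
  (forall e, 0 < e -> exists2 h, 0 < h & forall t, `|t - x| < h ->
     `|f t - f x - l * (t - x)| <= e * `|t - x|) -> is_derive x 1 f l.
Proof.
move=> fx.
suff fl : h^-1 *: (f (h *: 1 + x) - f x) @[h --> 0^'] --> l.
  by apply: DeriveDef; [apply/cvg_ex; exists l|exact: cvg_lim fl].
apply/cvgrPdist_le => e e0; have [h h0 hf] := fx e e0.
apply/nbhs_ballP; exists h => //= t; rewrite /ball/= sub0r normrN => th t0.
have := hf (t + x); rewrite addrK [t%:A]mulr1 => /(_ th) H.
have -> : l - t^-1 *: (f (t + x) - f x) =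
    - (t^-1 * (f (t + x) - f x - l * t)).
  by rewrite /GRing.scale/=; field.
by rewrite normrN normrM normfV ler_pdivrMl ?normr_gt0// [leRHS]mulrC.
Qed.

Lemma is_derive_ReIm (F : C -> C) (x : R) (D : R[i]) :
  is_derive (x%:C : C) 1 F D ->
  is_derive x 1 (fun t => Re (F t%:C)) (Re D) /\
  is_derive x 1 (fun t => Im (F t%:C)) (Im D).
Proof.
move=> /is_derive_approx FD.
have H e : 0 < e -> exists2 h, 0 < h & forall t, `|t - x| < h ->
    normc (F t%:C - F x%:C - D * (t - x)%:C) <= e * `|t - x|.
  move=> /FD[h h0 hF]; exists h => // t th.
  by have := hF t%:C; rewrite -rmorphB normc_real; exact.
split; apply: is_derive_approx_real => e /H[h h0 hF]; exists h => // t /hF.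
  by apply/le_trans; apply: le_trans (normr_Re _); rewrite !ReB ReM/= mulr0 subr0.
by apply/le_trans; apply: le_trans (normr_Im _); rewrite !ImB ImM/= mulr0 add0r.
Qed.

Definition kern' (z : R[i]) : R[i] := (1 - z ^+ 2) * 'i - (1 + 'i * z) * (2 * z).

Lemma is_derive_kern (z : C) : is_derive z 1 (@kern R : C -> C) (kern' z).
Proof.
have d1 : is_derive z 1 (fun w : C => 1 - w * w : C) (- (2 * z)).
  apply: is_derive_eq; rewrite /GRing.scale/=; ring.
have d2 : is_derive z 1 (fun w : C => 1 + 'i * w : C) 'i.
  by apply: is_derive_eq; rewrite /GRing.scale/= add0r mulr1.
have d3 := is_deriveM d1 d2.
rewrite (_ : @kern R = (fun w : C => 1 - w * w : C) * (fun w : C => 1 + 'i * w : C));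
    last first.
  by apply/funext => w; rewrite /kern expr2.
apply: is_derive_eq; rewrite /kern' /GRing.scale/= expr2.
by rewrite mulrN.
Qed.

Lemma is_derive_kernX j (z : C) : is_derive z 1 (fun w : C => kern w ^+ j.+1 : C)
  (j.+1%:R * (kern' z * kern z ^+ j)).
Proof.
elim: j => [|j IH].
  by rewrite expr0 mulr1 mul1r; under eq_fun do rewrite expr1; exact: is_derive_kern.
under eq_fun do rewrite exprS.
have d := is_deriveM (is_derive_kern z) IH.
rewrite (_ : (fun w : C => _) = (@kern R : C -> C) * (fun w : C => kern w ^+ j.+1 :
    C))//.
apply: is_derive_eq; rewrite /GRing.scale/= -[j.+2%:R]natr1.
rewrite [kern z ^+ j.+1]exprS; ring.
Qed.

Lemma ccont_kern' a b : ccont (fun x : R => kern' x%:C) a b.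
Proof.
have rc := @ccont_real R a b; have kc := fun z => @ccont_cst R z a b.
apply: ccontD.
  apply: ccontM => //; apply: ccontD => //; under eq_fun do rewrite -mulN1r.
  by apply: ccontM => //; exact: ccontX.
under eq_fun do rewrite -mulN1r.
apply: ccontM => //; apply: ccontM; first by apply: ccontD => //; exact: ccontM.
exact: ccontM.
Qed.

Lemma kern1 : kern (1 : R[i]) = 0. Proof. by rewrite /kern expr1n subrr mul0r. Qed.
Lemma kernN1 : kern (- 1 : R[i]) = 0.
Proof. by rewrite /kern sqrrN expr1n subrr mul0r. Qed.

(** The integrand is the derivative of [K^(j+1) / (j+1)], and [K] vanishes at both end points. *)
Lemma moment_kern' j : moment j (fun x : R => kern' x%:C) = 0.
Proof.
have N11 : (-1 : R) < 1 by lra.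
have [fr fi] := ccont_moment j (ccont_kern' (-1) 1).
have dk x := is_derive_ReIm (is_derive_kernX j (x%:C : C)).
have jE (z : R[i]) : j.+1%:R * z = (j.+1%:R * Re z) +i* (j.+1%:R * Im z).
  by rewrite -[in LHS](rmorph_nat (real_complex R)); apply: eq_ReIm;
    rewrite ?ReM ?ImM /= !mul0r ?subr0 ?addr0.
have j0 : j.+1%:R != 0 :> R by rewrite pnatr_eq0.
have dRe (x : R) : is_derive x 1 (fun t => Re (kern t%:C ^+ j.+1))
    (j.+1%:R * Re (kern' x%:C * kern x%:C ^+ j)).
  by have := (dk x).1; rewrite jE.
have dIm (x : R) : is_derive x 1 (fun t => Im (kern t%:C ^+ j.+1))
    (j.+1%:R * Im (kern' x%:C * kern x%:C ^+ j)).
  by have := (dk x).2; rewrite jE.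
have := Int_FTC N11 (continuous_segZ (k := j.+1%:R) fr) (fun x _ => dRe x).
have := Int_FTC N11 (continuous_segZ (k := j.+1%:R) fi) (fun x _ => dIm x).
rewrite !IntZ// rmorphN kernN1 kern1 expr0n /= subrr => /eqP + /eqP.
rewrite !mulf_eq0 (negPf j0) /= => /eqP imE /eqP reE.
by apply: eq_ReIm.
Qed.

Lemma inv_real_analytic (w : R[i]) : Im w != 0 ->
  (fun x : R => (x%:C - w)^-1 : C) \in @is_real_analytic R.
Proof.
move=> w0; apply/asboolP => x; pose c := x%:C - w.
have ne y : y%:C - w != 0.
  by apply: contra_neq w0 => /(congr1 Im); rewrite ImB /= sub0r => /eqP; rewrite
      oppr_eq0 => /eqP.
have c0 : 0 < normc c.
  by rewrite lt_neqAle normc_ge0 andbT eq_sym; apply: contra_neq (ne x) => /eq0_normc.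
(* The geometric expansion of [1 / (c + t)] in [t = y - x]; its radius is the distance from [x] to
   the pole [w]. *)
exists (fun k => (- 1) ^+ k / c ^+ k.+1).
apply/nbhs_ballP; exists (normc c) => //= y; rewrite /ball/= distrC => yc.
set t := (y - x)%:C.
have ct : c + t = y%:C - w by rewrite /c /t rmorphB/=; ring.
have ct0 : c + t != 0 by rewrite ct.
have cn0 : c != 0 by exact: ne.
have SE n : series (fun k => (- 1) ^+ k / c ^+ k.+1 * t ^+ k) n =
    (c + t)^-1 - (- t / c) ^+ n / (c + t).
  elim: n => [|n IH].
    by rewrite /series/= big_geq// expr0 mul1r subrr.
  have -> : series (fun k => (- 1) ^+ k / c ^+ k.+1 * t ^+ k) n.+1 =
    series (fun k => (- 1) ^+ k / c ^+ k.+1 * t ^+ k) n + (- 1) ^+ n / c ^+ n.+1 * t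
        ^+ n.
    by rewrite /series/= big_nat_recr.
  rewrite IH !exprMn [(- t) ^+ n.+1]exprS [c^-1 ^+ n.+1]exprS exprSr invfM.
  rewrite -[c ^- n]exprVn [(- t) ^+ n]exprNn.
  move: ((-1) ^+ n) (t ^+ n) (c^-1 ^+ n) => u v p.
  clearbody t c; by field; rewrite ct0 cn0.
rewrite (_ : series _ = (fun n => (c + t)^-1 - (- t / c) ^+ n / (c + t))); last first.
  exact/funext.
pose q := `|y - x| / normc c.
have q0 : 0 <= q by rewrite divr_ge0// ltW.
have q1 : `|q| < 1 by rewrite ger0_norm// ltr_pdivrMr// mul1r.
have qn := cvg_expr q1.
apply: cvgC_normc => e e0.
have n0 : 0 < normc (c + t).
  by rewrite lt_neqAle normc_ge0 andbT eq_sym; apply: contra_neq ct0 => /eq0_normc.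
have /cvgr0Pnorm_lt/(_ (e * normc (c + t))) := qn.
rewrite mulr_gt0// => /(_ isT)[N _ NP]; exists N => n Nn.
rewrite -ct addrC addKr normcN normcM normcV normcX ltr_pdivrMr//.
have -> : normc (- t / c) = q by rewrite normcM normcN normcV normc_real.
by apply: le_lt_trans (ler_norm _) _; exact: NP.
Qed.

(** A polynomial copy of [kern - lam], which can be split into linear factors. *)
Definition kernS (lam : R) : {poly R[i]} :=
  (1 - 'X * 'X) * (1 + 'i%:P * 'X) - lam%:C%:P.

Lemma horner_kernS lam (z : R[i]) : (kernS lam).[z] = kern z - lam%:C.
Proof. by rewrite /kernS /kern !hornerE expr2. Qed.

Lemma horner_deriv_kernS lam (z : R[i]) : (kernS lam)^`().[z] = kern' z.
Proof.
rewrite /kernS /kern' !(derivB, derivD, derivM, derivX, derivC) !hornerE /= expr2.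
move: ('i : R[i]) => k; ring.
Qed.

Lemma log_deriv_prod (s : seq R[i]) (z : R[i]) :
  (\prod_(w <- s) ('X - w%:P)).[z] != 0 ->
  (\prod_(w <- s) ('X - w%:P))^`().[z] =
    (\prod_(w <- s) ('X - w%:P)).[z] * \sum_(w <- s) (z - w)^-1.
Proof.
elim: s => [|w s IH]; first by rewrite !big_nil mulr0 -polyC1 derivC horner0.
rewrite !big_cons hornerM !hornerE mulf_eq0 negb_or => /andP[zw zs].
rewrite derivM !hornerE derivXsubC hornerE IH// mul1r.
by field.
Qed.

(** On the real line [Im K = x (1 - x^2)], so [K] is real only at [0], [1] and [-1], where it equals
    1, 0 and 0. *)
Lemma real_kernS_neq0 lam (x : R) : 0 < lam < 1 -> kern x%:C - lam%:C != 0.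
Proof.
move=> /andP[l0 l1]; apply/eqP => E.
have := congr1 Im E; have := congr1 Re E.
rewrite /kern expr2 !(ReB, ImB, ReM, ImM, ReD, ImD)/= => E1 E2.
have : x * (1 - x ^+ 2) = 0 by rewrite expr2; lra.
move=> /eqP; rewrite mulf_eq0 => /predU1P[x0|/eqP x1].
  by move: E1; rewrite x0; lra.
have : (1 - x ^+ 2) - lam = 0 by rewrite expr2 in x1 *; lra.
by rewrite x1; lra.
Qed.

Lemma sum_real_analytic (s : seq R[i]) : all (fun w => Im w != 0) s ->
  (fun x : R => \sum_(w <- s) (x%:C - w)^-1 : C) \in @is_real_analytic R.
Proof.
elim: s => [_|w s IH /= /andP[w0 s0]].
  by under eq_fun do rewrite big_nil; exact: rpred0.
under eq_fun do rewrite big_cons.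
exact: (rpredD (inv_real_analytic w0) (IH s0)).
Qed.

(** The function is [kern' / (kern - lam)]. *)
Lemma moment_eigenfunction (lam : R) : 2 / 3 <= lam < 1 ->
  exists g : ranalytic R, moment 0 g != 0 /\
    forall j, moment j g = lam%:C ^+ j * moment 0 g.
Proof.
move=> /andP[l0 l1]; have l01 : 0 < lam < 1 by apply/andP; split; lra.
(* The quotient is a logarithmic derivative, hence the sum of [1 / (x - w)] over the roots [w]; none
   of these is real, so each summand is real analytic. *)
have [s sE] := closed_field_poly_normal (kernS lam).
set c := lead_coef _ in sE.
have sim : all (fun w => Im w != 0) s.
  apply/allP => w ws; apply/eqP => w0.
  have wR : w = (Re w)%:C by apply: eq_ReIm.
  have := @real_kernS_neq0 lam (Re w) l01; rewrite -wR -horner_kernS sE.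
  by rewrite hornerZ [X in _ * X](rootP _) ?mulr0 ?eqxx// root_prod_XsubC.
pose g := RAnalytic (sum_real_analytic sim).
have gE (x : R) : g x = kern' x%:C / (kern x%:C - lam%:C).
  have n0 := @real_kernS_neq0 lam x l01.
  rewrite -(horner_deriv_kernS lam) -horner_kernS sE derivZ !hornerZ.
  rewrite -horner_kernS sE hornerZ mulf_eq0 negb_or in n0.
  have /andP[c0 p0] := n0.
  rewrite log_deriv_prod// mulrA [_ / _]mulrAC mulfV ?mul1r//.
  by rewrite mulf_neq0.
exists g; split.
  (* [Im g] is positive on the whole segment. Up to a positive denominator it is
     [(1 - lam) + x^2 (1 - 3 (1 - lam)) + x^4], whose middle coefficient is non-negative because
     [lam >= 2 / 3]. *)
  apply: contra_neq (_ : Im (moment 0 g) != 0) => [->//|].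
  rewrite -[Im _]/(Int (fun x => Im (g x * kern x%:C ^+ 0)) (-1) 1) gt_eqF//.
  have N11 : (-1 : R) < 1 by lra.
  have [_ gi] := ccont_moment 0 (ranalytic_ccont g).
  apply: Int_gt0 => // x x1; rewrite expr0 mulr1 gE.
  have := @real_kernS_neq0 lam x l01.
  set P := 1 - x ^+ 2 - lam; set Q := x * (1 - x ^+ 2).
  have -> : kern x%:C - lam%:C = P +i* Q.
    by apply: eq_ReIm; rewrite /kern expr2 !(ReB, ImB, ReM, ImM, ReD, ImD)/= /P /Q
        ?expr2; ring.
  have -> : kern' x%:C = (- 2 * x) +i* (1 - 3 * x ^+ 2).
    by apply: eq_ReIm; rewrite /kern' expr2 !(ReB, ImB, ReM, ImM, ReD, ImD)/= ?expr2;
        ring.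
  rewrite eq_complex negb_and => PQ.
  have N0 : 0 < P ^+ 2 + Q ^+ 2.
    case/orP: PQ => /= h.
      by rewrite ltr_pwDl ?sqr_ge0// exprn_even_gt0.
    by rewrite ltr_wpDl ?sqr_ge0// exprn_even_gt0.
  rewrite ImM/=.
  have -> : - 2 * x * - (Q / (P ^+ 2 + Q ^+ 2)) + (1 - 3 * x ^+ 2) * (P / (P ^+ 2 + Q
      ^+ 2)) =
     (2 * x * Q + (1 - 3 * x ^+ 2) * P) / (P ^+ 2 + Q ^+ 2).
    by field; rewrite gt_eqF.
  apply: divr_gt0 => //.
  have -> : 2 * x * Q + (1 - 3 * x ^+ 2) * P =
      (1 - lam) + x ^+ 2 * (1 - 3 * (1 - lam)) + (x ^+ 2) ^+ 2.
    by rewrite /P /Q; ring.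
  have h1 : 0 <= x ^+ 2 * (1 - 3 * (1 - lam)).
    by apply: mulr_ge0; [exact: sqr_ge0|lra].
  have h2 := sqr_ge0 (x ^+ 2).
  lra.
(* [g K^(j+1) - lam g K^j = K' K^j], and the right-hand side integrates to zero. *)
have step j : moment j.+1 g = lam%:C * moment j g.
  have gc := ranalytic_ccont g.
  apply/eqP; rewrite -subr_eq0 -mulNr -(moment_kern' j); apply/eqP.
  rewrite -momentZ// /moment -CintD; [|exact: ccont_moment|].
    apply: eq_Cint => x _; rewrite gE.
    have n0 := @real_kernS_neq0 lam x l01.
    rewrite exprS; move: (kern' _) (kern _ ^+ j) => k p.
    by field.
  by apply: ccont_moment; apply: ccontM => //; exact: ccont_cst.
by elim=> [|j IH]; rewrite ?mul1r// step IH exprS mulrA.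
Qed.

End LogDerivative.

(** * The maximum principle *)

Section MaximumPrinciple.
Context {R : realType}.
Implicit Types (phi dphi : R -> R) (U V : R -> R -> R) (x y : R).

(** At the maximum [dphi c = 0]; with [l > 0] the derivative would be positive just to the right of
    [c], where [phi] would exceed [phi c] by the mean value theorem. *)
Lemma second_derivative_le0 phi dphi (c l h : R) : 0 < h ->
  (forall t, `|t - c| < h -> is_derive t 1 phi (dphi t)) ->
  is_derive c 1 dphi l -> (forall t, `|t - c| < h -> phi t <= phi c) -> l <= 0.
Proof.
move=> h0 dphiP ddphi cmax; rewrite leNgt; apply/negP => l0.
have inh t : t \in `]c - h, c + h[ -> `|t - c| < h.
  by rewrite in_itv/= ltr_distl.
have ch : `|c - c| < h by rewrite subrr normr0.
have phi'c : dphi c = 0.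
  have d0 : is_derive c 1 phi 0.
    apply: (@derive1_at_max _ phi (c - h) (c + h)); first lra.
    - by move=> t /inh/dphiP[].
    - by rewrite in_itv/=; apply/andP; split; lra.
    - by move=> t /inh/cmax.
  by case: (dphiP c ch) => _ <-; case: d0.
have := ddphi => -[dd dl].
have /cvgrPdist_lt : t^-1 *: (dphi (t *: 1 + c) - dphi c) @[t --> 0^'] --> l.
  by rewrite -dl; exact: dd.
move=> /(_ l l0) /nbhs_ballP[k /= k0 kP].
pose b := Num.min (h / 2) (k / 2).
have b0 : 0 < b by rewrite lt_min !divr_gt0.
have bh : b <= h / 2 by rewrite ge_min lexx.
have bk : b <= k / 2 by rewrite ge_min lexx orbT.
have near_c t : c <= t <= c + b -> `|t - c| < h.
  by move=> /andP[ct tb]; rewrite ger0_norm ?subr_ge0//; lra.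
have pos t : c < t < c + b -> 0 < dphi t.
  move=> /andP[ct tb]; have tc : 0 < t - c by rewrite subr_gt0.
  have := kP (t - c); rewrite /ball/= sub0r normrN gtr0_norm//.
  have tk : t - c < k by lra.
  move=> /(_ tk); rewrite gt_eqF// => /(_ isT).
  rewrite [(t - c)%:A]mulr1 subrK phi'c subr0 => H.
  have : 0 < (t - c)^-1 *: dphi t.
    by rewrite -subr_lt0 -ltrBrDr in H *; move: H; rewrite ltr_norml; lra.
  by rewrite /GRing.scale/= pmulr_rgt0// invr_gt0.
have cb : c < c + b by lra.
have [| |xi] := @MVT R phi dphi c (c + b) cb.
- by move=> t; rewrite in_itv/= => /andP[ct tb]; apply: dphiP; apply: near_c; rewrite
    !ltW.
- apply: continuous_seg_within => t; rewrite in_itv/= => /near_c/dphiP[+ _].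
  by move=> /derivable1_diffP/differentiable_continuous.
rewrite in_itv/= => /pos xi0 E.
have := cmax (c + b); rewrite addrAC subrr add0r gtr0_norm// => /(_ _).
have bh' : b < h by lra.
move=> /(_ bh'); rewrite -subr_le0 E addrAC subrr add0r leNgt.
by rewrite mulr_gt0.
Qed.

Definition rect_interior (x1 x2 y1 y2 x y : R) := x1 < x < x2 /\ y1 < y < y2.
Definition rect_mem (x1 x2 y1 y2 x y : R) := x1 <= x <= x2 /\ y1 <= y <= y2.
Definition rect_boundary (x1 x2 y1 y2 x y : R) := rect_mem x1 x2 y1 y2 x y /\
  [\/ x = x1, x = x2, y = y1 | y = y2].
Definition continuous2 U x y :=
  {for (x, y), continuous (fun z : R * R => U z.1 z.2)}.

Lemma continuous2_fst (f : R -> R) x y : {for x, continuous f} ->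
  continuous2 (fun x _ => f x) x y.
Proof. by move=> fc; apply: (@cvg_comp _ _ _ fst f); [exact: cvg_fst|exact: fc]. Qed.

Lemma continuous2_snd (f : R -> R) x y : {for y, continuous f} ->
  continuous2 (fun _ y => f y) x y.
Proof. by move=> fc; apply: (@cvg_comp _ _ _ snd f); [exact: cvg_snd|exact: fc]. Qed.

Lemma continuous2D U V x y : continuous2 U x y -> continuous2 V x y ->
  continuous2 (fun x y => U x y + V x y) x y.
Proof. by move=> a b; exact: continuousD a b. Qed.

Lemma continuous2B U V x y : continuous2 U x y -> continuous2 V x y ->
  continuous2 (fun x y => U x y - V x y) x y.
Proof. by move=> a b; exact: continuousB a b. Qed.

Lemma continuous2M U V x y : continuous2 U x y -> continuous2 V x y ->
  continuous2 (fun x y => U x y * V x y) x y.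
Proof. by move=> a b; exact: continuousM a b. Qed.

Lemma continuous2_comp (f : R -> R) U x y : {for U x y, continuous f} ->
  continuous2 U x y -> continuous2 (fun x y => f (U x y)) x y.
Proof. by move=> fc Uc; apply: continuous_comp => //. Qed.

Variables x1 x2 y1 y2 : R.
Hypotheses (x12 : x1 <= x2) (y12 : y1 <= y2).
Local Notation inside := (rect_interior x1 x2 y1 y2).
Local Notation on_rect := (rect_mem x1 x2 y1 y2).
Local Notation on_boundary := (rect_boundary x1 x2 y1 y2).

(** At an interior maximum both pure second derivatives would be non-positive, against the strict
    inequality on the Laplacian. *)
Lemma max_on_boundary (v vx vxx vy vyy : R -> R -> R) :
  (forall x y, on_rect x y -> continuous2 v x y) ->
  (forall x y, inside x y ->
    [/\ is_derive x 1 (v ^~ y) (vx x y), is_derive x 1 (vx ^~ y) (vxx x y),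
        is_derive y 1 (v x) (vy x y), is_derive y 1 (vy x) (vyy x y) &
        0 < vxx x y + vyy x y]) ->
  exists x y, on_boundary x y /\ forall x' y', on_rect x' y' -> v x' y' <= v x y.
Proof.
move=> vc dv.
have [||[x y]] := @compact_EVT_max _ R (fun z : R * R => v z.1 z.2)
    (`[x1, x2] `*` `[y1, y2]) _ (compact_setX (@segment_compact _ x1 x2)
        (@segment_compact _ y1 y2)).
- by exists (x1, y1); split; rewrite /= in_itv/= lexx.
- apply/continuous_in_subspaceT => -[x y]; rewrite inE => -[/= xb yb].
  by apply: vc; split; [move: xb|move: yb]; rewrite in_itv.
rewrite inE => -[/=]; rewrite !in_itv/= => xb yb vmax.
have {}vmax x' y' : on_rect x' y' -> v x' y' <= v x y.
  move=> [xb' yb']; apply: (vmax (x', y')); rewrite inE; split => /=; by rewrite in_itv.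
exists x, y; split=> //; split=> //.
have [->|xx1] := eqVneq x x1; first by constructor 1.
have [->|xx2] := eqVneq x x2; first by constructor 2.
have [->|yy1] := eqVneq y y1; first by constructor 3.
have [->|yy2] := eqVneq y y2; first by constructor 4.
exfalso.
move: (xb) (yb) => /andP[xa xb'] /andP[ya yb'].
have h1 : x1 < x by rewrite lt_neqAle eq_sym xx1.
have h2 : x < x2 by rewrite lt_neqAle xx2.
have h3 : y1 < y by rewrite lt_neqAle eq_sym yy1.
have h4 : y < y2 by rewrite lt_neqAle yy2.
pose h := Num.min (Num.min (x - x1) (x2 - x)) (Num.min (y - y1) (y2 - y)).
have h0 : 0 < h by rewrite !lt_min !subr_gt0 h1 h2 h3.
have hx t : `|t - x| < h -> x1 < t < x2.
  by rewrite !lt_min => /andP[/andP[]]; rewrite !ltr_norml => *; apply/andP; split; lra.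
have hy t : `|t - y| < h -> y1 < t < y2.
  by rewrite !lt_min => /andP[_ /andP[]]; rewrite !ltr_norml => *; apply/andP; split;
      lra.
have ins : inside x y by split; apply/andP.
have [dx dxx dy dyy] := dv x y ins.
apply/negP; rewrite -leNgt -[0]addr0; apply: lerD.
  apply: (@second_derivative_le0 (v ^~ y) (vx ^~ y) x _ h h0) dxx _.
    by move=> t /hx tx; case: (dv t y (conj tx ins.2)).
  move=> t /hx /andP[? ?]; apply: vmax; split=> //; apply/andP; split; exact: ltW.
apply: (@second_derivative_le0 (v x) (vy x) y _ h h0) dyy _.
  by move=> t /hy ty; case: (dv x t (conj ins.1 ty)).
move=> t /hy /andP[? ?]; apply: vmax; split=> //; apply/andP; split; exact: ltW.
Qed.

Lemma subharmonic_max (v vx vxx vy vyy : R -> R -> R) M :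
  (forall x y, on_rect x y -> continuous2 v x y) ->
  (forall x y, inside x y ->
    [/\ is_derive x 1 (v ^~ y) (vx x y), is_derive x 1 (vx ^~ y) (vxx x y),
        is_derive y 1 (v x) (vy x y), is_derive y 1 (vy x) (vyy x y) &
        0 <= vxx x y + vyy x y]) ->
  (forall x y, on_boundary x y -> v x y <= M) ->
  forall x y, on_rect x y -> v x y <= M.
Proof.
move=> vc dv vM x y xy; apply/ler_addgt0Pl => e e0.
pose N := `|x1| + `|x2| + 1.
have N0 : 0 < N by rewrite ltr_wpDl// addr_ge0.
(* Adding [d x^2] makes the Laplacian strictly positive; as [|x| <= N] on the rectangle, it changes
   the values by at most [e]. *)
pose d := e / N ^+ 2.
have d0 : 0 < d by rewrite divr_gt0// exprn_gt0.
have [|a b ab|a [b [abd abmax]]] := @max_on_boundary (fun x y => v x y + d * (x * x))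
  (fun x y => vx x y + 2 * d * x) (fun x y => vxx x y + 2 * d) vy vyy.
- move=> a b ab; apply: continuous2D; first exact: vc.
  apply: (@continuous2_fst (fun x => d * (x * x))).
  apply: continuousM; first exact: cst_continuous.
  by apply: continuousM; exact: cvg_id.
- have [h1 h2 h3 h4 h5] := dv a b ab; split=> //.
  + by apply: is_derive_eq; rewrite /GRing.scale/=; ring.
  + by apply: is_derive_eq; rewrite /GRing.scale/=; ring.
  + by apply: is_derive_eq; rewrite addr0.
  + by lra.
have := abmax x y xy.
have aN : `|a| <= N.
  have [[/andP[a1 a2] _] _] := abd.
  rewrite ler_norml /N; apply/andP; split.
    have := ler_norm (- x1); rewrite normrN; have := normr_ge0 x2; lra.
  have := ler_norm x2; have := normr_ge0 x1; lra.
have : d * (a * a) <= e.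
  apply: (@le_trans _ _ (d * N ^+ 2)); last by rewrite divfK ?gt_eqF ?exprn_gt0.
  apply: ler_wpM2l; first exact: ltW.
  by rewrite -[a * a]real_normK ?num_real// lerXn2r ?nnegrE// ltW.
have : 0 <= d * (x * x) by apply: mulr_ge0; [exact: ltW|exact: (sqr_ge0 x)].
have := vM a b abd; lra.
Qed.

(** [U + i V] is holomorphic and [q] harmonic, so that
    [(U ^ 2 + V ^ 2) e ^ (2 q)] is the squared modulus of the holomorphic
    function [(U + i V) e ^ (q + i r)], where [r] is conjugate to [q]. *)
Lemma weighted_max_principle (U Ux Uxx Uyy V Vx Vxx Vyy q qx qy qxx : R -> R -> R) M :
  (forall x y, on_rect x y ->
     [/\ continuous2 U x y, continuous2 V x y & continuous2 q x y]) ->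
  (forall x y, inside x y -> [/\
     [/\ is_derive x 1 (U ^~ y) (Ux x y), is_derive x 1 (Ux ^~ y) (Uxx x y),
         is_derive y 1 (U x) (- Vx x y), is_derive y 1 (fun t => - Vx x t) (Uyy x y) &
         Uxx x y + Uyy x y = 0],
     [/\ is_derive x 1 (V ^~ y) (Vx x y), is_derive x 1 (Vx ^~ y) (Vxx x y),
         is_derive y 1 (V x) (Ux x y), is_derive y 1 (Ux x) (Vyy x y) &
         Vxx x y + Vyy x y = 0] &
     [/\ is_derive x 1 (q ^~ y) (qx x y), is_derive x 1 (qx ^~ y) (qxx x y),
         is_derive y 1 (q x) (qy x y) & is_derive y 1 (qy x) (- qxx x y)]]) ->
  (forall x y, on_boundary x y ->
     (U x y * U x y + V x y * V x y) * expR (2 * q x y) <= M) ->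
  forall x y, on_rect x y -> (U x y * U x y + V x y * V x y) * expR (2 * q x y) <= M.
Proof.
move=> cUVq dUVq bM x y xy.
have jet (u u' w w' k k' : R -> R) (u'' w'' k'' t : R) :
  is_derive t 1 u (u' t) -> is_derive t 1 u' u'' ->
  is_derive t 1 w (w' t) -> is_derive t 1 w' w'' ->
  is_derive t 1 k (k' t) -> is_derive t 1 k' k'' ->
  is_derive t 1 (fun t => (u t * u t + w t * w t) * expR (2 * k t))
    ((2 * (u t * u' t + w t * w' t) + 2 * (u t * u t + w t * w t) * k' t) * expR (2 *
        k t)) /\
  is_derive t 1 (fun t => (2 * (u t * u' t + w t * w' t) + 2 * (u t * u t + w t * w
      t) * k' t) * expR (2 * k t))
    ((2 * (u' t * u' t + u t * u'' + w' t * w' t + w t * w'') + 8 * (u t * u' t + w t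
        * w' t) * k' t +
      4 * (u t * u t + w t * w t) * (k' t * k' t) + 2 * (u t * u t + w t * w t) *
          k'') * expR (2 * k t)).
  move=> *; have de : is_derive t 1 (fun t => expR (2 * k t)) (2 * k' t * expR (2 * k
      t)).
    by apply: is_derive_eq; rewrite /GRing.scale/=; ring.
  by split; apply: is_derive_eq; rewrite /GRing.scale/=; ring.
apply: (@subharmonic_max (fun x y => (U x y * U x y + V x y * V x y) * expR (2 * q x y))
  (fun x y => (2 * (U x y * Ux x y + V x y * Vx x y) + 2 * (U x y * U x y + V x y * V
      x y) * qx x y) * expR (2 * q x y))
  (fun x y => (2 * (Ux x y * Ux x y + U x y * Uxx x y + Vx x y * Vx x y + V x y * Vxx
      x y) + 8 * (U x y * Ux x y + V x y * Vx x y) * qx x y +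
      4 * (U x y * U x y + V x y * V x y) * (qx x y * qx x y) + 2 * (U x y * U x y +
          V x y * V x y) * qxx x y) * expR (2 * q x y))
  (fun x y => (2 * (U x y * - Vx x y + V x y * Ux x y) + 2 * (U x y * U x y + V x y *
      V x y) * qy x y) * expR (2 * q x y))
  (fun x y => (2 * (- Vx x y * - Vx x y + U x y * Uyy x y + Ux x y * Ux x y + V x y *
      Vyy x y) + 8 * (U x y * - Vx x y + V x y * Ux x y) * qy x y +
      4 * (U x y * U x y + V x y * V x y) * (qy x y * qy x y) + 2 * (U x y * U x y +
          V x y * V x y) * - qxx x y) * expR (2 * q x y)) M _ _ bM x y xy).
- move=> a b /cUVq[cU cV cq]; apply: continuous2M.
    by apply: continuous2D; exact: continuous2M.
  apply: (@continuous2_comp expR); first exact: continuous_expR.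
  by apply: continuous2M => //; exact: cst_continuous.
- move=> a b /dUVq[[u1 u2 u3 u4 u5] [w1 w2 w3 w4 w5] [q1 q2 q3 q4]].
  have [jx1 jx2] := jet (U ^~ b) (Ux ^~ b) (V ^~ b) (Vx ^~ b) (q ^~ b) (qx ^~ b) _ _
      _ a u1 u2 w1 w2 q1 q2.
  have [jy1 jy2] := jet (U a) (fun t => - Vx a t) (V a) (Ux a) (q a) (qy a) _ _ _ b
      u3 u4 w3 w4 q3 q4.
  split=> //; rewrite -mulrDl mulr_ge0 ?expR_ge0//.
  have -> : Uyy a b = - Uxx a b by lra.
  have -> : Vyy a b = - Vxx a b by lra.
  move: (U a b) (V a b) (Ux a b) (Vx a b) (qx a b) (qy a b) (Uxx a b) (Vxx a b) (qxx
      a b).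
  move=> u w p r kx ky u'' w'' k''.
  (* For [f = U + i V] the Laplacian is [4 e^(2q) |f' + f (qx - i qy)|^2]; the two squares come from
     the real and imaginary parts. *)
  have := addr_ge0 (sqr_ge0 (p + u * kx + w * ky)) (sqr_ge0 (r + w * kx - u * ky)).
  lra.
Qed.

End MaximumPrinciple.

(** * Symmetry of mixed second derivatives *)

Section MixedPartials.
Context {R : realType}.

Lemma is_derive_continuous (f : R -> R) (x l : R) : is_derive x 1 f l -> {for x,
    continuous f}.
Proof. by move=> [/derivable1_diffP/differentiable_continuous]. Qed.

Let rectangle_increment (U Ux Uxy : R -> R -> R) (x y h : R) : 0 < h ->
  (forall s t : R, x <= s <= x + h -> y <= t <= y + h ->
    is_derive s 1 (U ^~ t) (Ux s t) /\ is_derive t 1 (Ux s) (Uxy s t)) ->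
  exists s t, [/\ x <= s <= x + h, y <= t <= y + h &
    U (x + h) (y + h) - U (x + h) y - U x (y + h) + U x y = h * h * Uxy s t].
Proof.
move=> h0 dU.
have xh : x < x + h by lra. have yh : y < y + h by lra.
have y0 : y <= y <= y + h by rewrite lexx ltW.
have y1 : y <= y + h <= y + h by rewrite lexx ltW.
pose f s := U s (y + h) - U s y.
have df s : x <= s <= x + h -> is_derive s 1 f (Ux s (y + h) - Ux s y).
  move=> sx; have [d1 _] := dU s _ sx y1; have [d2 _] := dU s _ sx y0.
  exact: is_deriveB.
have [| |s] := @MVT R f (fun s => Ux s (y + h) - Ux s y) x (x + h) xh.
- by move=> s; rewrite in_itv/= => /andP[/ltW a /ltW b]; apply: df; rewrite a.
- apply: continuous_seg_within => s; rewrite in_itv/= => /df; exact: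
    is_derive_continuous.
rewrite in_itv/= => /andP[/ltW s1 /ltW s2] E.
have sx : x <= s <= x + h by rewrite s1.
have [| |t] := @MVT R (Ux s) (Uxy s) y (y + h) yh.
- move=> t; rewrite in_itv/= => /andP[/ltW a /ltW b].
  by have [|_ //] := dU s t sx; rewrite a.
- apply: continuous_seg_within => t; rewrite in_itv/= => tb.
  by have [_ /is_derive_continuous] := dU s t sx tb.
rewrite in_itv/= => /andP[/ltW t1 /ltW t2] E2.
exists s, t; split=> //; first by rewrite t1.
have -> : U (x + h) (y + h) - U (x + h) y - U x (y + h) + U x y = f (x + h) - f x.
  by rewrite /f; ring.
rewrite E E2; ring.
Qed.

(** Schwarz's theorem: the second difference over a small square is, up to the area, a value of
    either mixed derivative, depending on the order in which the mean value theorem is applied;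
    continuity concludes. *)
Lemma mixed_partials (U Ux Uy Uxy Uyx : R -> R -> R) (x y h : R) : 0 < h ->
  (forall s t : R, `|s - x| < h -> `|t - y| < h ->
    [/\ is_derive s 1 (U ^~ t) (Ux s t), is_derive t 1 (Ux s) (Uxy s t),
        is_derive t 1 (U s) (Uy s t) & is_derive s 1 (Uy ^~ t) (Uyx s t)]) ->
  continuous2 Uxy x y -> continuous2 Uyx x y -> Uxy x y = Uyx x y.
Proof.
move=> h0 dU c1 c2; apply/eqP; rewrite -subr_eq0 -normr_le0; apply/ler_addgt0Pl => e e0.
rewrite addr0.
have e2 : 0 < e / 2 by rewrite divr_gt0.
move/cvgrPdist_lt: c1 => /(_ _ e2) H1; move/cvgrPdist_lt: c2 => /(_ _ e2) H2.
have [d /= d0 dP] : exists2 d : R, 0 < d & forall s t, `|s - x| < d -> `|t - y| < d ->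
    `|Uxy x y - Uxy s t| < e / 2 /\ `|Uyx x y - Uyx s t| < e / 2.
  have /nbhs_ballP[d d0 dP] : nbhs (x, y) [set z : R * R |
    `|Uxy x y - Uxy z.1 z.2| < e / 2 /\ `|Uyx x y - Uyx z.1 z.2| < e / 2].
    by apply: filterI.
  exists d => // s t sx ty; apply: (dP (s, t)).
  by split; rewrite /ball/= distrC.
pose k := Num.min (h / 2) (d / 2).
have k0 : 0 < k by rewrite lt_min !divr_gt0.
have kh : k <= h / 2 by rewrite ge_min lexx.
have kd : k <= d / 2 by rewrite ge_min lexx orbT.
have near_x a s : a <= s <= a + k -> `|s - a| < h /\ `|s - a| < d.
  by move=> /andP[? ?]; rewrite ger0_norm ?subr_ge0//; split; lra.
have [s [t [sx ty E1]]] : exists s t, [/\ x <= s <= x + k, y <= t <= y + k &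
    U (x + k) (y + k) - U (x + k) y - U x (y + k) + U x y = k * k * Uxy s t].
  apply: (@rectangle_increment U Ux) => // s t /near_x[s1 _] /near_x[t1 _].
  by case: (dU s t s1 t1).
have [t' [s' [ty' sx' E2]]] : exists t s, [/\ y <= t <= y + k, x <= s <= x + k &
    U (x + k) (y + k) - U x (y + k) - U (x + k) y + U x y = k * k * Uyx s t].
  apply: (@rectangle_increment (fun y x => U x y) (fun y x => Uy x y) (fun y x => Uyx
      x y)) => //.
  by move=> t' s' /near_x[t1 _] /near_x[s1 _]; case: (dU s' t' s1 t1).
have E : Uxy s t = Uyx s' t'.
  have kk : k * k != 0 by rewrite mulf_neq0 ?gt_eqF.
  by apply: (mulfI kk); rewrite -E1 -E2; ring.
have [_ s1] := near_x _ _ sx; have [_ t1] := near_x _ _ ty.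
have [_ s1'] := near_x _ _ sx'; have [_ t1'] := near_x _ _ ty'.
have [b1 _] := dP _ _ s1 t1; have [_ b2] := dP _ _ s1' t1'.
have -> : Uxy x y - Uyx x y = (Uxy x y - Uxy s t) - (Uyx x y - Uyx s' t').
  by rewrite E; ring.
rewrite (le_trans (ler_normB _ _))// [e]splitr lerD// ltW//.
Qed.

End MixedPartials.

(** * Bump functions *)

Section Bump.
Context {R : realType}.
Implicit Types (s x y : R) (k : nat).

(** The powers of [1 / s] make the family closed under differentiation up to linear combinations; in
    particular [bump 2] is the derivative of [bump 0]. *)
Definition bump k s : R := if 0 < s then s^-1 ^+ k * expR (- s^-1) else 0.

Lemma bump_ge0 k s : 0 <= bump k s.
Proof.
rewrite /bump; case: ifP => // s0.
by rewrite mulr_ge0 ?expR_ge0// exprn_ge0// invr_ge0 ltW.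
Qed.

Lemma bump_gt0 k s : 0 < s -> 0 < bump k s.
Proof. by move=> s0; rewrite /bump s0 mulr_gt0 ?expR_gt0// exprn_gt0// invr_gt0. Qed.

Lemma bump0 k s : s <= 0 -> bump k s = 0.
Proof. by rewrite /bump leNgt; case: ifP. Qed.

(** The exponential of [1 / s] dominates the term of order [k + 2] of its series. A quadratic bound
    is what differentiability at [0] asks for. *)
Lemma bump_le k s : bump k s <= (k.+2)`!%:R * s ^+ 2.
Proof.
have [s0|s0] := leP s 0.
  by rewrite bump0// mulr_ge0// sqr_ge0.
rewrite /bump s0 expRN ler_pdivrMr ?expR_gt0//.
have t0 : 0 <= s^-1 by rewrite invr_ge0 ltW.
have := expR_ge1Dxn k.+1 t0.
set E := expR _ => H.
have f0 : (0 : R) < (k.+2)`!%:R by rewrite ltr0n fact_gt0.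
have {}H : s^-1 ^+ k.+2 <= (k.+2)`!%:R * E.
  by rewrite mulrC -ler_pdivrMr//; apply: le_trans H; rewrite lerDr.
have -> : s^-1 ^+ k = s^-1 ^+ k.+2 * s ^+ 2.
  by rewrite -addn2 exprD -mulrA -exprMn mulVf ?gt_eqF// expr1n mulr1.
by rewrite [leRHS]mulrAC ler_wpM2r// sqr_ge0.
Qed.

Lemma is_derive_bump k s : is_derive s 1 (bump k) (bump k.+2 s - k%:R * bump k.+1 s).
Proof.
have [s0|s0|s0] := ltgtP s 0.
- rewrite !bump0 ?ltW// mulr0 subrr.
  apply: (@near_eq_is_derive _ _ _ (cst 0)).
  near=> t; rewrite bump0//; apply/ltW; near: t; exact: lt_nbhsl.
- have sN0 : s != 0 by rewrite gt_eqF.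
  have dV : is_derive s 1 (fun t : R => t^-1) (- s ^- 2).
    have := @is_deriveV R id s 1 1 sN0 (is_derive_id s 1).
    by rewrite /GRing.scale/= mulr1.
  have dX : is_derive s 1 (fun t : R => t^-1 ^+ k) (- (k%:R * s^-1 ^+ k.+1)).
    elim: k {dV} (dV) => [|k IH] dV.
      rewrite mul0r oppr0; under eq_fun do rewrite expr0; exact: is_derive_cst.
    under eq_fun do rewrite exprS.
    have d := is_deriveM dV (IH dV).
    rewrite (_ : (fun t : R => _) = (fun t : R => t^-1) * (fun t : R => t^-1 ^+ k))//.
    apply: is_derive_eq; rewrite /GRing.scale/= -[k.+1%:R]natr1 -exprVn.
    by rewrite [s^-1 ^+ k.+2]exprS [s^-1 ^+ k.+1]exprS; ring.
  have dE : is_derive s 1 (fun t : R => expR (- t^-1)) (s ^- 2 * expR (- s^-1)).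
    have dN : is_derive s 1 (fun t : R => - t^-1) (s ^- 2).
      by apply: is_derive_eq; rewrite opprK.
    apply: is_derive_eq; rewrite /GRing.scale/=; ring.
  apply: (@near_eq_is_derive _ _ _ (fun t : R => t^-1 ^+ k * expR (- t^-1))).
    near=> t; rewrite /bump ifT//; near: t; exact: lt_nbhsr.
  have d := is_deriveM dX dE.
  rewrite (_ : (fun t : R => _) = (fun t : R => t^-1 ^+ k) * (fun t : R => expR (-
      t^-1)))//.
  apply: is_derive_eq; rewrite /GRing.scale/= /bump s0 -exprVn.
  by rewrite [s^-1 ^+ k.+2]exprS [s^-1 ^+ k.+1]exprS; ring.
- rewrite s0 !bump0// mulr0 subrr; apply: is_derive_approx_real => e e0.
  have f0 : (0 : R) < (k.+2)`!%:R by rewrite ltr0n fact_gt0.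
  exists (e / (k.+2)`!%:R); first by rewrite divr_gt0.
  move=> t; rewrite subr0 mul0r (@bump0 k 0)// !subr0 => te.
  rewrite ger0_norm ?bump_ge0//; apply: le_trans (bump_le k t) _.
  rewrite -[t ^+ 2]real_normK ?num_real// expr2 mulrA.
  by rewrite ler_wpM2r// mulrC -ler_pdivlMr// ltW.
Unshelve. all: by end_near. Qed.

Lemma bump_continuous k : continuous (bump k).
Proof. by move=> s; apply: is_derive_continuous (is_derive_bump k s). Qed.

(** Linear combinations of [X ^ i Y ^ j bump k (r ^ 2 - X ^ 2 - Y ^ 2)], where
    [X = x - a] and [Y = y - b]: they are closed under partial derivatives. *)
Inductive bexpr :=
  | Bump of nat
  | BX of bexpr
  | BY of bexpr
  | BScale of R & bexpr
  | BAdd of bexpr & bexpr.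

Fixpoint beval a b r e x y : R := match e with
  | Bump k => bump k (r ^+ 2 - (x - a) ^+ 2 - (y - b) ^+ 2)
  | BX e => (x - a) * beval a b r e x y
  | BY e => (y - b) * beval a b r e x y
  | BScale c e => c * beval a b r e x y
  | BAdd e1 e2 => beval a b r e1 x y + beval a b r e2 x y
  end.

Definition dBump k := BAdd (Bump k.+2) (BScale (- k%:R) (Bump k.+1)).

Fixpoint dX e := match e with
  | Bump k => BScale (- 2) (BX (dBump k))
  | BX e => BAdd e (BX (dX e))
  | BY e => BY (dX e)
  | BScale c e => BScale c (dX e)
  | BAdd e1 e2 => BAdd (dX e1) (dX e2)
  end.

Fixpoint dY e := match e with
  | Bump k => BScale (- 2) (BY (dBump k))
  | BX e => BX (dY e)
  | BY e => BAdd e (BY (dY e))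
  | BScale c e => BScale c (dY e)
  | BAdd e1 e2 => BAdd (dY e1) (dY e2)
  end.

Section Evaluation.
Variables a b r : R.
Local Notation ev := (beval a b r).

Lemma is_derive_comp_bump k (g : R -> R) (t dg : R) : is_derive t 1 g dg ->
  is_derive t 1 (fun t => bump k (g t)) (dg * (bump k.+2 (g t) - k%:R * bump k.+1 (g
      t))).
Proof. by move=> gt; have := @is_derive1_comp R (bump k) g t _ _ (is_derive_bump k (g
    t)) gt; rewrite mulrC. Qed.

Lemma is_derive_dX e x y : is_derive x 1 (ev e ^~ y) (ev (dX e) x y).
Proof.
elim: e => [k|e IH|e IH|c e IH|e1 IH1 e2 IH2] /=.
- have d : is_derive x 1 (fun t : R => r ^+ 2 - (t - a) ^+ 2 - (y - b) ^+ 2) (- 2 *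
    (x - a)).
    apply: is_derive_eq; rewrite /GRing.scale/= ?expr1; ring.
  apply: (is_derive_eq (is_derive_comp_bump k d)); ring.
- by apply: is_derive_eq; rewrite /GRing.scale/=; ring.
- by apply: is_derive_eq; rewrite /GRing.scale/=; ring.
- by apply: is_derive_eq; rewrite /GRing.scale/=; ring.
- exact: is_deriveD.
Qed.

Lemma is_derive_dY e x y : is_derive y 1 (ev e x) (ev (dY e) x y).
Proof.
elim: e => [k|e IH|e IH|c e IH|e1 IH1 e2 IH2] /=.
- have d : is_derive y 1 (fun t : R => r ^+ 2 - (x - a) ^+ 2 - (t - b) ^+ 2) (- 2 *
    (y - b)).
    apply: is_derive_eq; rewrite /GRing.scale/= ?expr1; ring.
  apply: (is_derive_eq (is_derive_comp_bump k d)); ring.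
- by apply: is_derive_eq; rewrite /GRing.scale/=; ring.
- by apply: is_derive_eq; rewrite /GRing.scale/=; ring.
- by apply: is_derive_eq; rewrite /GRing.scale/=; ring.
- exact: is_deriveD.
Qed.

Lemma beval_continuous e x y : continuous2 (ev e) x y.
Proof.
have cX : continuous2 (fun x _ : R => x - a) x y.
  by apply: (@continuous2_fst _ (fun x => x - a)); apply: continuousB; [exact:
      cvg_id|exact: cst_continuous].
have cY : continuous2 (fun _ y : R => y - b) x y.
  by apply: (@continuous2_snd _ (fun y => y - b)); apply: continuousB; [exact:
      cvg_id|exact: cst_continuous].
elim: e => [k|e IH|e IH|c e IH|e1 IH1 e2 IH2] /=.
- apply: (@continuous2_comp _ (bump k)); first exact: bump_continuous.
  apply: continuous2B; last exact: continuous2M.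
  by apply: continuous2B; [exact: cst_continuous|exact: continuous2M].
- exact: continuous2M.
- exact: continuous2M.
- by apply: continuous2M => //; exact: cst_continuous.
- exact: continuous2D.
Qed.

Lemma beval_eq0 e x y : r ^+ 2 <= (x - a) ^+ 2 + (y - b) ^+ 2 -> ev e x y = 0.
Proof.
move=> rxy; elim: e => [k|e IH|e IH|c e IH|e1 IH1 e2 IH2] /=.
- by rewrite bump0//; lra.
- by rewrite IH mulr0.
- by rewrite IH mulr0.
- by rewrite IH mulr0.
- by rewrite IH1 IH2 addr0.
Qed.

(** Everything vanishes outside the disc, and inside it the factors [x - a] and [y - b] are at most
    [|r|]. *)
Lemma beval_bounded e : exists c, forall x y, `|ev e x y| <= c.
Proof.
have small x y : (x - a) ^+ 2 + (y - b) ^+ 2 < r ^+ 2 -> `|x - a| <= `|r| /\ `|y - b|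
    <= `|r|.
  move=> H; have := sqr_ge0 (x - a); have := sqr_ge0 (y - b) => h1 h2.
  by split; rewrite -ler_sqr ?nnegrE// !real_normK ?num_real//; lra.
have bd (X : R -> R -> R) e' c : (forall x y, `|ev e' x y| <= c) ->
    (forall x y, (x - a) ^+ 2 + (y - b) ^+ 2 < r ^+ 2 -> `|X x y| <= `|r|) ->
    forall x y, `|X x y * ev e' x y| <= `|r| * c.
  move=> ec Xr x y; have [/beval_eq0 ->|xy] := leP (r ^+ 2) ((x - a) ^+ 2 + (y - b)
      ^+ 2).
    by rewrite mulr0 normr0 mulr_ge0// (le_trans _ (ec 0 0)).
  by rewrite normrM ler_pM ?Xr.
elim: e => [k|e [c IH]|e [c IH]|d e [c IH]|e1 [c1 IH1] e2 [c2 IH2]] /=.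
- exists ((k.+2)`!%:R * (r ^+ 2) ^+ 2) => x y; rewrite ger0_norm ?bump_ge0//.
  set s := _ - _ - _; have [s0|s0] := leP s 0.
    by rewrite bump0// mulr_ge0// sqr_ge0.
  apply: le_trans (bump_le k s) _; rewrite ler_wpM2l// ler_sqr ?nnegrE ?sqr_ge0 ?(ltW
      s0)//.
  by rewrite /s; have := sqr_ge0 (x - a); have := sqr_ge0 (y - b); lra.
- by exists (`|r| * c); apply: (bd (fun x _ => x - a)) => // x y /small[].
- by exists (`|r| * c); apply: (bd (fun _ y => y - b)) => // x y /small[].
- by exists (`|d| * c) => x y; rewrite normrM ler_wpM2l.
- by exists (c1 + c2) => x y; rewrite (le_trans (ler_normD _ _))// lerD.
Qed.

End Evaluation.

End Bump.

(** * The right-hand side *)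

Section VectorValued.
Context {R : realType}.
Local Notation C := R[i]^o.
Local Notation E := (real_analytic R).
Local Notation Re := (@complex.Re R).
Local Notation Im := (@complex.Im R).

(** Locally the right-hand side is a real function times a fixed vector, so this reduces all its
    limits to real ones. *)
Lemma cvg_scale_real {T : Type} {F : set_system T} {FF : Filter F} (c : T -> R) (l :
    R) (g : E)
  (k : T -> E) : c @ F --> l -> (\forall t \near F, k t = (c t)%:C *: g) ->
  k @ F --> (l%:C *: g : E).
Proof.
move=> cl kE A [s [sP [e e0 sA]]].
pose M := 1 + \sum_(p <- s) (p : seminorm _) g.
have M0 : 0 < M by rewrite ltr_pwDl// sumr_ge0// => p _; exact: seminorm_ge0.
have pM p : p \in s -> (p : seminorm _) g <= M.
  move=> ps; rewrite /M (big_rem p)//= addrCA lerDl addr_ge0//.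
  by rewrite sumr_ge0// => q _; exact: seminorm_ge0.
move/cvgrPdist_lt: cl => /(_ (e / M)); rewrite divr_gt0// => /(_ isT).
apply: filterS2 kE => t kt lt; apply: sA => p ps.
rewrite kt -scalerBl -rmorphB seminormZ normc_real distrC.
apply: (@le_lt_trans _ _ (`|l - c t| * M)); first by rewrite ler_wpM2l// pM.
by rewrite -ltr_pdivlMr.
Qed.

Lemma is_pderiv_unique (v : C) (f : C -> E) z (l m : E) :
  is_pderiv v f z l -> is_pderiv v f z m -> l = m.
Proof. by move=> fl fm; apply: (@cvg_unique E (@real_analytic_hausdorff R) _ _ l m fl
    fm). Qed.

Lemma pderivE (v : C) (f : C -> E) z (l : E) : is_pderiv v f z l -> pderiv v f z = l.
Proof.
move=> fl; apply: xget_unique => // m fm; exact: is_pderiv_unique fm fl.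
Qed.

Lemma pderivP (v : C) (f : C -> E) z : pderivable v f z ->
  is_pderiv v f z (pderiv v f z).
Proof. by move=> [l fl]; rewrite (pderivE fl). Qed.

Lemma is_derive_quotient (f : R -> R) (x l : R) : is_derive x 1 f l ->
  h^-1 * (f (x + h) - f x) @[h --> 0^'] --> l.
Proof.
move=> [df <-].
have -> : (fun h => h^-1 * (f (x + h) - f x)) = (fun h => h^-1 *: (f (h *: 1 + x) - f
    x)).
  by apply/funext => h; rewrite [h%:A]mulr1 [x + h]addrC.
exact: df.
Qed.

Variables (b r : nat -> R) (g : nat -> ranalytic R).
Hypotheses (r_gt0 : forall n, 0 < r n) (r_le : forall n, r n <= 4^-1).

Local Notation ev n := (beval n%:R (b n) (r n)).

(** The nearest natural number, and 0 on the whole half-line [x < 1 / 2], as [truncn] sends negative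
    numbers to 0. Hence the lower bounds below are conditional on a nonzero index. *)
Definition strip_index (x : R) : nat := Num.truncn (x + 2^-1).

(** The discs of centre [(n, b n)] and radius [r n] are pairwise disjoint, so
    that near every point [bump_sum] is a single scalar bump times a vector. *)
Definition bump_sum e (z : C) : E :=
  (ev (strip_index (Re z)) e (Re z) (Im z))%:C *: g (strip_index (Re z)).

Lemma strip_indexP x : x < (strip_index x)%:R + 2^-1 /\
  (strip_index x != 0%N -> (strip_index x)%:R - 2^-1 <= x).
Proof.
rewrite /strip_index; have [x0|x0] := leP 0 (x + 2^-1).
  have /andP[h1 h2] := truncn_itv x0.
  move: (Num.truncn _) h1 h2 => m h1; rewrite -[m.+1%:R]natr1 => h2.
  by split=> [|_]; lra.
have -> : Num.truncn (x + 2^-1) = 0%N by apply/truncn0Pn; rewrite -ltNge; lra.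
by split=> //; lra.
Qed.

Lemma ev_far n e x y : 4^-1 <= `|x - n%:R| -> ev n e x y = 0.
Proof.
move=> xn; apply: beval_eq0.
have : r n ^+ 2 <= (x - n%:R) ^+ 2.
  rewrite -[leRHS]real_normK ?num_real// ler_sqr ?nnegrE ?(ltW (r_gt0 n))//.
  exact: le_trans (r_le n) xn.
have := sqr_ge0 (y - b n); lra.
Qed.

(** At a distance between [1 / 2] and [3 / 4] from [n], both the [n]-th bump and that of the actual
    index vanish, since the radii are at most [1 / 4]. The overlap of width [1 / 4] makes the
    formula valid in a neighbourhood of every point. *)
Lemma bump_sumE n e z : Re z < n%:R + 3 / 4 -> (n != 0%N -> n%:R - 3 / 4 < Re z) ->
  bump_sum e z = (ev n e (Re z) (Im z))%:C *: (g n : E).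
Proof.
rewrite /bump_sum; case: z => x y /=; have [h1 h2] := strip_indexP x.
move: (strip_index x) h1 h2 => m h1 h2 xn1 xn2.
have [mn|nm|->//] := ltngtP m n.
  have m1n : m.+1%:R <= n%:R :> R by rewrite ler_nat.
  rewrite -natr1 in m1n.
  have n0 : n != 0%N by case: (n) mn.
  have := xn2 n0 => xn3.
  rewrite (@ev_far m); last by rewrite ger0_norm; lra.
  by rewrite (@ev_far n) ?scale0r// ler0_norm; lra.
have m1n : n.+1%:R <= m%:R :> R by rewrite ler_nat.
rewrite -natr1 in m1n.
have m0 : m != 0%N by case: (m) nm.
have := h2 m0 => h3.
rewrite (@ev_far m); last by rewrite ler0_norm; lra.
by rewrite (@ev_far n) ?scale0r// ger0_norm; lra.
Qed.

Lemma bump_sum_local z : exists n, forall e w, `|Re w - Re z| < 4^-1 ->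
  bump_sum e w = (ev n e (Re w) (Im w))%:C *: (g n : E).
Proof.
exists (strip_index (Re z)) => e w; have [h1 h2] := strip_indexP (Re z).
rewrite ltr_norml => /andP[w1 w2]; apply: bump_sumE; first lra.
by move=> /h2; lra.
Qed.

Lemma bump_sum_pderiv1 e z : is_pderiv 1 (bump_sum e) z (bump_sum (dX e) z).
Proof.
have [n nE] := bump_sum_local z.
have zz : `|Re z - Re z| < 4^-1 by rewrite subrr normr0 invr_gt0.
rewrite /is_pderiv nE//.
have d := is_derive_quotient (is_derive_dX n%:R (b n) (r n) e (Re z) (Im z)).
apply: (cvg_scale_real (g := g n) d); near=> h.
rewrite /diff_quotient (nE e z)// nE; last first.
  rewrite ReD ReM /= mul0r subr0 mulr1 addrAC subrr add0r.
  by near: h; apply: dnbhs0_lt; rewrite invr_gt0.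
rewrite -scalerBl -rmorphB scalerA -rmorphM ReD ImD ReM ImM /=.
by rewrite !mul0r mulr0 subr0 mulr1 !addr0.
Unshelve. all: by end_near. Qed.

Lemma bump_sum_pderivi e z : is_pderiv 'i%C (bump_sum e) z (bump_sum (dY e) z).
Proof.
have [n nE] := bump_sum_local z.
have zz : `|Re z - Re z| < 4^-1 by rewrite subrr normr0 invr_gt0.
rewrite /is_pderiv nE//.
have d := is_derive_quotient (is_derive_dY n%:R (b n) (r n) e (Re z) (Im z)).
apply: (cvg_scale_real (g := g n) d); near=> h.
have ReE : Re (z + h%:C * 'i%C) = Re z.
  by rewrite ReD ReM /= mul0r mulr0 subr0 addr0.
have ImE : Im (z + h%:C * 'i%C) = Im z + h.
  by rewrite ImD ImM /= mul0r mulr1 addr0.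
rewrite /diff_quotient (nE e z)// nE ?ReE ?ImE//.
by rewrite -scalerBl -rmorphB scalerA -rmorphM.
Unshelve. all: by end_near. Qed.

Lemma bump_sum_continuous e : continuous (bump_sum e).
Proof.
move=> z; have [n nE] := bump_sum_local z.
have zz : `|Re z - Re z| < 4^-1 by rewrite subrr normr0 invr_gt0.
rewrite /continuous_at nE//.
have evc : (fun w : C => ev n e (Re w) (Im w)) @ z --> ev n e (Re z) (Im z).
  have idc : {for z, continuous (fun w : C => w)} by exact: cvg_id.
  have [cR cI] := continuousC_Re idc.
  apply: (@cvg_comp _ _ _ (fun w : C => (Re w, Im w)) (fun q : R * R => ev n e q.1
      q.2)); last first.
    exact: beval_continuous.
  exact: cvg_pair cR cI.
apply: (cvg_scale_real (g := g n) evc).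
apply/nbhsC; exists 4^-1; first by rewrite invr_gt0.
move=> w wz; rewrite /= nE// -ReB; exact: le_lt_trans (normr_Re _) wz.
Qed.

Definition dB (v : bool) (e : @bexpr R) := if v then dY e else dX e.

Lemma pderiv_bump_sum (v : bool) e :
  pderiv (if v then 'i%C else 1) (bump_sum e) = bump_sum (dB v e).
Proof.
apply/funext => z; apply: pderivE; case: v => /=.
  exact: bump_sum_pderivi.
exact: bump_sum_pderiv1.
Qed.

Lemma iter_pderiv_bump_sum s e :
  iter_pderiv s (bump_sum e) = bump_sum (foldr dB e s).
Proof. by elim: s => //= v s IH; rewrite IH pderiv_bump_sum. Qed.

Lemma bump_sum_smooth T e : smooth_on T (bump_sum e).
Proof.
move=> s z _; rewrite iter_pderiv_bump_sum; split; first exact: bump_sum_continuous.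
  by exists (bump_sum (dX (foldr dB e s)) z); exact: bump_sum_pderiv1.
by exists (bump_sum (dY (foldr dB e s)) z); exact: bump_sum_pderivi.
Qed.

Lemma mderiv_bump_sum a e : mderiv a (bump_sum e) =
  bump_sum (iter a.1 dX (iter a.2 dY e)).
Proof.
case: a => k l; rewrite /mderiv /=.
have -> : iter l (pderiv 'i%C) (bump_sum e) = bump_sum (iter l dY e).
  by elim: l => //= l ->; rewrite (pderiv_bump_sum true).
by elim: k => //= k ->; rewrite (pderiv_bump_sum false).
Qed.

Variables (F G : R -> R) (W : nat -> R -> R).
Hypothesis W_system : weight_system W.
Hypothesis F_gt0 : forall x, 0 < F x.
Hypothesis disc_high : forall n x y,
  (x - n%:R) ^+ 2 + (y - b n) ^+ 2 < r n ^+ 2 -> (1 - n.+2%:R^-1) * F x < y.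

(** The [n]-th disc lies above the graph of [(1 - 1 / (n + 2)) F], so the closed strip of ratio
    [q < 1] meets only finitely many discs, and on these any weight is bounded. *)
Lemma bump_sum_weighted e : weighted_space W F G (bump_sum e).
Proof.
split; first exact: bump_sum_smooth.
move=> p pc N a q /andP[q0 q1]; rewrite mderiv_bump_sum.
set e' := iter _ _ _.
pose n0 := Num.bound (1 - q)^-1.
have q10 : 0 < 1 - q by rewrite subr_gt0.
have n0P n : (n0 <= n)%N -> q <= 1 - n.+2%:R^-1.
  move=> nn; rewrite lerBrDr addrC -lerBrDr.
  rewrite -[leRHS]invrK lef_pV2 ?posrE ?invr_gt0 ?ltr0n//.
  apply: ltW; apply: lt_le_trans (archi_boundP _) _; first by rewrite invr_ge0 ltW.
  by rewrite ler_nat (leq_trans nn)// -addn2 leq_addr.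
have [c cP] := choice (fun n => beval_bounded n%:R (b n) (r n) e').
(* A bound on the [n]-th disc, where [|Re z| <= n + 1 / 4]; [W N] is non-decreasing. *)
pose B n := expR (W N (n%:R + 1)) * (c n * p (g n)).
have c0 n : 0 <= c n by exact: le_trans (normr_ge0 _) (cP n 0 0).
have B0 n : 0 <= B n.
  by rewrite mulr_ge0 ?expR_ge0// mulr_ge0// seminorm_ge0.
have S0 : 0 <= \sum_(n < n0) B n by apply: sumr_ge0 => n _; exact: B0.
exists (\sum_(n < n0) B n) => _ [z zcl <-].
pose n := strip_index (Re z).
have [zin|zout] := ltP ((Re z - n%:R) ^+ 2 + (Im z - b n) ^+ 2) (r n ^+ 2); last first.
  by rewrite /bump_sum beval_eq0// scale0r seminorm0 mulr0.
have [nn0|n0n] := ltnP n n0; last first.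
  exfalso.
  (* The open disc contains a point of the closure, hence a point of the strip itself, which is too
     low for [disc_high]. *)
  have [w [[+ _] +]] : exists w : C, (strip (fun t => q * F t) (fun t => q * G t) w
      /\ True) /\
      (Re w - n%:R) ^+ 2 + (Im w - b n) ^+ 2 < r n ^+ 2.
    have op : nbhs z [set w : C | (Re w - n%:R) ^+ 2 + (Im w - b n) ^+ 2 < r n ^+ 2].
      have idc : {for z, continuous (fun w : C => w)} by exact: cvg_id.
      have [cR cI] := continuousC_Re idc.
      have sc : {for z, continuous (fun w : C =>
          (Re w - n%:R) * (Re w - n%:R) + (Im w - b n) * (Im w - b n))}.
        have cRn : {for z, continuous (fun w : C => Re w - n%:R)}.
          by apply: continuousB => //; exact: cst_continuous.
        have cIn : {for z, continuous (fun w : C => Im w - b n)}.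
          by apply: continuousB => //; exact: cst_continuous.
        by apply: continuousD; [exact: (continuousM cRn cRn)|exact: (continuousM cIn
            cIn)].
      by move/cvgr_lt: sc => /(_ _ zin).
    by have [w [w1 w2]] := zcl _ op; exists w.
  rewrite /strip /= => /andP[_ h1] /disc_high h2.
  have := lt_trans h2 h1; rewrite ltNge => /negP; apply.
  by rewrite ler_wpM2r ?(ltW (F_gt0 _))// n0P.
apply: (@le_trans _ _ (B n)).
  rewrite /bump_sum -/n seminormZ normc_real /B.
  have zn : `|Re z - n%:R| <= 4^-1.
    rewrite leNgt; apply/negP => far; move: zin; rewrite ltNge => /negP; apply.
    have : r n ^+ 2 <= (Re z - n%:R) ^+ 2.
      rewrite -[leRHS]real_normK ?num_real// ler_sqr ?nnegrE ?(ltW (r_gt0 n))//.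
      exact: le_trans (r_le n) (ltW far).
    have := sqr_ge0 (Im z - b n); lra.
  have [_ Wm _] := W_system.1 N.
  apply: ler_pM; rewrite ?expR_ge0 ?mulr_ge0 ?seminorm_ge0//.
    rewrite ler_expR Wm// -[Re z](subrK n%:R) (le_trans (ler_normD _ _))//.
    by rewrite normr_nat addrC lerD2l (le_trans zn)// invf_le1// ler1n.
  by rewrite ler_wpM2r ?seminorm_ge0.
rewrite (bigD1 (Ordinal nn0))//= lerDl.
by apply: sumr_ge0 => i _; exact: B0.
Qed.

End VectorValued.

(** * The two-constants estimate in a corridor *)

(** There is no second derivative in [y]: the Cauchy-Riemann equations trade one [y] for an [x]. The
    two mixed derivatives are kept apart, with the continuity needed to identify them. *)
Definition second_jet (R : realType) (v vx vy vxx vxy vyx : R -> R -> R) (x y : R) :=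
  [/\ is_derive x 1 (v ^~ y) (vx x y), is_derive y 1 (v x) (vy x y),
      is_derive x 1 (vx ^~ y) (vxx x y), is_derive y 1 (vx x) (vxy x y) &
      is_derive x 1 (vy ^~ y) (vyx x y)] /\
  [/\ continuous2 v x y, continuous2 vxy x y & continuous2 vyx x y].

Section PlanarEstimate.
Context {R : realType}.
Variables a b r L M m : R.
Hypotheses (r0 : 0 < r) (rb : r < b) (L0 : 0 <= L).

(** With this value [cos (k * (x - a))] vanishes on both vertical sides of the corridor. *)
Definition wavenumber : R := pi / (2 * r).
(** The value of [q / L] at the centre [(a, b)] of the disc: a lower bound for the harmonic measure
    of the base of the corridor seen from there. *)
Definition gain : R := expR (- wavenumber * b) - expR (- wavenumber * (b + r)).

Local Notation k := wavenumber.
Local Notation s := (expR (- k * (b + r))).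

Let k0 : 0 < k.
Proof. by rewrite divr_gt0 ?pi_gt0// mulr_gt0. Qed.

Lemma gain_gt0 : 0 < gain.
Proof. by rewrite subr_gt0 ltr_expR !mulNr ltrN2 ltr_pM2l ?k0// ltrDl. Qed.

Lemma gain_le1 : gain <= 1.
Proof.
rewrite lerBlDr; apply: (@le_trans _ _ 1); last by rewrite lerDl expR_ge0.
rewrite -[leRHS]expR0 ler_expR mulNr oppr_le0.
by apply: mulr_ge0; [exact: ltW k0|exact: ltW (lt_trans r0 rb)].
Qed.

(** With [c = a + i b], [psi] and [zeta] come from the first and second derivatives of [bump 0]; the
    chain rule gives [dbar chi = - (z - c) psi]. *)
Let psi (x y : R) := bump 2 (r ^+ 2 - (x - a) ^+ 2 - (y - b) ^+ 2).
Let chi (x y : R) := bump 0 (r ^+ 2 - (x - a) ^+ 2 - (y - b) ^+ 2).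
Let zeta (x y : R) := bump 4 (r ^+ 2 - (x - a) ^+ 2 - (y - b) ^+ 2) -
  2 * bump 3 (r ^+ 2 - (x - a) ^+ 2 - (y - b) ^+ 2).

Let rho_x (x y : R) : is_derive x 1 (fun t : R => r ^+ 2 - (t - a) ^+ 2 - (y - b) ^+
    2) (- 2 * (x - a)).
Proof. apply: is_derive_eq; rewrite /GRing.scale/= ?expr1; ring. Qed.

Let rho_y (x y : R) : is_derive y 1 (fun t : R => r ^+ 2 - (x - a) ^+ 2 - (t - b) ^+
    2) (- 2 * (y - b)).
Proof. apply: is_derive_eq; rewrite /GRing.scale/= ?expr1; ring. Qed.

Let chi_x (x y : R) : is_derive x 1 (chi ^~ y) (- 2 * (x - a) * psi x y).
Proof.
have := is_derive_comp_bump 0 (rho_x x y); rewrite mul0r subr0; exact.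
Qed.

Let psi_x (x y : R) : is_derive x 1 (psi ^~ y) (- 2 * (x - a) * zeta x y).
Proof. exact: (is_derive_comp_bump 2 (rho_x x y)). Qed.

Let psi_y (x y : R) : is_derive y 1 (psi x) (- 2 * (y - b) * zeta x y).
Proof. exact: (is_derive_comp_bump 2 (rho_y x y)). Qed.

Let chi_cont x y : continuous2 chi x y.
Proof. exact: (@beval_continuous _ a b r (Bump 0) x y). Qed.

Let chi0 x y : r ^+ 2 <= (x - a) ^+ 2 + (y - b) ^+ 2 -> chi x y = 0.
Proof. exact: (@beval_eq0 _ a b r (Bump 0)). Qed.

(** A separated harmonic function; subtracting [s], the value of the exponential on the top side,
    makes it non-positive on the top and on the vertical sides, and it is at most [L] on the
    base. *)
Let q (x y : R) := L * (expR (- k * y) * cos (k * (x - a)) - s).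
Let qx (x y : R) := - (L * k * (expR (- k * y) * sin (k * (x - a)))).
Let qxx (x y : R) := - (L * k * k * (expR (- k * y) * cos (k * (x - a)))).
Let qy (x y : R) := - (L * k * (expR (- k * y) * cos (k * (x - a)))).

Let dq (x y : R) : [/\ is_derive x 1 (q ^~ y) (qx x y), is_derive x 1 (qx ^~ y) (qxx
    x y),
  is_derive y 1 (q x) (qy x y) & is_derive y 1 (qy x) (- qxx x y)].
Proof.
by split; apply: is_derive_eq; rewrite /GRing.scale/= /qx /qxx /qy; ring.
Qed.

Let q_cont x y : continuous2 q x y.
Proof.
have cE : continuous2 (fun _ y => expR (- k * y)) x y.
  apply: (@continuous2_snd _ (fun y => expR (- k * y))).
  apply: continuous_comp; last exact: continuous_expR.
  by apply: continuousM; [exact: cst_continuous|exact: cvg_id].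
have cC : continuous2 (fun x _ => cos (k * (x - a))) x y.
  apply: (@continuous2_fst _ (fun x => cos (k * (x - a)))).
  apply: continuous_comp; last exact: continuous_cos.
  apply: continuousM; first exact: cst_continuous.
  by apply: continuousB; [exact: cvg_id|exact: cst_continuous].
apply: continuous2M; first exact: cst_continuous.
by apply: continuous2B; [exact: continuous2M|exact: cst_continuous].
Qed.

Local Notation on_rect := (rect_mem (a - r) (a + r) 0 (b + r)).
Local Notation inside := (rect_interior (a - r) (a + r) 0 (b + r)).
Local Notation boundary := (rect_boundary (a - r) (a + r) 0 (b + r)).

Let q_boundary x y : boundary x y -> (y = 0 /\ q x y <= L) \/ q x y <= 0.
Proof.
move=> [[/andP[xa xb] /andP[ya yb]] side].
have Lp : 0 <= L := L0.
have cos0 t : t = k * r \/ t = - (k * r) -> cos t = 0.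
  have kr : k * r = pi / 2 by rewrite /k; field; rewrite gt_eqF.
  by case=> ->; rewrite ?cosN kr cos_pihalf.
have s0 : 0 < s by exact: expR_gt0.
case: side => E.
- right; rewrite /q cos0; last by right; rewrite E; ring.
  by rewrite mulr0 sub0r mulrN oppr_le0 mulr_ge0// ltW.
- right; rewrite /q cos0; last by left; rewrite E; ring.
  by rewrite mulr0 sub0r mulrN oppr_le0 mulr_ge0// ltW.
- left; split=> //; rewrite /q E mulr0 expR0 mul1r.
  have := cos_le1 (k * (x - a)) => c1.
  by rewrite ler_piMr//; lra.
- right; rewrite /q E; have := cos_le1 (k * (x - a)) => c1.
  apply: mulr_ge0_le0 => //; rewrite subr_le0.
  by rewrite ler_piMr// ltW.
Qed.

(** [v1 + i v2] solves the scalar Cauchy-Riemann equation with right-hand side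
    [psi]; the pole at the centre that this forces on it is compensated in
    [(z - (a + i b)) (v1 + i v2) + chi], which is holomorphic. *)
Lemma planar_estimate (v1 v1x v1y v1xx v1xy v1yx v2 v2x v2y v2xx v2xy v2yx : R -> R
    -> R) :
  (forall x y, on_rect x y -> second_jet v1 v1x v1y v1xx v1xy v1yx x y) ->
  (forall x y, on_rect x y -> second_jet v2 v2x v2y v2xx v2xy v2yx x y) ->
  (forall x y, on_rect x y -> v1x x y - v2y x y = 2 * psi x y /\ v2x x y + v1y x y =
      0) ->
  (forall x y, on_rect x y -> v1 x y * v1 x y + v2 x y * v2 x y <= M ^+ 2) ->
  (forall x, a - r <= x <= a + r -> v1 x 0 * v1 x 0 + v2 x 0 * v2 x 0 <= m ^+ 2) ->
  bump 0 (r ^+ 2) ^+ 2 * expR (2 * (L * gain)) <=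
    (r ^+ 2 + (b + r) ^+ 2) * (M ^+ 2 + m ^+ 2 * expR (2 * L)).
Proof.
move=> dv1 dv2 CR vM vm.
have rp : 0 < r := r0; have rb' : r < b := rb; have Lp : 0 <= L := L0.
pose X (x : R) := x - a; pose Y (y : R) := y - b.
have on_inside x y : inside x y -> on_rect x y.
  by move=> [/andP[/ltW h1 /ltW h2] /andP[/ltW h3 /ltW h4]]; split; apply/andP.
have square x y : inside x y -> exists2 h, 0 < h & forall x' y', `|x' - x| < h ->
    `|y' - y| < h -> on_rect x' y'.
  move=> [/andP[h1 h2] /andP[h3 h4]].
  exists (Num.min (Num.min (x - (a - r)) (a + r - x)) (Num.min y (b + r - y))).
    by rewrite !lt_min !subr_gt0 h1 h2 h3.
  move=> x' y'; rewrite !lt_min !ltr_norml => /andP[/andP[/andP[p1 p2] /andP[p3 p4]] _].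
  by move=> /andP[_ /andP[/andP[p5 p6] /andP[p7 p8]]]; split; apply/andP; split; lra.
have sym1 x y : inside x y -> v1xy x y = v1yx x y.
  move=> xy; have [h h0 hP] := square x y xy.
  have [_ [_ c1 c2]] := dv1 x y (on_inside x y xy).
  apply: (@mixed_partials _ v1 v1x v1y v1xy v1yx x y h h0 _ c1 c2) => s' t s1 t1.
  by have [[]] := dv1 s' t (hP _ _ s1 t1).
have sym2 x y : inside x y -> v2xy x y = v2yx x y.
  move=> xy; have [h h0 hP] := square x y xy.
  have [_ [_ c1 c2]] := dv2 x y (on_inside x y xy).
  apply: (@mixed_partials _ v2 v2x v2y v2xy v2yx x y h h0 _ c1 c2) => s' t s1 t1.
  by have [[]] := dv2 s' t (hP _ _ s1 t1).
(* The equations hold around an interior point, hence may be differentiated in [x]. *)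
have CRx x y : inside x y -> v1xx x y - v2yx x y = - 4 * X x * zeta x y /\
    v2xx x y + v1yx x y = 0.
  move=> xy; have xy' := on_inside x y xy; have [h h0 hP] := square x y xy.
  have [[_ _ d1 _ d1'] _] := dv1 x y xy'; have [[_ _ d2 _ d2'] _] := dv2 x y xy'.
  have yy : `|y - y| < h by rewrite subrr normr0.
  have nearx : \forall t \near x, on_rect t y.
    by apply/nbhs_ballP; exists h => // t; rewrite /ball/= distrC => tx; exact: hP.
  split.
    have e1 : is_derive x 1 (fun t => 2 * psi t y) (v1xx x y - v2yx x y).
      apply: near_eq_is_derive (is_deriveB d1 d2').
      by apply: filterS nearx => t /CR[].
    have e2 : is_derive x 1 (fun t => 2 * psi t y) (- 4 * X x * zeta x y).
      have p := is_deriveZ 2 (psi_x x y).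
      apply: (is_derive_eq p); rewrite /GRing.scale/= /X; move: (zeta x y) => w; ring.
    by case: e1 => _ <-; case: e2.
  have e1 : is_derive x 1 (cst 0) (v2xx x y + v1yx x y).
    apply: near_eq_is_derive (is_deriveD d2 d1').
    by apply: filterS nearx => t /CR[].
  by case: e1 => _ <-; rewrite derive_cst.
pose U x y := X x * v1 x y - Y y * v2 x y + chi x y.
pose V x y := X x * v2 x y + Y y * v1 x y.
pose Ux x y := v1 x y + X x * v1x x y - Y y * v2x x y - 2 * X x * psi x y.
pose Vx x y := v2 x y + X x * v2x x y + Y y * v1x x y.
pose Uxx x y := 2 * v1x x y + X x * v1xx x y - Y y * v2xx x y - 2 * psi x y + 4 * X x
    * X x * zeta x y.
pose Vxx x y := 2 * v2x x y + X x * v2xx x y + Y y * v1xx x y.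
(* [Uyy] and [Vyy] are obtained by differentiating [- Vx] and [Ux] in [y], that is, after the
   Cauchy-Riemann equations have been used. *)
pose Uyy x y := - (v2y x y + X x * v2xy x y + v1x x y + Y y * v1xy x y).
pose Vyy x y := v1y x y + X x * v1xy x y - v2x x y - Y y * v2xy x y + 4 * X x * Y y *
    zeta x y.
have dU x y : inside x y ->
   [/\ is_derive x 1 (U ^~ y) (Ux x y), is_derive x 1 (Ux ^~ y) (Uxx x y),
       is_derive y 1 (U x) (- Vx x y), is_derive y 1 (fun t => - Vx x t) (Uyy x y) &
       Uxx x y + Uyy x y = 0].
  move=> xy; have xy' := on_inside x y xy.
  have [[a1 a2 a3 a4 a5] _] := dv1 x y xy'; have [[b1 b2 b3 b4 b5] _] := dv2 x y xy'.
  have [c1 c2] := CR x y xy'; have [c3 c4] := CRx x y xy.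
  have [e1 e2] := (sym1 x y xy, sym2 x y xy).
  have p1 := chi_x x y; have p2 := psi_x x y.
  have p3 : is_derive y 1 (chi x) (- 2 * (y - b) * psi x y).
    by have := is_derive_comp_bump 0 (rho_y x y); rewrite mul0r subr0; exact.
  split.
  - by apply: is_derive_eq; rewrite /GRing.scale/= /Ux /X /Y; ring.
  - by apply: is_derive_eq; rewrite /GRing.scale/= /Uxx /X /Y; ring.
  - apply: is_derive_eq; rewrite /GRing.scale/= /Vx /X /Y.
    have -> : v2y x y = v1x x y - 2 * psi x y by lra.
    have -> : v1y x y = - v2x x y by lra.
    ring.
  - by apply: is_derive_eq; rewrite /GRing.scale/= /Uyy /X /Y; ring.
  - rewrite /Uxx /Uyy e1 e2 /X /Y.
    have -> : v1xx x y = v2yx x y - 4 * (x - a) * zeta x y by rewrite /X in c3; lra.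
    have -> : v2xx x y = - v1yx x y by lra.
    have -> : v1x x y = v2y x y + 2 * psi x y by lra.
    ring.
have dV x y : inside x y ->
   [/\ is_derive x 1 (V ^~ y) (Vx x y), is_derive x 1 (Vx ^~ y) (Vxx x y),
       is_derive y 1 (V x) (Ux x y), is_derive y 1 (Ux x) (Vyy x y) &
       Vxx x y + Vyy x y = 0].
  move=> xy; have xy' := on_inside x y xy.
  have [[a1 a2 a3 a4 a5] _] := dv1 x y xy'; have [[b1 b2 b3 b4 b5] _] := dv2 x y xy'.
  have [c1 c2] := CR x y xy'; have [c3 c4] := CRx x y xy.
  have [e1 e2] := (sym1 x y xy, sym2 x y xy).
  have p2 := psi_y x y.
  split.
  - by apply: is_derive_eq; rewrite /GRing.scale/= /Vx /X /Y; ring.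
  - by apply: is_derive_eq; rewrite /GRing.scale/= /Vxx /X /Y; ring.
  - apply: is_derive_eq; rewrite /GRing.scale/= /Ux /X /Y.
    have -> : v2y x y = v1x x y - 2 * psi x y by lra.
    have -> : v1y x y = - v2x x y by lra.
    ring.
  - by apply: is_derive_eq; rewrite /GRing.scale/= /Vyy /X /Y; ring.
  - rewrite /Vxx /Vyy e1 e2 /X /Y.
    have -> : v1xx x y = v2yx x y - 4 * (x - a) * zeta x y by rewrite /X in c3; lra.
    have -> : v2xx x y = - v1yx x y by lra.
    have -> : v1y x y = - v2x x y by lra.
    ring.
pose D2 := r ^+ 2 + (b + r) ^+ 2.
have D20 : 0 <= D2 by rewrite addr_ge0 ?sqr_ge0.
have cont x y : on_rect x y -> [/\ continuous2 U x y, continuous2 V x y & continuous2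
    q x y].
  move=> xy; have [_ [c1 _ _]] := dv1 x y xy; have [_ [c2 _ _]] := dv2 x y xy.
  have cX : continuous2 (fun x _ : R => X x) x y.
    by apply: (@continuous2_fst _ X); apply: continuousB; [exact: cvg_id|exact:
        cst_continuous].
  have cY : continuous2 (fun _ y : R => Y y) x y.
    by apply: (@continuous2_snd _ Y); apply: continuousB; [exact: cvg_id|exact:
        cst_continuous].
  split; last exact: q_cont.
  - by apply: continuous2D => //; apply: continuous2B; exact: continuous2M.
  - by apply: continuous2D; exact: continuous2M.
have on_bd x y : boundary x y ->
    (U x y * U x y + V x y * V x y) * expR (2 * q x y) <= D2 * (M ^+ 2 + m ^+ 2 *
        expR (2 * L)).
  move=> bd; have [xy side] := bd; have [/andP[x1 x2] /andP[y1 y2]] := xy.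
  (* No side enters the open disc, the base because [r < b]; so [chi] vanishes on the boundary. *)
  have XY : r ^+ 2 <= X x ^+ 2 + Y y ^+ 2.
    have X2 := sqr_ge0 (X x); have Y2 := sqr_ge0 (Y y).
    have Xr : x = a - r \/ x = a + r -> X x ^+ 2 = r ^+ 2 by rewrite /X => -[->|->];
        ring.
    case: side => E.
    - by rewrite Xr; [lra|left].
    - by rewrite Xr; [lra|right].
    - have : r ^+ 2 <= Y y ^+ 2.
        by rewrite /Y E sub0r sqrrN ler_sqr ?nnegrE; lra.
      by lra.
    - have -> : Y y ^+ 2 = r ^+ 2 by rewrite /Y E; ring.
      by lra.
  have Xle : X x ^+ 2 <= r ^+ 2.
    rewrite -[X x ^+ 2]real_normK ?num_real// ler_sqr ?nnegrE ?(ltW r0)// ler_norml /X.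
    by apply/andP; split; lra.
  have Yle : Y y ^+ 2 <= (b + r) ^+ 2.
    rewrite -[Y y ^+ 2]real_normK ?num_real// ler_sqr ?nnegrE//; last by lra.
    by rewrite ler_norml /Y; apply/andP; split; lra.
  have -> : U x y * U x y + V x y * V x y =
      (X x ^+ 2 + Y y ^+ 2) * (v1 x y * v1 x y + v2 x y * v2 x y).
    by rewrite /U /V chi0//; ring.
  have XY0 : 0 <= X x ^+ 2 + Y y ^+ 2 by rewrite addr_ge0 ?sqr_ge0.
  have vv0 : 0 <= v1 x y * v1 x y + v2 x y * v2 x y.
    by rewrite addr_ge0// -expr2 sqr_ge0.
  have XYD : X x ^+ 2 + Y y ^+ 2 <= D2 by rewrite /D2; lra.
  rewrite -mulrA; apply: ler_pM => //; first by rewrite mulr_ge0// expR_ge0.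
  have mm : 0 <= m ^+ 2 * expR (2 * L) by rewrite mulr_ge0 ?sqr_ge0 ?expR_ge0.
  have M2 : 0 <= M ^+ 2 := sqr_ge0 M.
  case: (q_boundary bd) => [[y0 qL]|q0].
    apply: (@le_trans _ _ (m ^+ 2 * expR (2 * L))); last by rewrite lerDr.
    apply: ler_pM; rewrite ?expR_ge0//.
      by rewrite y0; apply: vm; apply/andP.
    by rewrite ler_expR; lra.
  apply: (@le_trans _ _ (M ^+ 2)); last by rewrite lerDl.
  rewrite -[leRHS]mulr1; apply: ler_pM; rewrite ?expR_ge0//.
    exact: vM.
  by rewrite -[leRHS]expR0 ler_expR; lra.
have center : on_rect a b by split; apply/andP; split; lra.
have := weighted_max_principle (M := D2 * (M ^+ 2 + m ^+ 2 * expR (2 * L))) _ _ cont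
  (fun x y xy => And3 (dU x y xy) (dV x y xy) (dq x y)) on_bd center.
have -> : U a b = bump 0 (r ^+ 2).
  by rewrite /U /X /Y !subrr !mul0r subrr add0r /chi !subrr !expr0n/= !subr0.
have -> : V a b = 0 by rewrite /V /X /Y !subrr !mul0r addr0.
rewrite mul0r addr0 -expr2 /q !subrr mulr0 cos0 mulr1.
by apply; lra.
Qed.

End PlanarEstimate.

(** * Moments of smooth functions *)

Section Transfer.
Context {R : realType}.
Local Notation C := R[i]^o.
Local Notation E := (real_analytic R).
Local Notation Re := (@complex.Re R).
Local Notation Im := (@complex.Im R).

Let one_ge0 : forall j : nat, (0 : R) <= (fun=> 1) j. Proof. by []. Qed.

Let one_subexp (e : R) : 0 < e -> exists c, forall j : nat, (fun=> 1) j * expR (- e)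
    ^+ j <= c.
Proof.
move=> e0; exists 1 => j; rewrite mul1r exprn_ile1 ?expR_ge0//.
by rewrite -[leRHS]expR0 ler_expR oppr_le0 ltW.
Qed.

(** The constant weight gives one continuous seminorm above all moments, hence a bound of the
    moments of [u] in a corridor that is uniform in [j]. *)
Definition sup_moment : seminorm (ranalytic R) := ra_sup_moment one_ge0 one_subexp.

Lemma sup_moment_continuous : continuous (sup_moment : E -> R).
Proof. exact: ra_sup_moment_continuous. Qed.

Lemma normc_moment_le_sup j (f : ranalytic R) : normc (moment j f) <= sup_moment f.
Proof.
by have := ra_moment_le_sup one_ge0 one_subexp j f; rewrite mul1r.
Qed.

Lemma moment_addE j (f g : ranalytic R) :
  moment j (f + g : ranalytic R) = moment j f + moment j g.
Proof. by rewrite -momentD; [|exact: ranalytic_ccont|exact: ranalytic_ccont]. Qed.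

Lemma moment_scaleE j (a : R[i]) (f : ranalytic R) :
  moment j (a *: f : ranalytic R) = a * moment j f.
Proof. by rewrite -momentZ//; exact: ranalytic_ccont. Qed.

Lemma moment_subE j (f g : ranalytic R) :
  moment j (f - g : ranalytic R) = moment j f - moment j g.
Proof. by rewrite moment_addE -scaleN1r moment_scaleE mulN1r. Qed.

(** The factor [rho] covers both components at once: [1 / c] and [- i / c] give the real and
    imaginary parts of the moment divided by [c]. *)
Definition functional (rho : R[i]) j (f : E) : R :=
  Re (rho * moment j (f : ranalytic R)).

Lemma functional_continuous rho j : continuous (functional rho j : E -> R).
Proof.
move=> x; have xF := @nbhs_filter E x; apply/cvgrPdist_lt => e e0.
have rho0 : 0 < normc rho + 1 by rewrite ltr_wpDl ?normc_ge0.
have d0 : 0 < e / (normc rho + 1) by rewrite divr_gt0.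
have pP p : p \in [:: sup_moment] -> @projective_seminorms R p.
  by rewrite inE => /eqP ->; exact: ra_sup_moment_projective.
apply: (@filterS _ (nbhs (x : E)) _ _ _ _ (seminorm_ball_nbhs x pP d0)) => y /(_
    sup_moment (mem_head _ _)) yx.
rewrite /functional -ReB -mulrBr -moment_subE.
apply: le_lt_trans (normr_Re _) _; rewrite normcM.
have := normc_moment_le_sup j (x - y : ranalytic R); rewrite seminormBC => le1.
apply: (@le_lt_trans _ _ ((normc rho + 1) * sup_moment (y - x))).
  by apply: ler_pM le1; rewrite ?normc_ge0// lerDl.
by rewrite mulrC -ltr_pdivlMr.
Qed.

Lemma functional_quotient rho j (c : R) (x y : E) :
  functional rho j (c%:C *: (x - y)) = c * (functional rho j x - functional rho j y).
Proof.
rewrite /functional moment_scaleE moment_subE mulrCA -ReB -mulrBr ReM /=.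
by rewrite mul0r subr0.
Qed.

Lemma functional_pderiv1 rho j (f : C -> E) (x y : R) l : is_pderiv 1 f (x +i* y) l ->
  is_derive x 1 (fun t => functional rho j (f (t +i* y))) (functional rho j l).
Proof.
move=> fl.
have H : functional rho j (diff_quotient 1 f (x +i* y) h) @[h --> (0 : R)^'] -->
    functional rho j l.
  exact: (cvg_comp _ _ fl (@functional_continuous rho j l)).
suff H' : h^-1 *: (functional rho j (f ((h *: 1 + x) +i* y)) -
    functional rho j (f (x +i* y))) @[h --> (0 : R)^'] --> functional rho j l.
  by apply: DeriveDef; [apply/cvg_ex; exists (functional rho j l)|exact: cvg_lim H'].
rewrite (_ : (fun h => _) = (fun h => functional rho j (diff_quotient 1 f (x +i* y)
    h)))//.
apply/funext => h; rewrite /diff_quotient functional_quotient /GRing.scale/=.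
congr (_ * (functional rho j (f _) - _)); apply: eq_ReIm.
  by rewrite ReD ReM/= !mulr1 mul0r subr0 addrC.
by rewrite ImD ImM/= mulr0 mul0r !addr0.
Qed.

Lemma functional_pderivi rho j (f : C -> E) (x y : R) l : is_pderiv 'i%C f (x +i* y)
    l ->
  is_derive y 1 (fun t => functional rho j (f (x +i* t))) (functional rho j l).
Proof.
move=> fl.
have H : functional rho j (diff_quotient 'i%C f (x +i* y) h) @[h --> (0 : R)^'] -->
    functional rho j l.
  exact: (cvg_comp _ _ fl (@functional_continuous rho j l)).
suff H' : h^-1 *: (functional rho j (f (x +i* (h *: 1 + y))) -
    functional rho j (f (x +i* y))) @[h --> (0 : R)^'] --> functional rho j l.
  by apply: DeriveDef; [apply/cvg_ex; exists (functional rho j l)|exact: cvg_lim H'].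
rewrite (_ : (fun h => _) = (fun h => functional rho j (diff_quotient 'i%C f (x +i*
    y) h)))//.
apply/funext => h; rewrite /diff_quotient functional_quotient /GRing.scale/=.
congr (_ * (functional rho j (f _) - _)); apply: eq_ReIm.
  by rewrite ReD ReM/= mulr0 mul0r subr0 addr0.
by rewrite ImD ImM/= !mulr1 mul0r addr0 addrC.
Qed.

Lemma functional_continuous2 rho j (f : C -> E) (x y : R) :
  {for (x +i* y : C), continuous f} ->
  continuous2 (fun x y => functional rho j (f (x +i* y))) x y.
Proof.
move=> fc.
have pairc : (fun q : R * R => (q.1 +i* q.2 : C)) @ (x, y) --> (x +i* y : C).
  move=> A /nbhsC[e e0 eA]; apply/nbhs_ballP; exists (e / 2); first by rewrite /=
      divr_gt0.
  move=> [s t] [/=]; rewrite /ball/= => sx ty; apply: eA.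
  rewrite distrC in sx; rewrite distrC in ty.
  apply: le_lt_trans (normc_le_ReIm _) _; rewrite ReB ImB/=.
  by rewrite [e]splitr ltrD.
apply: (@cvg_comp _ _ _ (fun q : R * R => (q.1 +i* q.2 : C)) (functional rho j \o f)
    _ _ _ pairc).
exact: (cvg_comp _ _ fc (@functional_continuous rho j _)).
Qed.

Lemma smooth_functional (T : set C) (u : C -> E) rho j s (x y : R) :
  smooth_on T u -> T (x +i* y) ->
  let U s x y := functional rho j (iter_pderiv s u (x +i* y)) in
  [/\ is_derive x 1 (U s ^~ y) (U (false :: s) x y),
      is_derive y 1 (U s x) (U (true :: s) x y) & continuous2 (U s) x y].
Proof.
move=> us Txy U; have [uc u1 ui] := us s _ Txy; split.
- exact: functional_pderiv1 (pderivP u1).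
- exact: functional_pderivi (pderivP ui).
- exact: functional_continuous2.
Qed.

End Transfer.

(** * Corridors in the strip *)

Section Geometry.
Context {R : realType}.
Implicit Types (F G : R -> R) (W : nat -> R -> R).

Lemma strip_profile_gt0 F x : strip_profile F -> 0 < F x.
Proof.
move=> [F0 _ iF _]; apply: lt_le_trans iF _; apply: ge_inf; last by exists x.
by exists 0 => _ [t _ <-].
Qed.

Lemma unif_continuous_at F x : unif_continuous F -> {for x, continuous F}.
Proof.
move=> Fu; apply/cvgrPdist_lt => e e0.
have entF : entourage [set z : R * R | ball (F z.1) e (F z.2)].
  exact: (Fu _ (entourage_ball _ (PosNum e0))).
have := nbhs_entourage x entF; apply: filterS => y.
by rewrite /xsection /= inE.
Qed.

(** A disc close to the upper boundary of the strip, the top of a vertical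
    corridor that stays in a smaller strip. *)
Lemma corridor F (n : nat) : strip_profile F -> exists brq : R * R * R,
  let b := brq.1.1 in let r := brq.1.2 in let q := brq.2 in
  [/\ 0 < r <= 4^-1, r < b, 0 < q < 1 &
    forall x, `|x - n%:R| <= r -> (1 - n.+2%:R^-1) * F x < b - r /\ b + r < q * F x].
Proof.
move=> hF; have A0 := strip_profile_gt0 n%:R hF.
have Fc : {for (n%:R : R), continuous F}.
  by case: hF => _ /unif_continuous_at.
set A := F n%:R in A0; set c : R := n.+2%:R^-1.
have c0 : 0 < c by rewrite invr_gt0 ltr0n.
have c1 : c <= 2^-1 by rewrite lef_pV2 ?posrE ?ltr0n// ler_nat.
(* The centre has height [(1 - c / 2) * A], at least [c * A / 4] away from the levels [1 - c] and
   [1 - c / 4]; the slack [d] absorbs both the radius and the variation of [F]. *)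
pose d := c * A / 16.
have cA : c * A <= 2^-1 * A by rewrite ler_wpM2r// ltW.
have cA0 : 0 < c * A by rewrite mulr_gt0.
have d0 : 0 < d by rewrite /d; lra.
have /cvgrPdist_lt/(_ d d0)/nbhs_ballP[e /= e0 eF] := Fc.
pose r := Num.min (Num.min 4^-1 (e / 2)) d.
have r0 : 0 < r by rewrite !lt_min d0 divr_gt0// invr_gt0 ltr0n.
have r4 : r <= 4^-1 by rewrite !ge_min lexx.
have re : r <= e / 2 by rewrite !ge_min lexx orbT.
have rd : r <= d by rewrite !ge_min lexx !orbT.
exists (((1 - c / 2) * A, r), 1 - c / 4) => /=; split.
- by rewrite r0.
- by rewrite /d in rd; lra.
- by apply/andP; split; lra.
- move=> x xr; have xe : `|x - n%:R| < e by lra.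
  have := eF x; rewrite /ball/= distrC => /(_ xe); rewrite -/A ltr_norml => /andP[h1
      h2].
  have h3 : c * d <= 2^-1 * d by rewrite ler_wpM2r// ltW.
  have h4 : 0 < c * d by rewrite mulr_gt0.
  have h5 : (1 - c) * F x <= (1 - c) * (A + d) by apply: ler_wpM2l; lra.
  have h6 : (1 - c / 4) * (A - d) <= (1 - c / 4) * F x by apply: ler_wpM2l; lra.
  rewrite /d in rd h3 h4 h5 h6 *; split; lra.
Qed.

(** Weights are non-negative, so their exponential is at least 1 and plain boundedness follows. *)
Lemma weighted_bound F G W (u : R[i]^o -> real_analytic R) (p : seminorm
    (real_analytic R)) q :
  weight_system W -> weighted_space W F G u -> continuous (p : real_analytic R -> R) ->
  0 < q < 1 -> exists2 B, 0 <= B & forall z,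
    strip (fun t => q * F t) (fun t => q * G t) z -> p (u z) <= B.
Proof.
move=> hW [_ uW] pc q01; have [B uB] := uW p pc 0%N (0%N, 0%N) q q01.
exists `|B| => // z zq; apply: le_trans (ler_norm _); apply: (@le_trans _ _ _ _ _ _
    (uB _ _)); last first.
  by exists z; [exact: subset_closure|reflexivity].
rewrite ler_peMl ?seminorm_ge0//.
rewrite -expR0 ler_expR; have [W0 _ _] := hW.1 0%N; exact: W0.
Qed.

End Geometry.

(** * The planar estimate applied to the moments of a solution *)

Section CorridorEstimate.
Context {R : realType}.
Local Notation C := R[i]^o.
Local Notation E := (real_analytic R).
Local Notation Re := (@complex.Re R).
Local Notation Im := (@complex.Im R).

Lemma moment_dbar j (u : C -> E) z : moment j (dbar u z : ranalytic R) =
  2^-1 * (moment j (pderiv 1 u z : ranalytic R) +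
          'i * moment j (pderiv 'i%C u z : ranalytic R)).
Proof. by rewrite /dbar moment_scaleE moment_addE moment_scaleE. Qed.

Lemma cauchy_riemann_components (c P Q : R[i]) (w : R) : c != 0 ->
  2^-1 * (P + 'i * Q) = w%:C * c ->
  Re (c^-1 * P) - Im (c^-1 * Q) = 2 * w /\ Im (c^-1 * P) + Re (c^-1 * Q) = 0.
Proof.
move=> c0 E.
have n2 : (2 : R[i]) != 0 by rewrite pnatr_eq0.
have PQ : c^-1 * P + 'i * (c^-1 * Q) = (2 * w)%:C.
  rewrite rmorphM /= rmorph_nat -[w%:C](mulfK c0) -E.
  by move: ('i : R[i]) => k; field.
have := congr1 Re PQ; have := congr1 Im PQ.
by rewrite !ReD !ImD Re_i Im_i /= => h1 h2; split.
Qed.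

(** The planar estimate is applied to the moment of [u] divided by that of [g]: its [dbar] is the
    real bump itself, and both bounds [M] and [m] are divided by the same modulus. *)
Lemma corridor_estimate (T : set C) (u : C -> E) (g : ranalytic R) j (a b r L M m : R) :
  0 < r -> r < b -> 0 <= L -> 0 <= m -> moment j g != 0 ->
  smooth_on T u ->
  (forall x y, rect_mem (a - r) (a + r) 0 (b + r) x y -> T (x +i* y) /\
     dbar u (x +i* y) = (bump 2 (r ^+ 2 - (x - a) ^+ 2 - (y - b) ^+ 2))%:C *: (g :
         E)) ->
  (forall x y, rect_mem (a - r) (a + r) 0 (b + r) x y ->
     normc (moment j (u (x +i* y) : ranalytic R)) <= M) ->
  (forall x, normc (moment j (u (x +i* 0) : ranalytic R)) <= m) ->
  (bump 0 (r ^+ 2) * normc (moment j g)) ^+ 2 * expR (2 * (L * gain b r)) <=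
    (r ^+ 2 + (b + r) ^+ 2) * (M ^+ 2 + m ^+ 2 * expR (2 * L)).
Proof.
move=> r0 rb L0 m0 g0 us ueq uM um.
set c := moment j g in g0 *; pose N := normc c.
have N0 : 0 < N.
  by rewrite lt_neqAle normc_ge0 andbT eq_sym; apply: contra_neq g0 => /eq0_normc.
pose U rho s x y := functional rho j (iter_pderiv s u (x +i* y)).
pose k1 : R[i] := c^-1; pose k2 : R[i] := - 'i * c^-1.
have U1E s x y : U k1 s x y = Re (c^-1 * moment j (iter_pderiv s u (x +i* y) :
    ranalytic R)).
  by [].
have U2E s x y : U k2 s x y = Im (c^-1 * moment j (iter_pderiv s u (x +i* y) :
    ranalytic R)).
  by rewrite /U /functional /k2 -mulrA mulNr ReN Re_i opprK.
have modulus x y : U k1 [::] x y * U k1 [::] x y + U k2 [::] x y * U k2 [::] x y =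
    (normc (moment j (u (x +i* y) : ranalytic R)) / N) ^+ 2.
  by rewrite U1E U2E -!expr2 -sqr_normc_ReIm normcM normcV mulrC.
have jet rho x y : rect_mem (a - r) (a + r) 0 (b + r) x y ->
  second_jet (U rho [::]) (U rho [:: false]) (U rho [:: true])
    (U rho [:: false; false]) (U rho [:: true; false]) (U rho [:: false; true]) x y.
  move=> /ueq[Txy _].
  have S s := @smooth_functional R T u rho j s x y us Txy.
  have [a1 a2 a3] := S [::]; have [b1 b2 _] := S [:: false].
  have [c1 _ _] := S [:: true]; have [_ _ d3] := S [:: true; false].
  have [_ _ e3] := S [:: false; true].
  split; split; [exact: a1|exact: a2|exact: b1|exact: b2|exact: c1|
    exact: a3|exact: d3|exact: e3].
have H := planar_estimate (M := M / N) (m := m / N) r0 rb L0 (jet k1) (jet k2).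
have {H}H : bump 0 (r ^+ 2) ^+ 2 * expR (2 * (L * gain b r)) <=
    (r ^+ 2 + (b + r) ^+ 2) * ((M / N) ^+ 2 + (m / N) ^+ 2 * expR (2 * L)).
  apply: H => [x y xy|x y xy|x x1].
  - have [_ eqxy] := ueq x y xy; rewrite !U1E !U2E.
    apply: cauchy_riemann_components g0 _.
    by rewrite -moment_dbar eqxy moment_scaleE.
  - rewrite modulus lerXn2r ?nnegrE ?divr_ge0 ?normc_ge0 ?(ltW N0)//.
      exact: le_trans (normc_ge0 _) (uM x y xy).
    by rewrite ler_pM2r ?invr_gt0// uM.
  - rewrite modulus lerXn2r ?nnegrE ?divr_ge0 ?normc_ge0 ?(ltW N0)//.
    by rewrite ler_pM2r ?invr_gt0// um.
rewrite exprMn mulrAC.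
have N20 : 0 < N ^+ 2 by rewrite exprn_gt0.
rewrite -ler_pdivlMr//; apply: le_trans H _.
rewrite !expr_div_n le_eqVlt; apply/orP; left; apply/eqP.
by rewrite [m ^+ 2 / _ * _]mulrAC -mulrDl mulrA.
Qed.

End CorridorEstimate.

(** * Non-surjectivity *)

Lemma mul_exp_decay_le {R : realType} (d : R) j : 0 < d ->
  j%:R * expR (- d) ^+ j <= d^-1.
Proof.
move=> d0; rewrite -expRM_natl mulrN expRN ler_pdivrMr ?expR_gt0//.
rewrite ler_pdivlMl//; apply: le_trans (expR_ge1Dx _).
by rewrite mulrC lerDr.
Qed.

Theorem corollary3p13 (R : realType) (F G : R -> R) (W : nat -> R -> R)
    (hF : strip_profile F) (hG : strip_profile G) (hW : weight_system W) :
  ~ (forall f : R[i]^o -> real_analytic R,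
       weighted_space W F G f ->
       exists2 u : R[i]^o -> real_analytic R,
         weighted_space W F G u &
         forall z : R[i]^o, strip F G z -> dbar u z = f z).
Proof.
move=> surj.
have [b [r [q brqP]]] : exists b r q : nat -> R, forall n,
    [/\ 0 < r n <= 4^-1, r n < b n, 0 < q n < 1 & forall x, `|x - n%:R| <= r n ->
      (1 - n.+2%:R^-1) * F x < b n - r n /\ b n + r n < q n * F x].
  have [brq brqP] := choice (fun n => corridor n hF).
  by exists (fun n => (brq n).1.1), (fun n => (brq n).1.2), (fun n => (brq n).2).
have r0 n : 0 < r n by have [/andP[]] := brqP n.
have r4 n : r n <= 4^-1 by have [/andP[]] := brqP n.
have rb n : r n < b n by have [] := brqP n.
have q01 n : 0 < q n < 1 by have [] := brqP n.
have Fbounds n x : `|x - n%:R| <= r n ->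
    (1 - n.+2%:R^-1) * F x < b n - r n /\ b n + r n < q n * F x.
  by have [_ _ _] := brqP n; exact.
have F0 x : 0 < F x := strip_profile_gt0 x hF.
have G0 x : 0 < G x := strip_profile_gt0 x hG.
(* The offset 4 gives [sig n * rate n <= 1 / 4], hence [lam n >= 3 / 4], in the range where an
   eigenfunction is available. *)
pose rate n : R := n.+4%:R^-1.
have rate0 n : 0 < rate n by rewrite invr_gt0 ltr0n.
have rate4 n : rate n <= 4^-1 by rewrite lef_pV2 ?posrE ?ltr0n// ler_nat.
pose sig n := gain (b n) (r n).
have sig0 n : 0 < sig n by exact: gain_gt0.
have sig1 n : sig n <= 1 by exact: gain_le1.
pose lam n := expR (- (sig n * rate n)).
have lamP n : 2 / 3 <= lam n < 1.
  apply/andP; split; last first.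
    by rewrite -[ltRHS]expR0 ltr_expR oppr_lt0 mulr_gt0.
  apply: le_trans (expR_ge1Dx _).
  have : sig n * rate n <= 1 * 4^-1 by apply: ler_pM => //; exact: ltW.
  lra.
have [g gP] := choice (fun n => moment_eigenfunction (lamP n)).
have disc n x y : (x - n%:R) ^+ 2 + (y - b n) ^+ 2 < r n ^+ 2 ->
    (1 - n.+2%:R^-1) * F x < y.
  move=> xy.
  have small t : t ^+ 2 < r n ^+ 2 -> `|t| < r n.
    by rewrite -[t ^+ 2]real_normK ?num_real// ltr_sqr ?nnegrE// ltW.
  have /ltW/Fbounds[h _] : `|x - n%:R| < r n.
    by apply: small; have := sqr_ge0 (y - b n); lra.
  have : `|y - b n| < r n by apply: small; have := sqr_ge0 (x - n%:R); lra.
  rewrite ltr_norml => /andP[h1 h2]; apply: lt_trans h _.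
  by clear -h1; move: (b n) (r n) h1 => b' r'; lra.
(* [Bump 2] because the planar estimate needs the derivative of [bump 0] on the right-hand side. *)
have [u uW uE] := surj _ (bump_sum_weighted g r0 r4 G hW F0 disc (Bump 2)).
have half : 0 < (2^-1 : R) < 1 by rewrite invr_gt0 ltr0n invf_lt1 ?ltr1n ?ltr0n.
have real_strip (q' x : R) : 0 < q' -> strip (fun t => q' * F t) (fun t => q' * G t)
    (x +i* 0).
  by move=> q0; rewrite /strip /= oppr_lt0 !mulr_gt0.
pose v x : ranalytic R := u (x +i* 0).
have [M0 M00 uM0] := weighted_bound hW uW sup_moment_continuous half.
have v_ub j : has_ubound (range (fun x => normc (moment j (v x)))).
  exists M0 => _ [x _ <-]; apply: le_trans (normc_moment_le_sup j _) _.
  by apply: uM0; apply: real_strip; rewrite invr_gt0.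
pose m j := sup (range (fun x => normc (moment j (v x)))).
have vm j x : normc (moment j (v x)) <= m j.
  by apply: ub_le_sup => //; exists x.
have m_ge0 j : 0 <= m j by exact: le_trans (normc_ge0 _) (vm j 0).
have m_lower n : exists2 e, 0 < e & forall j, e * expR (- rate n) ^+ j <= m j.
  have [M1 M10 uM1] := weighted_bound hW uW sup_moment_continuous (q01 n).
  have [g0 gj] := gP n.
  pose N := normc (moment 0 (g n)).
  have N0 : 0 < N.
    by rewrite lt_neqAle normc_ge0 andbT eq_sym; apply: contra_neq g0 => /eq0_normc.
  have gN j : normc (moment j (g n)) = lam n ^+ j * N.
    by rewrite gj normcM normcX normc_real ger0_norm ?expR_ge0.
  pose D := r n ^+ 2 + (b n + r n) ^+ 2.
  have D0 : 0 < D by rewrite ltr_wpDr ?sqr_ge0// exprn_gt0.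
  pose A := (bump 0 (r n ^+ 2) * N) ^+ 2 / D.
  have A0 : 0 < A.
    by rewrite divr_gt0// exprn_gt0// mulr_gt0// bump_gt0// exprn_gt0.
  (* With [L = j * rate n + B], the factor [lam n ^+ j] squared cancels the [j] part of
     [expR (2 * (L * sig n))], leaving [A * expR (2 * (sig n * B))]. As [expR t >= t], this is at
     least [2 * (M1 ^+ 2 + 1)], more than the term [M1 ^+ 2] can account for, so that
     [m j * expR L >= 1]. *)
  pose B := (M1 ^+ 2 + 1) / (A * sig n).
  have B0 : 0 <= B.
    by rewrite divr_ge0 ?addr_ge0 ?sqr_ge0// mulr_ge0// ltW.
  exists (expR (- B)); first exact: expR_gt0.
  move=> j; pose L := j%:R * rate n + B.
  have L0 : 0 <= L by rewrite addr_ge0// mulr_ge0// ltW.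
  have mg0 : moment j (g n) != 0.
    rewrite gj mulf_neq0// expf_neq0//.
    by apply/eqP => /(congr1 (@complex.Re R)) /= /eqP; rewrite gt_eqF// expR_gt0.
  have local_f x y : rect_mem (n%:R - r n) (n%:R + r n) 0 (b n + r n) x y ->
    strip (fun t => q n * F t) (fun t => q n * G t) (x +i* y) /\
    (strip F G (x +i* y) /\ dbar u (x +i* y) =
     (bump 2 (r n ^+ 2 - (x - n%:R) ^+ 2 - (y - b n) ^+ 2))%:C *: (g n :
         real_analytic R)).
    move=> [/andP[x1 x2] /andP[y1 y2]].
    have xn : `|x - n%:R| <= r n by rewrite ler_norml; apply/andP; split; lra.
    have [_ yF] := Fbounds n x xn.
    have /andP[q0 q1] := q01 n.
    have yq : y < q n * F x by exact: le_lt_trans y2 yF.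
    have qF : q n * F x < F x by rewrite gtr_pMl.
    have yG q' : 0 < q' -> - (q' * G x) < y.
      by move=> q'0; apply: lt_le_trans y1; rewrite oppr_lt0 mulr_gt0.
    have inT : strip F G (x +i* y).
      by rewrite /strip /= -[G x]mul1r yG// (lt_trans yq).
    split; first by rewrite /strip /= yG.
    split=> //; rewrite uE// (@bump_sumE R b r g r0 r4 n (Bump 2) (x +i* y)) //=.
      by have := r4 n; rewrite ler_norml in xn; move/andP: xn => [? ?]; lra.
    by move=> _; have := r4 n; rewrite ler_norml in xn; move/andP: xn => [? ?]; lra.
  have := @corridor_estimate R (strip F G) u (g n) j n%:R (b n) (r n) L M1 (m j)
    (r0 n) (rb n) L0 (m_ge0 j) mg0 uW.1 (fun x y xy => (local_f x y xy).2)
    (fun x y xy => le_trans (normc_moment_le_sup j _) (uM1 _ (local_f x y xy).1))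
    (vm j).
  rewrite gN -/D -/(sig n) => est.
  have {}est : A * expR (2 * (sig n * B)) <= M1 ^+ 2 + (m j * expR L) ^+ 2.
    have E : expR (2 * (sig n * B)) = (lam n ^+ j) ^+ 2 * expR (2 * (L * sig n)).
      rewrite -[lam n ^+ j]expRM_natl -[expR _ ^+ 2]expRM_natl -expRD.
      by congr expR; rewrite /L; ring.
    have -> : A * expR (2 * (sig n * B)) =
        (bump 0 (r n ^+ 2) * (lam n ^+ j * N)) ^+ 2 * expR (2 * (L * sig n)) / D.
      by rewrite E /A; ring.
    by rewrite ler_pdivrMr// [leRHS]mulrC [(m j * _) ^+ 2]exprMn -[expR L ^+
        2]expRM_natl.
  have big : M1 ^+ 2 + 1 <= A * expR (2 * (sig n * B)).
    have h : A * (2 * (sig n * B)) <= A * expR (2 * (sig n * B)).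
      rewrite ler_wpM2l ?ltW//; apply: lt_le_trans (expR_ge1Dx _); lra.
    apply: le_trans h.
    have -> : A * (2 * (sig n * B)) = 2 * (M1 ^+ 2 + 1).
      by rewrite /B; field; rewrite !gt_eqF.
    by have := sqr_ge0 M1; lra.
  have : 1 <= m j * expR L.
    rewrite -(@ler_sqr R) ?nnegrE ?mulr_ge0 ?expR_ge0// expr1n; lra.
  rewrite -ler_pdivrMr ?expR_gt0// mul1r -expRN; apply: le_trans.
  by rewrite -expRM_natl -expRD /L opprD mulrN addrC.
have m_gt0 j : 0 < m j.
  have [e e0 em] := m_lower 0%N; apply: lt_le_trans (em j).
  by rewrite mulr_gt0// exprn_gt0// expR_gt0.
pose w j := j%:R / m j.
have w0 j : 0 <= w j by rewrite divr_ge0// ltW.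
have w_subexp e : 0 < e -> exists c, forall j, w j * expR (- e) ^+ j <= c.
  (* The rate of disc [n] is at most [e / 2]: one half of the decay pays for [1 / m j], the other
     half for the factor [j]. *)
  move=> e0; pose n := Num.bound (2 / e).
  have ne : rate n <= e / 2.
    rewrite -[e / 2]invrK lef_pV2 ?posrE ?invr_gt0 ?divr_gt0 ?ltr0n// invf_div.
    apply: ltW; apply: lt_le_trans (archi_boundP _) _; first by rewrite divr_ge0// ltW.
    by rewrite ler_nat -addn4 leq_addr.
  have [d d0 dm] := m_lower n.
  exists (d^-1 * (rate n)^-1) => j.
  have q0 : 0 < expR (- rate n) ^+ j by rewrite exprn_gt0// expR_gt0.
  rewrite /w mulrAC ler_pdivrMr//.
  apply: (@le_trans _ _ (d^-1 * (rate n)^-1 * (d * expR (- rate n) ^+ j))); last first.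
    by rewrite ler_pM2l// mulr_gt0 ?invr_gt0.
  rewrite mulrACA mulVf ?gt_eqF// mul1r.
  apply: (@le_trans _ _ (j%:R * (expR (- rate n) ^+ j * expR (- rate n) ^+ j))).
    rewrite ler_wpM2l// -exprMn -expRD lerXn2r ?nnegrE ?expR_ge0// ler_expR; lra.
  by rewrite mulrA ler_wpM2r ?(ltW q0)// mul_exp_decay_le.
have pc := @ra_sup_moment_continuous R w w0 w_subexp.
have [B B0 uB] := weighted_bound hW uW pc half.
(* The seminorm bounds [w j] times each [|mu_j (u x)|] by [B]; taking the supremum over real [x]
   gives [w j * m j = j]. The case [j = 0] is apart only because of the division by [j]. *)
have bound j : j%:R <= B.
  case: j => [|j]; first exact: B0.
  rewrite -(ler_pM2r (m_gt0 j.+1)) -ler_pdivlMl ?ltr0n//.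
  apply: ge_sup; first by exists (normc (moment j.+1 (v 0))), 0.
  move=> _ [x _ <-]; rewrite ler_pdivlMl ?ltr0n//.
  rewrite -ler_pdivrMr// mulrAC.
  apply: le_trans (ra_moment_le_sup w0 w_subexp j.+1 (v x)) _.
  by apply: uB; apply: real_strip; rewrite invr_gt0.
have := bound (Num.bound B); rewrite leNgt => /negP; apply.
exact: archi_boundP.
Qed.
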